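(* For integers $n\geq 1$, let $\mathfrak{S}_n$ and $A_n$ be the symmetric and alternating groups on $n$ letters. Then, for all $n\geq 1$, $$c(\mathfrak{S}_n)\asymp 1,\qquad c(A_n)\asymp 1,\qquad c_2(\mathfrak{S}_n)\asymp 1,\qquad c_2(A_n)\asymp 1,$$ i.e., each of these quantities is bounded above and below by positive constants independent of $n$. In fact, there exists a constant $c>1$ such that, for all $n\geq 1$, $$\mathbf{E}(c^{\tau_{\mathfrak{S}_n}})\ll 1,\qquad \mathbf{E}(c^{\tau_{A_n}})\ll 1,$$ i.e., these exponential moments are bounded by a constant independent of $n$.
   Context: For a finite group $G$, a tuple $(C_1,\ldots,C_m)$ of conjugacy classes of $G$ is said to generate $G$ if, for every choice of representatives $g_i\in C_i$ ($1\leq i\leq m$), the elements $g_1,\ldots,g_m$ generate $G$. Let $(X_n)_{n\geq 1}$ be a sequence of independent, uniformly distributed $G$-valued random variables and let $X_n^{\sharp}$ be the conjugacy class of $X_n$ in $G$. The waiting time is $$\tau_G=\min\{n\geq 1 \mid (X_1^{\sharp},\ldots,X_n^{\sharp})\text{ generates } G\}\in[1,+\infty]$$ (so $\tau_G=1$ if $G$ is trivial). The Chebotarev invariant and secondary Chebotarev invariant of $G$ are $c(G)=\mathbf{E}(\tau_G)$ and $c_2(G)=\mathbf{E}(\tau_G^2)$. *)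

(* Defs.v *)
From mathcomp Require Import all_boot all_order all_algebra all_fingroup all_solvable.
From mathcomp Require Import all_classical all_reals all_analysis.

Set Implicit Arguments.
Unset Strict Implicit.
Unset Printing Implicit Defensive.

Import Order.TTheory GRing.Theory Num.Theory.

Local Open Scope classical_set_scope.
Local Open Scope ring_scope.

Definition classes_generate (gT : finGroupType) (G : {group gT}) (n : nat)
    (C : 'I_n -> {set gT}) : Prop :=
  forall g : 'I_n -> gT, (forall i, g i \in C i) ->
    <<[set x in codom g]%SET>>%g = G :> {set gT}.

(* The whole event algebra of the finite set gT is used: A i is arbitrary. *)
Definition mutually_independent (R : realType) (d : measure_display)
    (T : measurableType d) (P : probability T R) (gT : finGroupType)
    (X : nat -> T -> gT) : Prop :=
  forall (J : seq nat) (A : nat -> set gT), uniq J ->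
    P (\bigcap_(i in [set` J]) (X i @^-1` A i)) =
    (\prod_(i <- J) P (X i @^-1` A i))%E.

(* A probability space carrying independent uniformly distributed G-valued
   random variables; the sequence is indexed from 0, so that [sample S n] is
   the variable X_{n+1}. *)
Record uniform_sequence (R : realType) (gT : finGroupType) (G : {group gT}) :=
  UniformSequence {
    disp : measure_display;
    space : measurableType disp;
    law : probability space R;
    sample : nat -> space -> gT;
    sample_in : forall n w, sample n w \in G;
    sample_measurable : forall n x, measurable (sample n @^-1` [set x]);
    sample_uniform : forall n x, x \in G ->
          law (sample n @^-1` [set x]) = ((#|G|%:R : R)^-1)%:E;
    sample_independent : mutually_independent law sample
  }.

Arguments law {R gT G} u.
Arguments sample {R gT G} u n w.

Section ChebotarevInvariants.
Context (R : realType) (gT : finGroupType) (G : {group gT}).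
Variable S : uniform_sequence R G.

(* The infimum of the empty set is +oo; otherwise this is a minimum. *)
Definition waiting_time (w : space S) : \bar R :=
  ereal_inf [set (n%:R : R)%:E | n in
    [set n : nat | (0 < n)%N /\
      classes_generate G (fun i : 'I_n => (sample S i w ^: G)%g)]].

Definition chebotarev : \bar R := (\int[law S]_w waiting_time w)%E.

Definition chebotarev2 : \bar R :=
  (\int[law S]_w (waiting_time w * waiting_time w))%E.

(* c ^ t for a base c > 1 and an extended exponent t. *)
Definition expe_base (c : R) (t : \bar R) : \bar R :=
  match t with
  | r%:E => (c `^ r)%:E
  | +oo%E => +oo%E
  | -oo%E => 0%E
  end.

Definition chebotarev_exp (c : R) : \bar R :=
  (\int[law S]_w expe_base c (waiting_time w))%E.

End ChebotarevInvariants.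

(* Main.v *)
(* It is enough to find K and d > 0, uniform in the degree n, such that a
   random K-tuple generates invariably with probability at least d: the number
   of blocks of K samples that are needed is then dominated by a geometric
   variable, and every moment follows from an exponential one.

   For large n take K = 27.  One even permutation has no cycle of length at
   most L; 24 others have a fixed point each, but no common size l of a fixed
   set with L <= l <= n/2; one more has a cycle whose length is a prime
   p >= L and no other cycle of length divisible by p; the last one is odd
   unless the group is alternating.  The subgroup generated by any conjugates
   of these is transitive.  It is primitive: a power of the p-cycle forces the
   blocks to have at least p >= L points, and a block through a fixed point is
   a fixed set.  By Jordan's theorem it contains the alternating group.

   The probabilities come from cycle-weight averages h_n, with
   n h_n = sum_j w_j h_(n-j).  A permutation has a fixed l-set with
   probability O(l^(-0.084)): weigh its cycles of length at most l by 3/2 if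
   there are at least log_2 l of them, and by 3/4 otherwise; the 24th power is
   summable in l.  The lone prime cycle is found by truncated inclusion-exclusion
   over primes in a window (A, B] with A of the order of log n, on which the
   sum of 1/p is bounded below thanks to Euler's product. *)
From mathcomp Require Import all_boot all_order all_algebra all_fingroup all_solvable.
From mathcomp Require Import zify ring lra.

Set Implicit Arguments.
Unset Strict Implicit.
Unset Printing Implicit Defensive.

Import Order.TTheory GRing.Theory Num.Theory.
Local Open Scope ring_scope.

(** * Permutations split along an invariant set or along one cycle *)

Section Splitting.
Variable T : finType.
Implicit Types (A C D : {set T}) (s : {perm T}).

(** The union bound over [l] must stay below $(1/8)^{24}/2$, half of the proportion guaranteed for
    24 even permutations with a fixed point each. This forces [L] to be large, which is why sizes
    below [L] are left to the long cycles (for invariant sets) and to the prime [p] (for blocks). As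
    [L] is an absolute constant, having only cycles longer than [L] keeps a positive probability.
    The threshold $\log_2 l$ arises because [C] cycles have only $2^C$ unions, while a permutation
    typically has about $\log l$ cycles of length at most [l]. A weight [z] on these cycles has an
    average of order $l^{z-1}$, or $l^{2(z-1)}$ once a fixed [l]-set is marked; with 3/2 and 3/4
    both cases decay like $l^{1/2-\log_2(3/2)}$. Even permutations fill all the slots but the last
    one because they lie in both groups; they are counted by averages twisted by the sign. In the
    finitely many remaining degrees, a block that lists the whole group is enough, since the
    conjugates of a proper subgroup never cover a finite group. *)

Lemma perm_onX C s i : perm_on C s -> perm_on C (s ^+ i)%g.
Proof.
move=> sC; elim: i => [|i IHi]; first by rewrite expg0 perm_on1.
by rewrite expgS perm_onM.
Qed.

Lemma porbit_mull C D s1 s2 x : [disjoint C & D] ->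
  perm_on C s1 -> perm_on D s2 -> x \in C -> porbit (s1 * s2)%g x = porbit s1 x.
Proof.
move=> dCD s1C s2D xC.
have com : commute s1 s2 by apply: perm_onC s1C s2D dCD.
have E i : ((s1 * s2) ^+ i)%g x = (s1 ^+ i)%g x.
  rewrite expgMn // permM (out_perm (perm_onX i s2D)) //.
  by rewrite (disjointFr dCD) // perm_closed // perm_onX.
apply/setP => y; apply/idP/idP => /porbitP[i ->]; first by rewrite E mem_porbit.
by rewrite -E mem_porbit.
Qed.

Lemma porbit_mulr C D s1 s2 x : [disjoint C & D] ->
  perm_on C s1 -> perm_on D s2 -> x \in D -> porbit (s1 * s2)%g x = porbit s2 x.
Proof.
move=> dCD s1C s2D xC; rewrite (perm_onC s1C s2D dCD).
by apply: porbit_mull s2D s1C xC; rewrite disjoint_sym.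
Qed.

Lemma porbit_sub A s x : perm_on A s -> x \in A -> porbit s x \subset A.
Proof.
move=> sA xA; apply/subsetP => y /porbitP[i ->].
by rewrite perm_closed // perm_onX.
Qed.

Lemma disjoint_setDr A C : [disjoint C & A :\: C].
Proof. by rewrite disjoint_sym disjoints_subset subsetDr. Qed.

Lemma restr_permEin C s x : s @: C = C -> x \in C -> restr_perm C s x = s x.
Proof.
move=> sC xC; apply: restr_permE => //.
apply/astabsP => y /=; rewrite apermE -{1}sC mem_imset //; exact: perm_inj.
Qed.

Lemma imset_setD A C s : perm_on A s -> s @: C = C ->
  s @: (A :\: C) = A :\: C.
Proof.
move=> sA sC; apply/eqP; rewrite eqEcard card_imset ?leqnn ?andbT; last exact: perm_inj.
apply/subsetP => _ /imsetP[y /setDP[yA yC] ->]; rewrite inE (perm_closed _ sA) yA andbT.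
by rewrite -sC mem_imset //; exact: perm_inj.
Qed.

(** A permutation that preserves [C] is, in a unique way, a permutation of [C] times one of
    [A :\: C]; [restr_perm] inverts the product. *)
Lemma sum_perm_on_split (V : nmodType) A C (F : {perm T} -> V) : C \subset A ->
  \sum_(s | perm_on A s && (s @: C == C)) F s =
  \sum_(s1 | perm_on C s1) \sum_(s2 | perm_on (A :\: C) s2) F (s1 * s2)%g.
Proof.
move=> CA; rewrite pair_big /=.
rewrite (reindex_onto (fun p : {perm T} * {perm T} => (p.1 * p.2)%g)
  (fun s => (restr_perm C s, restr_perm (A :\: C) s))) /=; last first.
  move=> s /andP[sA /eqP sC]; apply/permP => x; rewrite permM /=.
  have [xC|xC] := boolP (x \in C).
    rewrite (restr_permEin sC xC) (out_perm (restr_perm_on _ _)) //.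
    by rewrite inE -{1}sC mem_imset ?xC //; exact: perm_inj.
  rewrite [restr_perm C s x](out_perm (restr_perm_on _ _)) //.
  have [xA|xA] := boolP (x \in A).
    by rewrite restr_permEin ?imset_setD // inE xC.
  by rewrite (out_perm (restr_perm_on _ _)) ?(out_perm sA) // inE negb_and xA orbT.
apply: eq_bigl => -[s1 s2] /=; have dCD := disjoint_setDr A C.
apply/idP/idP => [/andP[/andP[_ _] /eqP[<- <-]]|/andP[s1C s2D]].
  by rewrite !restr_perm_on.
have s1A : perm_on A s1 by apply: subset_trans s1C CA.
have s2A : perm_on A s2 by apply: subset_trans s2D (subsetDl _ _).
have im : (s1 * s2)%g @: C = C.
  apply/eqP; rewrite eqEcard card_imset ?leqnn ?andbT; last exact: perm_inj.
  apply/subsetP => _ /imsetP[y yC ->]; have s1y : s1 y \in C by rewrite perm_closed.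
  by rewrite permM (out_perm s2D) // (disjointFr dCD).
rewrite perm_onM //= im eqxx /=; apply/eqP; congr (_, _); apply/permP => x.
  have [xC|xC] := boolP (x \in C).
    rewrite restr_permEin // permM (out_perm s2D) //.
    by rewrite (disjointFr dCD) // perm_closed.
  by rewrite (out_perm (restr_perm_on _ _)) // (out_perm s1C).
have [xD|xD] := boolP (x \in A :\: C).
  rewrite restr_permEin // ?imset_setD ?perm_onM // permM (out_perm s1C) //.
  by rewrite (disjointFl dCD).
by rewrite (out_perm (restr_perm_on _ _)) // (out_perm s2D).
Qed.

Lemma imset_porbit s x : s @: porbit s x = porbit s x.
Proof.
apply/eqP; rewrite eqEcard card_imset ?leqnn ?andbT; last exact: perm_inj.
apply/subsetP => _ /imsetP[_ /porbitP[i ->] ->].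
by rewrite -permM -expgSr mem_porbit.
Qed.

(** Having orbit [C] at [x] entails preserving [C] and concerns only the factor on [C]; the factor
    on the complement stays free. *)
Lemma sum_perm_on_porbit (V : nmodType) A C x (F : {perm T} -> V) :
    C \subset A -> x \in C ->
  \sum_(s | perm_on A s && (porbit s x == C)) F s =
  \sum_(s1 | perm_on C s1 && (porbit s1 x == C))
    \sum_(s2 | perm_on (A :\: C) s2) F (s1 * s2)%g.
Proof.
move=> CA xC; transitivity (\sum_(s | perm_on A s && (s @: C == C))
    (if porbit s x == C then F s else 0)).
  rewrite -big_mkcondr /=; apply: eq_bigl => s; rewrite -andbA; congr (_ && _).
  by case: eqP => [<-|]; rewrite ?andbF // imset_porbit eqxx.
rewrite sum_perm_on_split // big_mkcondr; apply: eq_bigr => s1 s1C.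
case: eqP => [E|E]; last rewrite big1 //; last first.
  by move=> s2 s2D; rewrite (porbit_mull (disjoint_setDr A C)) //; case: eqP.
by apply: eq_bigr => s2 s2D; rewrite (porbit_mull (disjoint_setDr A C)) // E eqxx.
Qed.

Lemma card_pointed_sub A x k : x \in A ->
  #|[set C : {set T} | [&& x \in C, C \subset A & #|C| == k.+1]]| = 'C(#|A|.-1, k).
Proof.
move=> xA; have -> : #|A|.-1 = #|A :\ x| by rewrite (cardsD1 x) xA.
rewrite -cards_draws -(@card_in_imset _ _ (fun C => C :\ x)); last first.
  move=> C D; rewrite !inE => /and3P[xC _ _] /and3P[xD _ _] E.
  by rewrite -(setD1K xC) E setD1K.
apply: eq_card => D; apply/imsetP/idP => [[C]|].
  rewrite !inE => /and3P[xC CA cC] ->; rewrite setSD //=.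
  by move: cC; rewrite (cardsD1 x) xC add1n eqSS.
rewrite inE subsetD1 => /andP[/andP[DA xD] cD]; exists (x |: D); last first.
  by rewrite setU1K.
by rewrite inE setU11 cardsU1 xD add1n eqSS cD subUset sub1set xA DA.
Qed.

Lemma sum_pointed_sub (V : nmodType) A x (f : nat -> V) : x \in A ->
  \sum_(C : {set T} | (x \in C) && (C \subset A)) f #|C| =
  \sum_(j < #|A|) f j.+1 *+ 'C(#|A|.-1, j).
Proof.
move=> xA; have [n An] : exists n, #|A| = n.+1.
  by exists #|A|.-1; rewrite prednK //; apply/card_gt0P; exists x.
rewrite An (partition_big (fun C : {set T} => inord #|C|.-1 : 'I_n.+1) xpredT) //=.
apply: eq_bigr => j _; have /= := card_pointed_sub j xA; rewrite An /= => <-.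
rewrite -sumr_const.
have P C : x \in C -> C \subset A -> (inord #|C|.-1 == j :> 'I_n.+1) = (#|C| == j.+1).
  move=> xC CA; have c0 : (0 < #|C|)%N by apply/card_gt0P; exists x.
  have := subset_leq_card CA; rewrite An => cn.
  rewrite -val_eqE /= inordK; last by rewrite prednK.
  by rewrite -{2}(prednK c0) eqSS.
have PP C : (x \in C) && (C \subset A) && (inord #|C|.-1 == j :> 'I_n.+1) =
    [&& x \in C, C \subset A & #|C| == j.+1].
  by case: (x \in C) (P C) => //= PC; case: (C \subset A) PC => //= ->.
rewrite (eq_bigl _ _ PP); apply: eq_big => C; first by rewrite inE.
by case/and3P => _ _ /eqP ->.
Qed.

End Splitting.

(** * Averages of multiplicative cycle weights *)

Section CycleSums.
Variable T : finType.
Implicit Types (A B C D : {set T}) (s : {perm T}).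

(** Every size contributes $(|A|-1)!$. This is the recursion that the number $(|C|-1)!$ of full
    cycles has to satisfy. *)
Lemma sum_pointed_fact A x : x \in A ->
  (\sum_(C : {set T} | (x \in C) && (C \subset A)) #|C|.-1`! * (#|A| - #|C|)`!
    = #|A|`!)%N.
Proof.
move=> xA; have := sum_pointed_sub (fun k => k.-1`! * (#|A| - k)`!)%N xA.
move=> /= ->; have [n An] : exists n, #|A| = n.+1.
  by exists #|A|.-1; rewrite prednK //; apply/card_gt0P; exists x.
rewrite An /= (eq_bigr (fun=> n`!)); first by rewrite sum_nat_const card_ord factS.
move=> j _; rewrite subSS -mulr_natl natn /= -(@bin_fact n j) //; by case: j.
Qed.

Lemma sum_perm_on_porbits (V : nmodType) A x (F : {perm T} -> V) : x \in A ->
  \sum_(s | perm_on A s) F s =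
  \sum_(C : {set T} | (x \in C) && (C \subset A))
    \sum_(s1 | perm_on C s1 && (porbit s1 x == C))
      \sum_(s2 | perm_on (A :\: C) s2) F (s1 * s2)%g.
Proof.
move=> xA; rewrite (partition_big (fun s => porbit s x)
  (fun C : {set T} => (x \in C) && (C \subset A))) /=.
  by apply: eq_bigr => C /andP[xC CA]; rewrite sum_perm_on_porbit.
by move=> s sA; rewrite porbit_id porbit_sub.
Qed.

(** Sorting all permutations of [C] by the cycle of [x] gives the same recursion as
    [sum_pointed_fact]. The terms of proper subsets agree by induction, hence so does the term of
    [C] itself. *)
Lemma card_full_cycles C x : x \in C ->
  #|[set s | perm_on C s && (porbit s x == C)]| = #|C|.-1`!.
Proof.
have [k] := ubnP #|C|; elim: k C => // k IHk C; rewrite ltnS => Ck xC.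
have := sum_pointed_fact xC; rewrite -card_perm -[#|perm_on C|]sum1_card.
rewrite [X in _ = X -> _](eq_bigl (perm_on C)) // (sum_perm_on_porbits _ xC).
rewrite [X in _ = X -> _](eq_bigr (fun D : {set T} =>
  #|[set s | perm_on D s && (porbit s x == D)]| * (#|C| - #|D|)`!)%N); last first.
  move=> D /andP[xD DC]; rewrite -sum_nat_const.
  apply: eq_big => s1; first by rewrite inE.
  move=> _; rewrite sum1_card (eq_card (B := perm_on (C :\: D))) // card_perm.
  by rewrite cardsD (setIidPr DC).
rewrite (bigD1 C) ?xC ?subxx //= [in RHS](bigD1 C) ?xC ?subxx //=.
rewrite subnn fact0 !muln1 (eq_bigr (fun D : {set T} =>
  #|[set s | perm_on D s && (porbit s x == D)]| * (#|C| - #|D|)`!)%N).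
  by move/eqP; rewrite eqn_add2r => /eqP.
move=> D /andP[/andP[xD DC] DnC]; rewrite IHk //.
by apply: leq_trans Ck; apply: proper_card; rewrite properEneq DnC.
Qed.

Variable R : realFieldType.

(** Permutations of [A] are those of the ambient type supported in [A], so that removing a cycle
    never changes the type. *)
Definition avg A (F : {perm T} -> R) : R :=
  (\sum_(s | perm_on A s) F s) / (#|A|`!)%:R.

Lemma factR_neq0 n : (n`!)%:R != 0 :> R.
Proof. by rewrite pnatr_eq0 -lt0n fact_gt0. Qed.
Hint Resolve factR_neq0 : core.

Lemma avg_sum A (I : Type) (r : seq I) (P : pred I) (F : I -> {perm T} -> R) :
  avg A (fun s => \sum_(i <- r | P i) F i s) = \sum_(i <- r | P i) avg A (F i).
Proof. by rewrite /avg exchange_big mulr_suml. Qed.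

Lemma avgD A (F G : {perm T} -> R) : avg A (fun s => F s + G s) = avg A F + avg A G.
Proof. by rewrite /avg big_split mulrDl. Qed.

Lemma avgM A c (F : {perm T} -> R) : avg A (fun s => c * F s) = c * avg A F.
Proof. by rewrite /avg -mulr_sumr mulrA. Qed.

Lemma eq_avg A (F G : {perm T} -> R) : (forall s, perm_on A s -> F s = G s) ->
  avg A F = avg A G.
Proof. by move=> FG; congr (_ / _); apply: eq_bigr. Qed.

Lemma le_avg A (F G : {perm T} -> R) : (forall s, perm_on A s -> F s <= G s) ->
  avg A F <= avg A G.
Proof. by move=> FG; rewrite ler_wpM2r ?invr_ge0 ?ler0n // ler_sum. Qed.

Lemma avg_cst A c : avg A (fun=> c) = c.
Proof.
rewrite /avg sumr_const (eq_card (B := perm_on A)) // card_perm -[c *+ _]mulr_natr.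
by rewrite mulfK.
Qed.

(** The cycle of a given point has a uniformly distributed length, because
    $\binom{n-1}{j-1}(j-1)!\,(n-j)!=(n-1)!$ for every [j], and what remains is a uniform permutation
    of the other points. *)
Lemma avg_porbit A x (F : {perm T} -> R) (H : {set T} -> {perm T} -> R)
    (phi : nat -> R) : x \in A ->
  (forall C s1 s2, x \in C -> C \subset A -> perm_on C s1 -> porbit s1 x = C ->
     perm_on (A :\: C) s2 -> F (s1 * s2)%g = H C s2) ->
  (forall C, x \in C -> C \subset A -> avg (A :\: C) (H C) = phi #|C|) ->
  avg A F = (\sum_(j < #|A|) phi j.+1) / #|A|%:R.
Proof.
move=> xA FH Hphi; rewrite /avg (sum_perm_on_porbits _ xA).
rewrite (eq_bigr (fun C : {set T} =>
    (#|C|.-1`!)%:R * ((#|A| - #|C|)`!)%:R * phi #|C|)); last first.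
  move=> C /andP[xC CA]; rewrite -Hphi // /avg.
  rewrite cardsD (setIidPr CA) -mulrA [X in _ * X]mulrC divfK //.
  rewrite -(card_full_cycles xC) mulr_natl -sumr_const.
  apply: eq_big => s1; first by rewrite inE.
  case/andP => s1C /eqP E; apply: eq_bigr => s2 s2D.
  exact: FH.
rewrite (sum_pointed_sub (fun k => (k.-1`!)%:R * ((#|A| - k)`!)%:R * phi k) xA) /=.
have [n An] : exists n, #|A| = n.+1.
  by exists #|A|.-1; rewrite prednK //; apply/card_gt0P; exists x.
rewrite An /= (eq_bigr (fun j : 'I_n.+1 => (n`!)%:R * phi j.+1)); last first.
  move=> j _; rewrite subSS -[_ *+ 'C(_, _)]mulr_natl mulrA -!natrM.
  by rewrite bin_fact //; case: j.
rewrite -mulr_sumr factS natrM; have f0 := factR_neq0 n.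
have n0 : n.+1%:R != 0 :> R by rewrite pnatr_eq0.
by field; rewrite f0 addrC natr1 n0.
Qed.

Definition cycle_weight (w : nat -> R) A s : R :=
  \prod_(B in [set porbit s x | x in A]) w #|B|.

Lemma imset_porbitU A C s1 s2 : C \subset A -> perm_on C s1 -> perm_on (A :\: C) s2 ->
  [set porbit (s1 * s2)%g x | x in A] =
  [set porbit s1 x | x in C] :|: [set porbit s2 x | x in A :\: C].
Proof.
move=> CA s1C s2D; have dCD := disjoint_setDr A C.
have {1}-> : A = C :|: (A :\: C).
  by rewrite setDE setUIr setUCr setIT (setUidPr CA).
rewrite imsetU; congr (_ :|: _); apply: eq_in_imset => x xC.
  exact: porbit_mull dCD s1C s2D xC.
exact: porbit_mulr dCD s1C s2D xC.
Qed.

Lemma disjoint_porbits A C s1 s2 : perm_on C s1 -> perm_on (A :\: C) s2 ->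
  [disjoint [set porbit s1 x | x in C] & [set porbit s2 x | x in A :\: C]].
Proof.
move=> s1C s2D; rewrite -setI_eq0; apply/eqP/setP => B; rewrite !inE.
apply/andP => -[/imsetP[x xC ->] /imsetP[y yD E]].
have := subsetP (porbit_sub s2D yD) x; rewrite -E porbit_id => /(_ isT).
by rewrite inE xC.
Qed.

Lemma cycle_weightM w A C s1 s2 : C \subset A ->
  perm_on C s1 -> perm_on (A :\: C) s2 ->
  cycle_weight w A (s1 * s2)%g = cycle_weight w C s1 * cycle_weight w (A :\: C) s2.
Proof.
move=> CA s1C s2D; rewrite /cycle_weight (imset_porbitU CA s1C s2D).
rewrite -bigU /=; last exact: (@disjoint_porbits A C).
by apply: eq_bigl => B; rewrite !inE.
Qed.

Lemma cycle_weight_full w C s x : x \in C -> perm_on C s -> porbit s x = C ->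
  cycle_weight w C s = w #|C|.
Proof.
move=> xC sC E; rewrite /cycle_weight.
have -> : [set porbit s y | y in C] = [set C]; last by rewrite big_set1.
apply/setP => B; rewrite inE; apply/imsetP/eqP => [[y yC ->]|->].
  by rewrite -[RHS]E; apply/eqP; rewrite eq_porbit_mem E.
by exists x.
Qed.

Fixpoint cycle_avgs (w : nat -> R) n : seq R :=
  if n is m.+1 then
    rcons (cycle_avgs w m) ((\sum_(j < m.+1) w j.+1 * (cycle_avgs w m)`_(m - j)) / m.+1%:R)
  else [:: 1].

Definition cycle_avg w n := (cycle_avgs w n)`_n.

Lemma size_cycle_avgs w n : size (cycle_avgs w n) = n.+1.
Proof. by elim: n => //= n IHn; rewrite size_rcons IHn. Qed.

Lemma nth_cycle_avgs w n k : (k <= n)%N -> (cycle_avgs w n)`_k = cycle_avg w k.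
Proof.
elim: n k => [|n IHn] k; first by rewrite leqn0 => /eqP ->.
rewrite leq_eqVlt => /predU1P[->//|kn] /=.
by rewrite nth_rcons size_cycle_avgs kn IHn.
Qed.

Lemma cycle_avg0 w : cycle_avg w 0 = 1.
Proof. by []. Qed.

Lemma cycle_avgS w n :
  cycle_avg w n.+1 = (\sum_(j < n.+1) w j.+1 * cycle_avg w (n - j)) / n.+1%:R.
Proof.
rewrite {1}/cycle_avg /= nth_rcons size_cycle_avgs ltnn eqxx; congr (_ / _).
by apply: eq_bigr => j _; rewrite nth_cycle_avgs // leq_subr.
Qed.

Lemma avg_cycle_weight w A : avg A (cycle_weight w A) = cycle_avg w #|A|.
Proof.
have [k] := ubnP #|A|; elim: k A => // k IHk A; rewrite ltnS => Ak.
have [->|[x xA]] := set_0Vmem A.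
  rewrite cards0 cycle_avg0 -[RHS](avg_cst set0); apply: eq_avg => s _.
  by rewrite /cycle_weight imset0 big_set0.
rewrite (avg_porbit (x := x)
  (H := fun C s2 => w #|C| * cycle_weight w (A :\: C) s2)
  (phi := fun j => w j * cycle_avg w (#|A| - j))) //.
- have [n An] : exists n, #|A| = n.+1.
    by exists #|A|.-1; rewrite prednK //; apply/card_gt0P; exists x.
  by rewrite An cycle_avgS.
- move=> C s1 s2 xC CA s1C E s2D.
  by rewrite (cycle_weightM _ CA s1C s2D) (cycle_weight_full _ xC s1C E).
move=> C xC CA; rewrite avgM IHk; first by rewrite cardsD (setIidPr CA).
apply: leq_trans Ak; apply: proper_card; rewrite properE subsetDl.
by apply/subsetPn; exists x; rewrite // inE xC.
Qed.

(** Points are counted instead of cycles because [avg_porbit] applies to each point separately; on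
    the whole type the result is [i] times the number of [i]-cycles. *)
Definition points_in_cycles i A s := #|[set y in A | #|porbit s y| == i]|.

Lemma points_in_cyclesE i A s :
  (points_in_cycles i A s)%:R = \sum_(y in A) (#|porbit s y| == i)%:R :> R.
Proof.
rewrite /points_in_cycles -sum1_card natr_sum [LHS](eq_bigl
  (fun y => (y \in A) && (#|porbit s y| == i))); last by move=> y; rewrite inE.
by rewrite big_mkcondr; apply: eq_bigr => y _; case: eqP.
Qed.

Lemma sum_delta n i (f : nat -> R) :
  \sum_(j < n) (j.+1 == i)%:R * f j.+1 = (0 < i <= n)%N%:R * f i.
Proof.
have [/andP[i0 iN]|ni] := boolP (0 < i <= n)%N; last first.
  rewrite mul0r big1 // => j _; case: eqP => [E|]; last by rewrite mul0r.
  by case/negP: ni; rewrite -E /=.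
case: i i0 iN => // i _ iN; rewrite (bigD1 (Ordinal iN)) //= eqxx !mul1r big1 ?addr0 //.
move=> j nj; rewrite eqSS; case: eqP => [E|]; last by rewrite mul0r.
by case/eqP: nj; apply: val_inj.
Qed.

(** Each of the $|A|$ points lies in an [i]-cycle with probability $1/|A|$, and the weight of the
    remaining $|A|-i$ points is averaged separately. *)
Lemma avg_weight_points w i A :
  avg A (fun s => cycle_weight w A s * (points_in_cycles i A s)%:R) =
  (0 < i <= #|A|)%N%:R * (w i * cycle_avg w (#|A| - i)).
Proof.
have [->|[x0 x0A]] := set_0Vmem A.
  rewrite cards0 leqn0 ltnNge leqn0 andNb mul0r -[RHS](avg_cst set0); apply: eq_avg => s _.
  by rewrite points_in_cyclesE big_set0 mulr0.
have A0 : #|A|%:R != 0 :> R by rewrite pnatr_eq0 -lt0n; apply/card_gt0P; exists x0.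
rewrite (eq_avg (G := fun s => \sum_(y in A) cycle_weight w A s * (#|porbit s y| == i)%:R));
  last by move=> s _; rewrite points_in_cyclesE mulr_sumr.
rewrite avg_sum (eq_bigr (fun _ => (0 < i <= #|A|)%N%:R * (w i * cycle_avg w (#|A| - i)) / #|A|%:R)).
  by rewrite sumr_const -[_ *+ #|A|]mulr_natr divfK.
move=> x xA; rewrite (avg_porbit (x := x)
  (H := fun C s2 => (#|C| == i)%:R * (w #|C| * cycle_weight w (A :\: C) s2))
  (phi := fun j => (j == i)%:R * (w j * cycle_avg w (#|A| - j)))) //.
- by rewrite (sum_delta _ _ (fun j => w j * cycle_avg w (#|A| - j))).
- move=> C s1 s2 xC CA s1C E s2D.
  rewrite (cycle_weightM _ CA s1C s2D) (cycle_weight_full _ xC s1C E) (porbit_mull (disjoint_setDr A C)) //.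
  by rewrite E mulrC.
move=> C xC CA; rewrite avgM avgM avg_cycle_weight cardsD (setIidPr CA) //.
Qed.

Lemma cycle_avg1 n : cycle_avg (fun=> 1) n = 1.
Proof.
have [k] := ubnP n; elim: k n => // k IHk [|n] //; rewrite ltnS => nk.
rewrite cycle_avgS (eq_bigr (fun=> 1)); first by rewrite sumr_const card_ord mulfV ?pnatr_eq0.
by move=> j _; rewrite mul1r IHk // (leq_ltn_trans _ nk) // leq_subr.
Qed.

Lemma cycle_weight1 A s : cycle_weight (fun=> 1) A s = 1.
Proof. by rewrite /cycle_weight big1. Qed.

Lemma avg_points i A :
  avg A (fun s => (points_in_cycles i A s)%:R) = (0 < i <= #|A|)%N%:R.
Proof.
have := avg_weight_points (fun=> 1) i A; rewrite cycle_avg1 !mulr1 => <-.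
by apply: eq_avg => s _; rewrite cycle_weight1 mul1r.
Qed.

Lemma points_in_cyclesM j A C x s1 s2 : x \in C -> C \subset A ->
  perm_on C s1 -> porbit s1 x = C -> perm_on (A :\: C) s2 ->
  (points_in_cycles j A (s1 * s2)%g =
   (#|C| == j) * #|C| + points_in_cycles j (A :\: C) s2)%N.
Proof.
move=> xC CA s1C E s2D; have dCD := disjoint_setDr A C.
rewrite /points_in_cycles -(cardsID C); congr (_ + _)%N.
  have -> : [set y in A | #|porbit (s1 * s2)%g y| == j] :&: C =
      [set y in C | #|C| == j].
    apply/setP => y; rewrite !inE andbC; have [yC|] //= := boolP (y \in C).
    rewrite (subsetP CA) //= (porbit_mull dCD) //.
    by have /eqP -> : porbit s1 y == porbit s1 x; rewrite ?eq_porbit_mem E.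
  case: eqP => _; rewrite ?mul1n ?mul0n; first by apply: eq_card => y; rewrite !inE andbT.
  by apply: eq_card0 => y; rewrite !inE andbF.
apply: eq_card => y; rewrite !inE andbA; have [yD|] //= := boolP (y \in A :\: C).
  by move: (yD); rewrite inE => ->; rewrite (porbit_mulr dCD).
by rewrite inE => /negbTE ->.
Qed.

(** Given a point in an [i]-cycle, that cycle contributes [i] points when $i=j$, and the other
    $|A|-i$ points contribute one on average as soon as [j] fits. *)
Lemma avg_points2 i j A :
  avg A (fun s => (points_in_cycles i A s)%:R * (points_in_cycles j A s)%:R) =
  (0 < i <= #|A|)%N%:R * ((i == j)%:R * i%:R + (0 < j <= #|A| - i)%N%:R).
Proof.
have [->|[x0 x0A]] := set_0Vmem A.
  rewrite cards0 leqn0 ltnNge leqn0 andNb mul0r -[RHS](avg_cst set0); apply: eq_avg => s _.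
  by rewrite points_in_cyclesE big_set0 mul0r.
have A0 : #|A|%:R != 0 :> R by rewrite pnatr_eq0 -lt0n; apply/card_gt0P; exists x0.
rewrite (eq_avg (G := fun s => \sum_(y in A) (#|porbit s y| == i)%:R * (points_in_cycles j A s)%:R));
  last by move=> s _; rewrite points_in_cyclesE mulr_suml.
set r := (X in _ = X).
rewrite avg_sum (eq_bigr (fun _ => r / #|A|%:R)).
  by rewrite sumr_const -[_ *+ #|A|]mulr_natr divfK.
move=> x xA; rewrite (avg_porbit (x := x)
  (H := fun C s2 => (#|C| == i)%:R * ((#|C| == j)%:R * #|C|%:R + (points_in_cycles j (A :\: C) s2)%:R))
  (phi := fun k => (k == i)%:R * ((k == j)%:R * k%:R + (0 < j <= #|A| - k)%N%:R))) //.
- by rewrite (sum_delta _ _ (fun k => ((k == j)%:R * k%:R + (0 < j <= #|A| - k)%N%:R))).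
- move=> C s1 s2 xC CA s1C E s2D.
  rewrite (porbit_mull (disjoint_setDr A C)) // E (points_in_cyclesM _ xC) //.
  by rewrite natrD natrM.
by move=> C xC CA; rewrite avgM avgD avg_cst avg_points cardsD (setIidPr CA).
Qed.

Definition fixed_sets l A s := #|[set U : {set T} | [&& U \subset A, #|U| == l & s @: U == U]]|.

(** A fixed set cuts the permutation into independent permutations of the set and of its complement;
    the number of sets cancels the factorials. *)
Lemma avg_weight_fixed_sets w l A : (l <= #|A|)%N ->
  avg A (fun s => cycle_weight w A s * (fixed_sets l A s)%:R) =
  cycle_avg w l * cycle_avg w (#|A| - l).
Proof.
move=> lA; pose D := [set U : {set T} | U \subset A & #|U| == l].
rewrite (eq_avg (G := fun s => \sum_(U in D) if s @: U == U then cycle_weight w A s else 0)).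
rewrite avg_sum (eq_bigr (fun=> (l`!)%:R * ((#|A| - l)`!)%:R / (#|A|`!)%:R
     * (cycle_avg w l * cycle_avg w (#|A| - l)))).
    rewrite sumr_const cards_draws -[_ *+ _]mulr_natl !mulrA -(bin_fact lA) !natrM.
    rewrite !invfM -!mulrA; do 2! rewrite mulrA.
    have b0 : ('C(#|A|, l))%:R != 0 :> R by rewrite pnatr_eq0 -lt0n bin_gt0.
    have f1 := factR_neq0 l; have f2 := factR_neq0 (#|A| - l).
    by field; rewrite b0 f1 f2.
  move=> U; rewrite inE => /andP[UA /eqP Ul].
  rewrite /avg -big_mkcondr sum_perm_on_split //.
  rewrite (eq_bigr (fun s1 => cycle_weight w U s1 *
     \sum_(s2 | perm_on (A :\: U) s2) cycle_weight w (A :\: U) s2)); last first.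
    by move=> s1 s1U; rewrite mulr_sumr; apply: eq_bigr => s2 s2D; rewrite (cycle_weightM _ UA s1U s2D).
  rewrite -mulr_suml; have := avg_cycle_weight w U; have := avg_cycle_weight w (A :\: U).
  rewrite /avg cardsD (setIidPr UA) Ul => <- <-.
  have f1 := factR_neq0 l; have f2 := factR_neq0 (#|A| - l).
  have f3 := factR_neq0 #|A|.
  by field; rewrite f1 f2 f3.
move=> s _; rewrite -big_mkcondr sumr_const mulr_natr; congr (_ *+ _).
by apply: eq_card => U; rewrite inE [RHS]unfold_in /= inE andbA.
Qed.

End CycleSums.

(** * Growth and decay of the cycle averages *)

Section CycleAvgBounds.
Variable R : realFieldType.
Implicit Types (v w : nat -> R) (n l : nat).

Lemma cycle_avg_rec w n :
  n.+1%:R * cycle_avg w n.+1 = \sum_(m < n.+1) w (n.+1 - m)%N * cycle_avg w m.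
Proof.
rewrite cycle_avgS mulrC divfK ?pnatr_eq0 // (reindex_inj rev_ord_inj) /=.
apply: eq_bigr => m _; rewrite subSS.
by have mn : (m <= n)%N := ltn_ord m; rewrite subKn // subSn.
Qed.

Lemma eq_cycle_avg v w n : v =1 w -> cycle_avg v n = cycle_avg w n.
Proof.
move=> E; have [k] := ubnP n; elim: k n => // k IHk [|n] //.
rewrite ltnS => nk; rewrite !cycle_avgS; congr (_ / _); apply: eq_bigr => j _.
by rewrite E IHk // (leq_ltn_trans _ nk) // leq_subr.
Qed.

Lemma cycle_avg_ge0 w n : (forall j, 0 <= w j) -> 0 <= cycle_avg w n.
Proof.
move=> w0; have [k] := ubnP n; elim: k n => // k IHk [|n]; first by rewrite ler01.
rewrite ltnS => nk; rewrite cycle_avgS divr_ge0 ?ler0n // sumr_ge0 // => j _.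
by rewrite mulr_ge0 // IHk // (leq_ltn_trans _ nk) // leq_subr.
Qed.

(* With generating functions: exp (sum_j (1 + v j) x^j / j) is 1 / (1 - x)
   times exp (sum_j v j x^j / j). *)
Lemma cycle_avg_add1 v n :
  cycle_avg (fun j => 1 + v j) n = \sum_(m < n.+1) cycle_avg v m.
Proof.
pose S n : R := \sum_(m < n.+1) cycle_avg v m; rewrite -/(S n).
have SS k : S k.+1 = S k + cycle_avg v k.+1 by rewrite /S big_ord_recr.
have key k : k%:R * S k = \sum_(j < k) (1 + v j.+1) * S (k.-1 - j)%N.
  elim: k => [|k IHk]; first by rewrite mul0r big_ord0.
  rewrite big_ord_recr /= subnn.
  rewrite (eq_bigr (fun j : 'I_k => (1 + v j.+1) * S (k.-1 - j)%N +
      (1 + v j.+1) * cycle_avg v (k - j))); last first.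
    case: k {IHk} => [|k] [j jk] //= _; rewrite -mulrDr; congr (_ * _).
    by rewrite subSn ?SS.
  rewrite big_split /= -IHk -addrA.
  have -> : (1 + v k.+1) * S 0%N = (1 + v k.+1) * cycle_avg v (k - k).
    by rewrite subnn /S big_ord_recl big_ord0 addr0.
  have -> : \sum_(i < k) (1 + v i.+1) * cycle_avg v (k - i) +
      (1 + v k.+1) * cycle_avg v (k - k) =
      \sum_(i < k.+1) (1 + v i.+1) * cycle_avg v (k - i) by rewrite big_ord_recr.
  under eq_bigr do rewrite mulrDl mul1r.
  rewrite big_split /=.
  have -> : \sum_(j < k.+1) cycle_avg v (k - j) = S k.
    rewrite (reindex_inj rev_ord_inj) /S; apply: eq_bigr => j _ /=.
    by have jk : (j <= k)%N := ltn_ord j; rewrite subSS subKn.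
  have n0 : k.+1%:R != 0 :> R by rewrite pnatr_eq0.
  have -> : \sum_(j < k.+1) v j.+1 * cycle_avg v (k - j) = k.+1%:R * cycle_avg v k.+1.
    by rewrite cycle_avgS mulrC divfK.
  by rewrite SS -natr1; ring.
have [k] := ubnP n; elim: k n => // k IHk [|n]; first by rewrite /S big_ord_recl big_ord0 addr0.
rewrite ltnS => nk; have n0 : n.+1%:R != 0 :> R by rewrite pnatr_eq0.
apply: (mulfI n0); rewrite key cycle_avgS mulrC divfK //; apply: eq_bigr => j _.
by rewrite IHk // (leq_ltn_trans _ nk) // leq_subr.
Qed.

Definition short_weight l (z : R) j : R := if (j <= l)%N then z else 1.

Lemma short_weight_sum l z n : (n <= l)%N ->
  n%:R * cycle_avg (short_weight l z) n =
  z * \sum_(m < n) cycle_avg (short_weight l z) m.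
Proof.
case: n => [|n] nl; first by rewrite mul0r big_ord0 mulr0.
rewrite cycle_avg_rec mulr_sumr; apply: eq_bigr => m _; congr (_ * _).
by rewrite /short_weight (leq_trans _ nl) // leq_subr.
Qed.

(** Up to [l] the weight is the constant [z], and the averages are the coefficients of $(1-x)^{-z}$;
    this is the ratio of two neighbours. *)
Lemma short_weight_rec l z n : (n < l)%N ->
  n.+1%:R * cycle_avg (short_weight l z) n.+1 =
  (n%:R + z) * cycle_avg (short_weight l z) n.
Proof.
move=> nl; rewrite short_weight_sum // big_ord_recr /= mulrDr -short_weight_sum ?mulrDl //.
exact: ltnW.
Qed.

(** The coefficients of $(1-x)^{-3/2}$ grow like $n^{1/2}$; squaring avoids the root. *)
Lemma short_weight32_le l n : (n <= l)%N ->
  cycle_avg (short_weight l (3/2)) n ^+ 2 <= n.*2.+1%:R.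
Proof.
elim: n => [|n IHn] nl; first by rewrite cycle_avg0 expr1n.
have := IHn (ltnW nl); have := short_weight_rec (3/2) nl.
set a := cycle_avg _ n.+1; set b := cycle_avg _ n => E Hb.
have a0 : 0 <= n.+1%:R ^+ 2 :> R by rewrite sqr_ge0.
have n0 : 0 < n.+1%:R ^+ 2 :> R by rewrite exprn_gt0 // ltr0n.
rewrite -(ler_pM2l n0) -exprMn E exprMn.
have := ler_wpM2l (sqr_ge0 (n%:R + 3/2 : R)) Hb; move/le_trans; apply.
rewrite doubleS -!natr1 -addnn natrD; set x : R := n%:R.
have x0 : 0 <= x by rewrite ler0n.
rewrite -subr_ge0 [leRHS](_ : _ = x / 2 + 3 / 4); last by field.
lra.
Qed.

(** Writing the weight as $1+v$, with [v] equal to 1/2 on short cycles, turns the average into a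
    partial sum [S] of the nonnegative averages [g] of [v]. Beyond [l], summing the recursion of [g]
    shows that the added part is at most half of the total, so [S] at most doubles. *)
Lemma cycle_avg_short32 l n :
  cycle_avg (short_weight l (3/2)) n ^+ 2 <= 4 * l.*2.+1%:R.
Proof.
pose v j : R := if (j <= l)%N then 1/2 else 0.
have v0 j : 0 <= v j by rewrite /v; case: ifP; lra.
pose g := cycle_avg v; have g0 m : 0 <= g m by apply: cycle_avg_ge0.
pose S N := \sum_(0 <= i < N) g i.
have E m : cycle_avg (short_weight l (3/2)) m = S m.+1.
  rewrite /S big_mkord -cycle_avg_add1; apply: eq_cycle_avg => j.
  by rewrite /v /short_weight; case: ifP; lra.
have S0 N : 0 <= S N by rewrite /S sumr_ge0.
have Smono M N : (M <= N)%N -> S M <= S N.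
  by move=> MN; rewrite /S [leRHS](big_cat_nat (n := M)) //= lerDl sumr_ge0.
have gl m : (l <= m)%N -> (l%:R + 1) * g m.+1 <= 1/2 * \sum_(j < l) g (m - j)%N.
  move=> lm; apply: (@le_trans _ _ (m.+1%:R * g m.+1)).
    by rewrite ler_wpM2r // natr1 ler_nat ltnS.
  rewrite /g cycle_avgS mulrC divfK ?pnatr_eq0 // mulr_sumr.
  rewrite (big_ord_widen_cond m.+1 xpredT (fun j => 1 / 2 * cycle_avg v (m - j))) //; last first.
    exact: leq_trans lm _.
  rewrite [leRHS]big_mkcond /=; apply: ler_sum => j _; rewrite /v.
  by case: ifP => _ //; rewrite mul0r.
have shift i a b : (i <= a)%N ->
    \sum_(a <= m < b) g (m - i)%N = \sum_(a - i <= m < b - i) g m.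
  move=> ia; rewrite -{1}(subnK ia) big_addn; apply: eq_bigr => m _.
  by rewrite addnK.
have tail N : (l < N)%N -> S N <= 2 * S l.+1.
  move=> lN.
  have : \sum_(l <= m < N.-1) ((l%:R + 1) * g m.+1) <=
         \sum_(l <= m < N.-1) (1/2 * \sum_(j < l) g (m - j)%N).
    rewrite big_nat_cond [leRHS]big_nat_cond; apply: ler_sum => m /andP[/andP[lm _] _].
    exact: gl.
  rewrite -!mulr_sumr exchange_big /=.
  have -> : \sum_(l <= m < N.-1) g m.+1 = S N - S l.+1.
    rewrite /S [\sum_(0 <= i < N) _](big_cat_nat (n := l.+1)) //= [X in _ = X - _]addrC addrK.
    by rewrite -{2}(prednK (leq_ltn_trans (leq0n l) lN)) big_add1.
  have : \sum_(j < l) \sum_(l <= m < N.-1) g (m - j)%N <= \sum_(j < l) S N.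
    apply: ler_sum => j _; have jl : (j <= l)%N := ltnW (ltn_ord j).
    apply: (@le_trans _ _ (\sum_(l - j <= m < N.-1 - j) g m)).
      by rewrite shift.
    apply: le_trans (Smono (N.-1 - j)%N N _); last by lia.
    rewrite /S [leRHS](big_cat_nat (n := (l - j)%N)) //=; last by lia.
    by rewrite lerDr sumr_ge0.
  rewrite sumr_const card_ord -[_ *+ _]mulr_natl.
  set s := S N; set t := S l.+1; set q := \sum_(j < l) _; set x : R := l%:R.
  have x0 : 0 <= x by rewrite ler0n.
  have s0 : 0 <= s by apply: S0.
  by move=> *; nra.
have [nl|ln] := leqP n l.
  apply: le_trans (short_weight32_le nl) _.
  by rewrite -natrM ler_nat; lia.
have := short_weight32_le (leqnn l).
have := tail n.+1 (ltnW ln); rewrite !E; have := S0 n.+1; have := S0 l.+1.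
set s := S _; set t := S _ => t0 s0 H1 H2; nra.
Qed.

(** All weights are at most 1, so $n h_n$ is at most the sum of the earlier values: those below [l]
    add up to exactly $\frac43 l h_l$, and each of the others is at most $\frac43 h_l$ by
    induction. *)
Lemma cycle_avg_short34_le l n : (l <= n)%N ->
  cycle_avg (short_weight l (3/4)) n <= 4/3 * cycle_avg (short_weight l (3/4)) l.
Proof.
set h := cycle_avg _; have h0 m : 0 <= h m.
  by apply: cycle_avg_ge0 => j; rewrite /short_weight; case: ifP; lra.
have w1 j : short_weight l (3/4) j <= 1 by rewrite /short_weight; case: ifP; lra.
have [k] := ubnP n; elim: k n => // k IHk n; rewrite ltnS => nk.
rewrite leq_eqVlt => /predU1P[<-|]; first by have := h0 l; lra.
case: n nk => // n nk; rewrite ltnS => ln.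
have n0 : 0 < n.+1%:R :> R by rewrite ltr0n.
rewrite -(ler_pM2l n0) cycle_avg_rec -/h.
apply: (@le_trans _ _ (\sum_(0 <= m < n.+1) h m)).
  by rewrite big_mkord; apply: ler_sum => m _; rewrite ler_piMl.
rewrite (big_cat_nat (n := l)) //=; last exact: ltnW.
have -> : \sum_(0 <= m < l) h m = 4/3 * (l%:R * h l).
  by rewrite short_weight_sum // big_mkord mulrA; set s := \sum_(_ < _) _; lra.
have : \sum_(l <= m < n.+1) h m <= \sum_(l <= m < n.+1) (4/3 * h l).
  rewrite big_nat_cond [leRHS]big_nat_cond; apply: ler_sum => m /andP[/andP[lm mn] _].
  by apply: IHk => //; apply: leq_trans mn _.
rewrite sumr_const_nat -[_ *+ _]mulr_natl natrB; last exact: ltnW.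
move=> H; apply: le_trans (lerD (lexx _) H) _; lra.
Qed.

(** The coefficients of $(1-x)^{-3/4}$ decay like $n^{-1/4}$, whence the fourth power. *)
Lemma cycle_avg_short34_diag l n : (n <= l)%N ->
  cycle_avg (short_weight l (3/4)) n ^+ 4 * n.+1%:R <= 1.
Proof.
elim: n => [|n IHn] nl; first by rewrite cycle_avg0 expr1n mul1r.
have := IHn (ltnW nl); have := short_weight_rec (3/4) nl.
have h0 m : 0 <= cycle_avg (short_weight l (3/4)) m.
  by apply: cycle_avg_ge0 => j; rewrite /short_weight; case: ifP; lra.
move: (h0 n) (h0 n.+1); set a := cycle_avg _ n.+1; set b := cycle_avg _ n => b0 a0 E Hb.
have n0 : 0 < n.+1%:R ^+ 4 :> R by rewrite exprn_gt0 // ltr0n.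
rewrite -(ler_pM2l n0) mulrA -exprMn E exprMn mulr1.
set x : R := n%:R; have x0 : 0 <= x by rewrite ler0n.
rewrite -[n.+2%:R]natr1; rewrite -[n.+1%:R]natr1 -/x in Hb *.
have p : (x + 3/4) ^+ 4 * (x + 1 + 1) <= (x + 1) ^+ 5.
  rewrite -subr_ge0; set e := (X in 0 <= X).
  have -> : e = x^+3 * (5/8) + x^+2 * (25/16) + x * (335/256) + 47/128 by rewrite /e; field.
  by rewrite !addr_ge0 ?mulr_ge0 ?exprn_ge0 //; lra.
have b4 : 0 <= b ^+ 4 by rewrite exprn_ge0.
apply: (@le_trans _ _ (b ^+ 4 * (x + 1) ^+ 5)).
  by rewrite mulrAC mulrC ler_wpM2l.
rewrite [(x + 1) ^+ 5]exprS mulrA ler_piMl // exprn_ge0 //; lra.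
Qed.

Definition long_weight L j : R := (L < j)%N%:R.
Definition signed_long_weight L j : R := (L < j)%N%:R * (-1) ^+ j.-1.

(* The proportion of permutations of n points that have all their cycles
   longer than L and the parity of b. *)
Definition parity_avg L b n : R :=
  (cycle_avg (long_weight L) n + (-1) ^+ b * cycle_avg (signed_long_weight L) n) / 2.

Lemma parity_avg0 L b : parity_avg L b 0 = (~~ odd b)%:R.
Proof. by rewrite /parity_avg !cycle_avg0 mulr1 -signr_odd; case: odd; rewrite ?expr0 ?expr1 /=; lra. Qed.

(** Removing a cycle of length $n+1-m$ leaves [m] points and shifts the parity by $n-m$, the sign of
    a [j]-cycle being $(-1)^{j-1}$. *)
Lemma parity_avg_rec L b n : n.+1%:R * parity_avg L b n.+1 =
  \sum_(m < n.+1) (L < n.+1 - m)%N%:R * parity_avg L (b + (n - m)) m.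
Proof.
rewrite /parity_avg mulrA mulrDr [n.+1%:R * (_ * _)]mulrCA !cycle_avg_rec.
rewrite mulr_sumr -big_split mulr_suml /=; apply: eq_bigr => m _.
have mn : (m <= n)%N := ltn_ord m.
rewrite /long_weight /signed_long_weight subSn //= exprD; ring.
Qed.

Lemma parity_avg_ge0 L b n : 0 <= parity_avg L b n.
Proof.
have [k] := ubnP n; elim: k n b => // k IHk [|n] b; first by rewrite parity_avg0 ler0n.
rewrite ltnS => nk; have n0 : 0 < n.+1%:R :> R by rewrite ltr0n.
rewrite -(pmulr_rge0 _ n0) parity_avg_rec sumr_ge0 // => m _.
by rewrite mulr_ge0 ?ler0n // IHk // (leq_trans _ nk).
Qed.

Lemma parity_avg_diag L b : parity_avg L b L.+1 = (~~ odd (b + L))%:R / L.+1%:R.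
Proof.
have n0 : L.+1%:R != 0 :> R by rewrite pnatr_eq0.
apply: (mulfI n0); rewrite [RHS]mulrC divfK // parity_avg_rec big_ord_recl.
rewrite big1 ?addr0 => [|m _]; first by rewrite subn0 ltnSn mul1r subn0 parity_avg0.
by rewrite /= /bump /= add1n subSS ltnNge leq_subr mul0r.
Qed.

(** In the recursion, $3L+2$ indices escape the induction: the $2L+2$ smallest ones and the [L] last
    ones, whose cycle is too short. The smallest ones together contribute at least
    $1/(L+1)=c(3L+2)$, which pays for all of them. *)
Lemma parity_avg_lb L b n : (L.+1.*2 <= n)%N ->
  ((L.+1 * (3 * L).+2)%N)%:R^-1 <= parity_avg L b n.
Proof.
set c := _^-1; have c0 : 0 <= c by rewrite invr_ge0 ler0n.
have cE : c * (L.+1%:R * (3 * L).+2%:R) = 1.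
  by rewrite -natrM mulVf // pnatr_eq0.
have [k] := ubnP n; elim: k n b => // k IHk [|n] b; first by rewrite doubleS.
rewrite ltnS => nk nL; have n0 : 0 < n.+1%:R :> R by rewrite ltr0n.
rewrite -(ler_pM2l n0) parity_avg_rec.
pose t m := (L < n.+1 - m)%N%:R * parity_avg L (b + (n - m)) m.
have t0 m : 0 <= t m by rewrite mulr_ge0 ?ler0n ?parity_avg_ge0.
(* The required parity is reached either by a single full cycle ($m=0$) or by a long cycle next to a
   cycle of length $L+1$ ($m=L+1$). *)
have main : L.+1%:R^-1 <= \sum_(0 <= m < L.+1.*2) t m.
  have [ob|ob] := boolP (odd (b + n)).
    have lt : (L.+1 < L.+1.*2)%N by lia.
    rewrite (bigD1_seq L.+1) ?iota_uniq ?mem_index_iota //=.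
    rewrite ler_wpDr ?sumr_ge0 // /t parity_avg_diag.
    have -> : (L < n.+1 - L.+1)%N by lia.
    have -> : odd (b + (n - L.+1) + L) = false.
      have : (b + n = b + (n - L.+1) + L + 1)%N by lia.
      by move: ob => /[swap] ->; rewrite oddD /= addbT => /negbTE.
    by rewrite !mul1r.
  rewrite big_nat_recl ?doubleS // ler_wpDr ?sumr_ge0 // /t subn0 parity_avg0.
  have -> : (L < n.+1)%N by lia.
  by rewrite subn0 ob mul1r invf_le1 ?ltr0n // ler1n.
rewrite -(big_mkord xpredT t) (big_cat_nat (n := L.+1.*2)) //=.
have {}main : c * (3 * L).+2%:R <= \sum_(0 <= m < L.+1.*2) t m.
  apply: le_trans main; rewrite le_eqVlt; apply/orP; left; apply/eqP.
  have L0 : L.+1%:R != 0 :> R by rewrite pnatr_eq0.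
  by apply: (mulfI L0); rewrite [RHS]mulfV // -[RHS]cE mulrCA.
have [n3|n3] := leqP n.+1 (3 * L).+2.
  apply: ler_wpDr; first by rewrite sumr_ge0.
  by apply: le_trans main; rewrite mulrC ler_wpM2l // ler_nat.
rewrite (big_cat_nat (n := (n.+1 - L)%N) (m := L.+1.*2)) /=; [|lia|lia].
have : \sum_(L.+1.*2 <= m < n.+1 - L) c <= \sum_(L.+1.*2 <= m < n.+1 - L) t m.
  rewrite big_nat_cond [leRHS]big_nat_cond; apply: ler_sum => m /andP[/andP[m1 m2] _].
  rewrite /t (_ : (L < n.+1 - m)%N); last by lia.
  by rewrite mul1r IHk //; lia.
have : 0 <= \sum_(n.+1 - L <= m < n.+1) t m by rewrite sumr_ge0.
rewrite sumr_const_nat -[c *+ _]mulr_natr.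
have : (n.+1%:R : R) <= (3 * L).+2%:R + (n.+1 - L - L.+1.*2)%:R by rewrite -natrD ler_nat; lia.
move=> /(ler_wpM2l c0); rewrite mulrDr.
move: main; set x1 := \sum_(_ <= _ < _) t _; set x2 := \sum_(_ <= _ < n.+1 - L) t _.
by set x3 := \sum_(_ <= _ < n.+1) t _; rewrite [n.+1%:R * c]mulrC; lra.
Qed.

End CycleAvgBounds.

(** * Even permutations, fixed points and fixed sets *)

Section PermutationStatistics.
Variables (R : realFieldType) (T : finType).
Implicit Types (s : {perm T}) (i l L : nat).
Local Notation n := #|T|.

Definition long_cycles L s := [forall x, L < #|porbit s x|]%N.
Definition has_fixed_point s := [exists x, s x == x].
Definition has_fixed_set l s := [exists U : {set T}, (#|U| == l) && (s @: U == U)].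

Lemma perm_onT s : perm_on setT s.
Proof. by apply/subsetP => x _; rewrite inE. Qed.

Lemma porbit_imsetT s : [set porbit s x | x in setT] = porbits s.
Proof. by apply/setP => B; apply/imsetP/imsetP => -[x _ ->]; exists x. Qed.

Lemma sum_card_porbits s : (\sum_(B in porbits s) #|B| = n)%N.
Proof.
rewrite -sum1_card (partition_big (porbit s) (mem (porbits s))) /=; last first.
  by move=> x _; apply: imset_f.
apply: eq_bigr => _ /imsetP[y _ ->]; rewrite -sum1_card.
by apply: eq_bigl => x; rewrite eq_porbit_mem.
Qed.

Lemma cycle_weight_sign s :
  cycle_weight (fun j => (-1) ^+ j.-1) setT s = (-1) ^+ odd_perm s :> R.
Proof.
rewrite /cycle_weight porbit_imsetT prodrXr.
suff -> : odd_perm s = odd (\sum_(B in porbits s) #|B|.-1)%N by rewrite signr_odd.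
have : (\sum_(B in porbits s) #|B|.-1 + #|porbits s| = n)%N.
  rewrite -(sum_card_porbits s) -[#|porbits s|]sum1_card -big_split /=.
  by apply: eq_bigr => _ /imsetP[x _ ->]; rewrite addn1 prednK // lt0n card_porbit_neq0.
by move=> E; rewrite /odd_perm -E oddD -addbA addbb addbF.
Qed.

Lemma sum_even (F : {perm T} -> R) : \sum_(s : {perm T} | ~~ odd_perm s) F s =
  (n`!)%:R / 2 * (avg setT F + avg setT (fun s => (-1) ^+ odd_perm s * F s)).
Proof.
rewrite /avg cardsT -mulrDl mulrCA -big_split /= [n`!%:R / 2 / _](_ : _ = 2^-1).
  rewrite mulrC (eq_bigl xpredT) => [|s]; last exact: perm_onT.
  rewrite [X in _ = _ * X](bigID (fun s : {perm T} => odd_perm s)) /= [X in X + _]big1 => [|s ->].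
    rewrite add0r mulr_sumr; apply: eq_bigr => s /negbTE ->.
    by rewrite expr0 mul1r; lra.
  by rewrite expr1 mulN1r subrr.
by field; exact: factR_neq0.
Qed.

(** The generating function $\exp\sum_j(-1)^{j-1}x^j/j$ is $1+x$. *)
Lemma cycle_avg_sign k : cycle_avg (fun j => (-1) ^+ j.-1) k.+2 = 0 :> R.
Proof.
have [m] := ubnP k; elim: m k => // m IHm k; rewrite ltnS => km.
have n0 : k.+2%:R != 0 :> R by rewrite pnatr_eq0.
apply: (mulfI n0); rewrite mulr0 cycle_avg_rec !big_ord_recl /= big1 ?addr0.
  rewrite cycle_avg0 cycle_avgS big_ord1 /= cycle_avg0 expr0 !mul1r divr1 mulr1.
  by rewrite exprS mulN1r addNr.
move=> [j jk] _; rewrite /= /bump /= !add1n IHm ?mulr0 //.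
by rewrite (leq_trans _ km).
Qed.

Lemma cycle_weight_long L s :
  cycle_weight (long_weight R L) setT s = (long_cycles L s)%:R.
Proof.
rewrite /cycle_weight porbit_imsetT /long_weight; have [lc|] := boolP (long_cycles L s).
  by rewrite big1 // => _ /imsetP[x _ ->]; rewrite (forallP lc).
rewrite negb_forall => /existsP[x nx].
by rewrite (bigD1 (porbit s x)) ?imset_f //= (negbTE nx) mul0r.
Qed.

Lemma cycle_weight_mulf (v w : nat -> R) s :
  cycle_weight (fun j => v j * w j) setT s = cycle_weight v setT s * cycle_weight w setT s.
Proof. by rewrite /cycle_weight big_split. Qed.

(** One exponent, the number of cycles of length at most [l], serves all [z]; this lets two weights
    be compared on the same permutation. *)
Lemma cycle_weight_short l s : exists C, forall z : R,
  cycle_weight (short_weight l z) setT s = z ^+ C.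
Proof.
exists #|[set B in porbits s | (#|B| <= l)%N]| => z.
rewrite /cycle_weight porbit_imsetT -prodr_const big_mkcond [RHS]big_mkcond /=.
by apply: eq_bigr => B _; rewrite inE /short_weight; case: (B \in _).
Qed.

Lemma avgT_card (P : pred {perm T}) :
  avg setT (fun s => (P s)%:R) = #|[set s | P s]|%:R / (n`!)%:R :> R.
Proof.
rewrite /avg cardsT -sum1_card natr_sum; congr (_ / _).
rewrite [LHS](bigID P) /= [X in _ + X]big1 ?addr0 => [|s /andP[_ /negbTE ->] //].
by apply: eq_big => s; rewrite ?inE perm_onT //= => ->.
Qed.

Lemma even_long_cyclesE L :
  #|[set s : {perm T} | ~~ odd_perm s & long_cycles L s]|%:R =
  (n`!)%:R * parity_avg R L 0 n.
Proof.
rewrite /parity_avg expr0 mul1r mulrA mulrAC.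
have -> : cycle_avg (long_weight R L) n =
    avg setT (fun s : {perm T} => (long_cycles L s)%:R).
  rewrite -cardsT -avg_cycle_weight; apply: eq_avg => s _; exact: cycle_weight_long.
have -> : cycle_avg (signed_long_weight R L) n =
    avg setT (fun s : {perm T} => (-1) ^+ odd_perm s * (long_cycles L s)%:R).
  rewrite -cardsT -avg_cycle_weight; apply: eq_avg => s _.
  by rewrite -cycle_weight_sign -cycle_weight_long mulrC -cycle_weight_mulf.
rewrite -sum_even -sum1_card natr_sum [RHS](bigID (long_cycles L)) /=.
rewrite [X in _ + X]big1 ?addr0 => [|s /andP[_ /negbTE ->] //].
by apply: eq_big => s; rewrite ?inE // => /andP[_ ->].
Qed.

(** The average twisted by the sign contains [cycle_avg_sign] for $n-i\ge2$ points and vanishes, so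
    even permutations account for exactly half. *)
Lemma sum_even_points i : (0 < i)%N -> (i.+2 <= n)%N ->
  \sum_(s : {perm T} | ~~ odd_perm s) (points_in_cycles i setT s)%:R = (n`!)%:R / 2 :> R.
Proof.
move=> i0 iN; rewrite sum_even avg_points cardsT i0 (ltnW (ltnW iN)) /=.
rewrite (eq_avg (G := fun s => cycle_weight (fun j => (-1) ^+ j.-1) setT s *
  (points_in_cycles i setT s)%:R)).
  rewrite avg_weight_points cardsT.
  have -> : (n - i = (n - i).-2.+2)%N by lia.
  by rewrite cycle_avg_sign !mulr0 addr0 mulr1.
by move=> s _; rewrite cycle_weight_sign.
Qed.

Lemma ler_sum_even (F : {perm T} -> R) : (forall s, 0 <= F s) ->
  \sum_(s : {perm T} | ~~ odd_perm s) F s <= (n`!)%:R * avg setT F.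
Proof.
move=> F0; rewrite /avg cardsT mulrC divfK ?factR_neq0 //.
rewrite [leRHS](eq_bigl xpredT) => [|s]; last exact: perm_onT.
by rewrite big_mkcond; apply: ler_sum => s _; case: ifP.
Qed.

(** For the number [X] of fixed points, $X/2-X^2/16$ is at most 1 and vanishes at 0. Over the even
    permutations the first moment is $n!/2$ and the second at most $2\,n!$, which leaves
    $n!/4-n!/8$. *)
Lemma even_fixed_point_lb : (3 <= n)%N ->
  (n`!)%:R / 8 <= #|[set s : {perm T} | ~~ odd_perm s & has_fixed_point s]|%:R :> R.
Proof.
move=> n3; pose X s : R := (points_in_cycles 1 setT s)%:R.
have H s : X s / 2 - X s * X s / 16 <= (has_fixed_point s)%:R.
  have [_|nf] := boolP (has_fixed_point s); first by have := sqr_ge0 (X s / 4 - 1); rewrite expr2 mulr1n; lra.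
  rewrite [X s](_ : _ = 0); first by rewrite mulr0n; lra.
  rewrite /X /points_in_cycles eq_card0 // => x; rewrite !inE; apply/negP => x1.
  case/negP: nf; apply/existsP; exists x.
  have := mem_porbit s 1 x; have := porbit_id s x; rewrite expg1.
  by move/cards1P: x1 => [y ->]; rewrite !inE => /eqP -> .
have := sum_even_points (leqnn 1) n3; rewrite -/(X _) => E1.
have := ler_sum_even (F := fun s => X s * X s) (fun s => mulr_ge0 (ler0n _ _) (ler0n _ _)).
rewrite avg_points2 cardsT eqxx (ltnW (ltnW n3)) /= !mul1r.
have -> : (0 < n - 1)%N by lia.
rewrite !mulr1n => E2; have : \sum_(s : {perm T} | ~~ odd_perm s) (X s / 2 - X s * X s / 16) <=
   \sum_(s : {perm T} | ~~ odd_perm s) (has_fixed_point s)%:R by apply: ler_sum.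
rewrite sumrB -!mulr_suml E1.
have -> : \sum_(s : {perm T} | ~~ odd_perm s) (has_fixed_point s)%:R =
    #|[set s : {perm T} | ~~ odd_perm s & has_fixed_point s]|%:R :> R.
  rewrite -sum1_card natr_sum [LHS](bigID has_fixed_point) /=.
  rewrite [X in _ + X]big1 ?addr0 => [|s /andP[_ /negbTE ->] //].
  by apply: eq_big => s; rewrite ?inE // => /andP[_ ->].
lra.
Qed.

(** Let [C] count the cycles of length at most [l]. If $C>t$ then $(2/3)^t(3/2)^C\ge1$; otherwise
    $(4/3)^t(3/4)^C\ge1$, and this may be multiplied by the number of fixed [l]-sets. The squares of
    the two averages are of order $2^t$ and $2^{-t}$, and $(2/3)^2\cdot2=(4/3)^2/2=8/9$, so both
    terms decay alike. *)
Lemma fixed_set_ub l : (l.*2 <= n)%N ->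
  (#|[set s : {perm T} | has_fixed_set l s]|%:R / (n`!)%:R) ^+ 2 <=
  36 * (8/9) ^+ trunc_log 2 l.+1 :> R.
Proof.
move=> ln; set t := trunc_log 2 l.+1; rewrite -avgT_card.
have [t1 t2] : (2 ^ t <= l.+1 /\ l.+1 < 2 ^ t.+1)%N.
  by apply/andP; apply: trunc_log_bounds.
pose N s : R := (fixed_sets l setT s)%:R.
have H s : (has_fixed_set l s)%:R <=
    (2/3) ^+ t * cycle_weight (short_weight l (3/2)) setT s +
    (4/3) ^+ t * (cycle_weight (short_weight l (3/4)) setT s * N s).
  have [C E] := cycle_weight_short l s; rewrite !E.
  have p1 k : 0 <= (3/2 : R) ^+ k by rewrite exprn_ge0 //; lra.
  have p2 k : 0 <= (3/4 : R) ^+ k by rewrite exprn_ge0 //; lra.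
  have p3 k : 0 <= (2/3 : R) ^+ k by rewrite exprn_ge0 //; lra.
  have p4 k : 0 <= (4/3 : R) ^+ k by rewrite exprn_ge0 //; lra.
  have N0 : 0 <= N s by rewrite ler0n.
  have [fs|_] := boolP (has_fixed_set l s); last by rewrite addr_ge0 ?mulr_ge0.
  have N1 : 1 <= N s.
    rewrite ler1n card_gt0; apply/set0Pn; case/existsP: fs => U /andP[Ul Us].
    by exists U; rewrite inE subsetT Ul.
  have [Ct|tC] := leqP C t.
    apply: ler_wpDl; first by rewrite mulr_ge0.
    rewrite mulrA -(subnK Ct) exprD -mulrA -mulrA [X in _ * X]mulrA -exprMn.
    rewrite [4/3*(3/4)](_ : _ = 1) ?expr1n ?mul1r; last by field.
    apply: mulr_ege1 => //; apply: exprn_ege1; lra.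
  apply: ler_wpDr; first by rewrite !mulr_ge0.
  rewrite -(subnK (ltnW tC)) exprD mulrCA -exprMn.
  by rewrite [2/3*(3/2)](_ : _ = 1) ?expr1n ?mulr1; [apply: exprn_ege1; lra | field].
have := @le_avg _ _ setT _ _ (fun s _ => H s); rewrite avgD !avgM avg_cycle_weight.
rewrite avg_weight_fixed_sets ?cardsT; last by rewrite -addnn in ln; lia.
have a1 := @cycle_avg_short32 R l n.
have ln' : (l <= n - l)%N by lia.
have b1 := @cycle_avg_short34_le R l _ ln'.
have b2 := @cycle_avg_short34_diag R l _ (leqnn l).
have hp k : 0 <= cycle_avg (short_weight l (3/4 : R)) k.
  by apply: cycle_avg_ge0 => j; rewrite /short_weight; case: ifP => _; lra.
have hq k : 0 <= cycle_avg (short_weight l (3/2 : R)) k.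
  by apply: cycle_avg_ge0 => j; rewrite /short_weight; case: ifP => _; lra.
move: a1 b1 b2 (hp l) (hp (n - l)%N) (hq n).
set a := cycle_avg _ n; set b := cycle_avg _ l; set c := cycle_avg _ _; set p := avg _ _.
move=> a1 b1 b2 b0 c0 a0 pub.
have p0 : 0 <= p by rewrite /p -(avg_cst [set: T] 0); apply: le_avg => s _; rewrite ler0n.
pose u : R := 2 ^+ t; pose v : R := (8/9) ^+ t.
have u0 : 0 < u by rewrite exprn_gt0.
have v0 : 0 < v by rewrite exprn_gt0 //; lra.
have l1 : u <= l.+1%:R by rewrite /u -natrX ler_nat.
have l2 : (l.*2.+1)%:R <= 4 * u.
  by rewrite /u -natrX -natrM ler_nat; move: t2; rewrite expnS; clear; lia.
have A : ((2/3) ^+ t * a) ^+ 2 <= 16 * v.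
  rewrite exprMn -exprM mulnC exprM [(2/3)^+2](_ : _ = 8/9 / 2); last by field.
  rewrite exprMn exprVn -/u -/v.
  apply: (@le_trans _ _ (v / u * (16 * u))); last by rewrite mulrCA divfK ?gt_eqF // mulrC.
  apply: ler_wpM2l; [exact: divr_ge0 (ltW v0) (ltW u0)|apply: le_trans a1 _].
  by apply: le_trans (ler_wpM2l _ l2) _ => //; rewrite mulrA -natrM.
have B : ((4/3) ^+ t * (b * c)) ^+ 2 <= 16/9 * v.
  have bc : b * c <= 4/3 * b ^+ 2 by rewrite expr2; nra.
  have b4 : b ^+ 4 * u <= 1 by apply: le_trans b2; rewrite ler_wpM2l // exprn_ge0.
  have : (b * c) ^+ 2 <= (4/3 * b ^+ 2) ^+ 2.
    have bb : 0 <= b ^+ 2 by apply: sqr_ge0.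
    by apply: lerXn2r => //; rewrite nnegrE; [apply: mulr_ge0|lra].
  rewrite [X in _ <= X -> _]exprMn -[_ ^+ 2 ^+ 2]exprM => K.
  rewrite [leLHS]exprMn -exprM mulnC exprM [(4/3)^+2](_ : _ = 8/9 * 2); last by field.
  rewrite exprMn -/u -/v; rewrite [(4/3)^+2](_ : _ = 16/9) in K; last by field.
  have uv0 : 0 <= v * u by rewrite mulr_ge0 ?ltW.
  apply: le_trans (ler_wpM2l uv0 K) _.
  rewrite [leLHS](_ : _ = 16/9 * v * (b ^+ 4 * u)); last by ring.
  by rewrite ler_piMr // mulr_ge0 ?ltW //; lra.
move: A B pub; set A := _ * a; set B := _ * (b * c).
rewrite -/v => A1 B1 pub.
have : p ^+ 2 <= (A + B) ^+ 2 by rewrite ler_sqr ?nnegrE // (le_trans p0).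
(* The constant 36 exceeds $2(16+16/9)$, by $(A+B)^2\le2A^2+2B^2$. *)
by move/le_trans; apply; nra.
Qed.

End PermutationStatistics.

(** * Euler's product and windows of primes *)

Section EulerProduct.
Variable R : realFieldType.
Implicit Types (A B N p : nat).

Definition harmonic N : R := \sum_(m < N) m.+1%:R^-1.

Definition euler_prod B : R := \prod_(p < B.+1 | prime p) (p%:R / (p%:R - 1)).

Lemma prime_gt1R p : prime p -> 2 <= p%:R :> R.
Proof. by move/prime_gt1 => ?; rewrite (ler_nat R 2). Qed.

Lemma euler_factor_ge1 p : prime p -> 1 <= p%:R / (p%:R - 1) :> R.
Proof. by move/prime_gt1R => p2; rewrite ler_pdivlMr; lra. Qed.

Lemma euler_prodS B : euler_prod B.+1 =
  euler_prod B * (if prime B.+1 then B.+1%:R / (B.+1%:R - 1) else 1).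
Proof. by rewrite /euler_prod big_mkcond big_ord_recr /= -big_mkcond. Qed.

Lemma euler_prod_ge1 B : 1 <= euler_prod B.
Proof.
elim: B => [|B IHB]; first by rewrite /euler_prod big_mkcond big_ord1.
rewrite euler_prodS; case: ifP => [pB|]; last by rewrite mulr1.
by apply: mulr_ege1 => //; exact: euler_factor_ge1.
Qed.

Lemma sum_multiples_le (f : nat -> R) p M : (0 < p)%N -> (forall m, 0 <= f m) ->
  \sum_(m < M | (p %| m)%N) f m <= \sum_(k < M) f (p * k)%N.
Proof.
move=> p0 f0.
apply: (@le_trans _ _ (\sum_(m < M) \sum_(k < M | (m == p * k :> nat)%N) f (p * k)%N)).
  rewrite big_mkcond; apply: ler_sum => m _; case: ifP => [pm|_]; last exact: sumr_ge0.
  have kM : (m %/ p < M)%N by apply: leq_ltn_trans (leq_div _ _) (ltn_ord m).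
  have mE : (m = p * (m %/ p) :> nat)%N by rewrite mulnC divnK.
  rewrite (bigD1 (Ordinal kM)) /=; last by apply/eqP.
  by rewrite -mE lerDl sumr_ge0.
rewrite (exchange_big_dep xpredT) //=; apply: ler_sum => k _.
have [kM|kM] := ltnP (p * k)%N M.
  by rewrite (bigD1 (Ordinal kM)) //= big1 ?addr0 // => m /andP[/eqP E /eqP]; case; apply: val_inj.
rewrite big1 // => m /eqP E; by have := ltn_ord m; rewrite E ltnNge kM.
Qed.

(* Removing the multiples of the largest prime p allowed divides the sum over
   smooth numbers by at most p / (p - 1). *)
Lemma smooth_sum_le B N :
  \sum_(m < N.+1 | (0 < m)%N && all (fun p => p <= B)%N (primes m)) m%:R^-1
    <= euler_prod B.
Proof.
elim: B => [|B IHB].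
  apply: le_trans (euler_prod_ge1 0).
  case: N => [|N]; first by rewrite big_mkcond big_ord1 /= ler01.
  rewrite (bigD1 (inord 1)) /= ?inordK //= invr1 big1 ?addr0 // => m /andP[/andP[m0 am] m1].
  have m2 : (1 < m)%N.
    by rewrite ltn_neqAle m0 andbT eq_sym; move: m1; rewrite -val_eqE /= inordK.
  have /allP /(_ (pdiv m)) := am; rewrite mem_primes pdiv_prime // m0 pdiv_dvd /= => /(_ isT).
  by rewrite leqNgt prime_gt0 ?pdiv_prime.
set P := fun C m => (0 < m)%N && all (fun p => p <= C)%N (primes m).
rewrite euler_prodS; case: ifP => [pB|npB]; last first.
  rewrite mulr1; apply: le_trans IHB; rewrite le_eqVlt; apply/orP; left; apply/eqP.
  apply: eq_bigl => m; congr (_ && _); apply: eq_in_all => q.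
  rewrite mem_primes => /and3P[pq _ _]; rewrite leq_eqVlt ltnS.
  by case: eqP => // E; rewrite -E pq in npB.
set s := \sum_(_ < _ | _) _; pose p := B.+1; rewrite -/p in pB *.
have p2 := prime_gt1R pB.
suff H : s <= euler_prod B + s / p%:R.
  rewrite mulrA ler_pdivlMr; last by lra.
  have : s * p%:R <= (euler_prod B + s / p%:R) * p%:R by rewrite ler_wpM2r; lra.
  by rewrite mulrDl divfK ?gt_eqF; lra.
rewrite {1}/s (bigID (fun m : 'I_N.+1 => ~~ (p %| m)%N)) /=; apply: lerD.
  apply: le_trans IHB; rewrite big_mkcond [leRHS]big_mkcond; apply: ler_sum => m _.
  have i0 : 0 <= (m : nat)%:R^-1 :> R by rewrite invr_ge0 ler0n.
  case: ifP => [|_]; last by case: ifP.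
  case/andP => /andP[m0 /allP am] pm; rewrite m0 /=; case: allP => // -[] q qm.
  have := am _ qm; rewrite leq_eqVlt => /predU1P[qp|]; last by rewrite ltnS.
  by case/negP: pm; move: qm; rewrite mem_primes qp => /and3P[].
rewrite (eq_bigl (fun m : 'I_N.+1 => (p %| m)%N && P B.+1 m)); last first.
  by move=> m; rewrite negbK andbC.
rewrite big_mkcondr.
have f0 m : 0 <= (if P B.+1 m then m%:R^-1 else 0) :> R.
  by case: ifP; rewrite ?invr_ge0 ?ler0n.
apply: le_trans (sum_multiples_le N.+1 (ltn0Sn B : (0 < p)%N) f0) _.
rewrite /= /s mulr_suml [leRHS]big_mkcond; apply: ler_sum => k _.
case: ifP => [|_]; last by case: ifP => // _; rewrite divr_ge0 ?invr_ge0 ?ler0n.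
case/andP; rewrite muln_gt0 => /andP[_ k0] /allP a; rewrite k0 /=.
case: allP => [_|[] q qk]; first by rewrite natrM invfM mulrC.
apply: a; move: qk; rewrite !mem_primes => /and3P[-> _ qk] /=.
by rewrite muln_gt0 k0 dvdn_mull.
Qed.

Lemma harmonic_le_euler_prod N : harmonic N <= euler_prod N.
Proof.
apply: le_trans (smooth_sum_le N N); rewrite /harmonic.
rewrite [leRHS]big_mkcond big_ord_recl /= add0r; apply: ler_sum => m _.
rewrite /bump /= add1n /=; case: allP => // -[] p.
rewrite mem_primes => /and3P[_ m0 pm]; apply: leq_trans (dvdn_leq m0 pm) _.
by apply: ltn_ord.
Qed.

(* For odd p, (p / (p - 1))^2 <= p / (p - 2), which telescopes. *)
Lemma euler_prod_ub A : (0 < A)%N -> euler_prod A ^+ 2 <= 4 * A%:R.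
Proof.
have e0 B : 0 <= euler_prod B by apply: le_trans ler01 (euler_prod_ge1 B).
have E1 : euler_prod 1 = 1 by rewrite /euler_prod big_mkcond !big_ord_recl big_ord0 /= !mulr1.
have [k] := ubnP A; elim: k A => // k IHk [|[|A]] //; first by rewrite E1; lra.
rewrite ltnS => Ak _; rewrite euler_prodS; case: ifP => [pA|_]; last first.
  rewrite mulr1; apply: le_trans (IHk A.+1 Ak _) _ => //.
  by rewrite ler_wpM2l ?ler_nat.
case: A Ak pA => [_ _|A Ak pA].
  by rewrite E1 [2%:R - 1](_ : _ = 1) ?divr1; lra.
rewrite euler_prodS; case: ifP => [pA'|_].
  have : ~~ odd A.+2 || ~~ odd A.+3 by rewrite /= !negbK; case: odd.
  case/orP => [ev|ev]; last by have := odd_prime_gt2 _ pA; case: (even_prime pA) => [//|]; rewrite (negbTE ev).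
  case: (even_prime pA') => [[->]|]; last by rewrite (negbTE ev).
  have a2 : 2 - 1 = 1 :> R by lra.
  have a3 : 3 - 1 = 2 :> R by lra.
  rewrite E1 a2 a3; lra.
rewrite mulr1 exprMn.
have IH : euler_prod A.+1 ^+ 2 <= 4 * A.+1%:R by apply: IHk => //; apply: ltnW.
set x : R := A.+1%:R; have x0 : 1 <= x by rewrite ler1n.
have -> : A.+3%:R = x + 2 :> R by rewrite -natrD addn2.
have y0 : 0 < x + 2 - 1 by lra.
rewrite expr_div_n mulrA ler_pdivrMr ?exprn_gt0 //.
have := ler_wpM2r (sqr_ge0 (x + 2)) IH; move/le_trans; apply; rewrite -/x.
rewrite -subr_ge0 [leRHS](_ : _ = 4 * (x + 2)); last by ring.
lra.
Qed.

Definition prime_sum A N : R := \sum_(p < N.+1 | prime p && (A < p)%N) p%:R^-1.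

Lemma prime_sumS A N : prime_sum A N.+1 =
  prime_sum A N + (if prime N.+1 && (A < N.+1)%N then N.+1%:R^-1 else 0).
Proof. by rewrite /prime_sum big_mkcond big_ord_recr /= -big_mkcond. Qed.

(** This amounts to $\prod_{A<p\le B}(1-1/p)\ge1-2\sum_{A<p\le B}1/p$: where Euler's product grows,
    the sum of $1/p$ cannot be small. *)
Lemma euler_prod_tail A B : (A <= B)%N ->
  euler_prod B * (1 - 2 * prime_sum A B) <= euler_prod A.
Proof.
elim: B => [|B IHB].
  rewrite leqn0 => /eqP ->; rewrite /prime_sum big_mkcond big_ord1 /=; lra.
have e0 C : 0 <= euler_prod C by apply: le_trans ler01 (euler_prod_ge1 C).
have z0 A' C : 0 <= prime_sum A' C by apply: sumr_ge0 => p _; rewrite invr_ge0 ler0n.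
rewrite leq_eqVlt => /predU1P[->|].
  by rewrite ler_piMr // gerBl mulr_ge0.
rewrite ltnS => AB; apply: le_trans (IHB AB).
rewrite euler_prodS prime_sumS ltnS AB andbT; case: ifP => [pB|_]; last by rewrite mulr1 addr0.
have p2 := prime_gt1R pB; set p : R := B.+1%:R; rewrite -/p in p2.
set s := prime_sum A B; have s0 : 0 <= s by apply: z0.
rewrite -mulrA; apply: ler_wpM2l => //; rewrite -mulrA mulrCA ler_pdivrMl; last by lra.
have -> : p * (1 - 2 * (s + p^-1)) = p * (1 - 2 * s) - 2.
  by field; lra.
nra.
Qed.

Lemma harmonic_double N : harmonic N <= harmonic N./2 + 1.
Proof.
have N2 : (N./2 <= N)%N by lia.
rewrite /harmonic -!(big_mkord xpredT (fun m => m.+1%:R^-1)) (big_cat_nat (n := N./2)) //=.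
rewrite lerD2l; apply: (@le_trans _ _ (\sum_(N./2 <= m < N) (N./2.+1%:R^-1))).
  rewrite big_nat_cond [leRHS]big_nat_cond; apply: ler_sum => m /andP[/andP[m1 _] _].
  by rewrite lef_pV2 ?posrE ?ltr0n // ler_nat ltnS.
rewrite sumr_const_nat -[_ *+ _]mulr_natl ler_pdivrMr ?ltr0n // mul1r ler_nat; lia.
Qed.

Lemma harmonic_mono M N : (M <= N)%N -> harmonic M <= harmonic N.
Proof.
move=> MN; rewrite /harmonic -!(big_mkord xpredT (fun m => m.+1%:R^-1)).
by rewrite [leRHS](big_cat_nat (n := M)) //= lerDl sumr_ge0 // => i _; rewrite invr_ge0 ler0n.
Qed.

Lemma harmonic_pow2 k : k%:R / 2 <= harmonic (2 ^ k).
Proof.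
elim: k => [|k IHk]; first by rewrite mul0r sumr_ge0 // => i _; rewrite invr_ge0 ler0n.
have le2 : (2 ^ k <= 2 ^ k.+1)%N by rewrite leq_exp2l.
rewrite /harmonic -(big_mkord xpredT (fun m => m.+1%:R^-1)) (big_cat_nat (n := 2 ^ k)) //=.
rewrite big_mkord -/(harmonic _) -natr1 mulrDl lerD //.
apply: (@le_trans _ _ (\sum_(2 ^ k <= m < 2 ^ k.+1) ((2 ^ k.+1)%:R^-1))).
  rewrite sumr_const_nat -[_ *+ _]mulr_natl expnS mul2n -addnn addnK addnn -mul2n natrM.
  by have p0 : (2 ^ k)%:R != 0 :> R; [rewrite pnatr_eq0 expn_eq0|rewrite le_eqVlt; apply/orP; left; apply/eqP; field].
apply: ler_sum_nat => m /andP[_ m1].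
by rewrite lef_pV2 ?posrE ?ltr0n ?expn_gt0 // ler_nat.
Qed.

(** Stop as soon as the sum reaches 1/4: the last prime exceeds 3, so it adds at most 1/4. The bound
    1/2 will keep pairs of primes under control. *)
Lemma prime_sum_window A B : (3 <= A)%N -> 1/4 <= prime_sum A B ->
  exists2 N, (N <= B)%N & 1/4 <= prime_sum A N <= 1/2.
Proof.
move=> A3; elim: B => [|B IHB].
  by rewrite /prime_sum big_mkcond big_ord1 /= => H; exfalso; move: H; lra.
move=> H; have [/IHB [N NB HN]|lt] := lerP (1/4) (prime_sum A B).
  by exists N => //; apply: leqW.
exists B.+1 => //; rewrite H /= prime_sumS; case: ifP => [/andP[_ AB]|_]; last by lra.
have : B.+1%:R^-1 <= 4%:R^-1 :> R.
  by rewrite lef_pV2 ?posrE ?ltr0n // ler_nat (leq_trans _ AB).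
move: lt; rewrite -[4^-1]div1r; set x := B.+1%:R^-1; set y := prime_sum A B; lra.
Qed.

End EulerProduct.

(** Let [h] be the harmonic sum up to $n/2$ and [A] about $16h$. Euler's product is at most $2\sqrt
    A$ at [A], of order $\sqrt h$, and at least [h] at $n/2$; for large [h], [euler_prod_tail]
    forces the sum of $1/p$ between them to reach 1/4. *)
Lemma prime_window (R : archiRealFieldType) (L : nat) : exists N0 : nat, forall n, (N0 <= n)%N ->
  exists A B, [/\ (L <= A)%N, 16 * harmonic R n <= A%:R, (B <= n./2)%N
    & 1/4 <= prime_sum R A B <= 1/2].
Proof.
(* The harmonic sum up to $2^K$ is at least $K/2=1000+16L$, enough to absorb [L] and the numerical
   constants. *)
have [K KE] : exists K, K = (2 * (1000 + 16 * L))%N by eexists.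
exists (2 ^ K).*2 => n nK; pose h := harmonic R n./2.
have hK : 1000 + 16 * L%:R <= h.
  have n2 : (2 ^ K <= n./2)%N by rewrite -(doubleK (2 ^ K)%N) half_leq.
  apply: le_trans (le_trans (harmonic_pow2 R K) (harmonic_mono R n2)).
  by rewrite KE natrM [2 * _]mulrC mulfK ?pnatr_eq0 // natrD natrM.
have L0 : 0 <= L%:R :> R by rewrite ler0n.
pose A := (L + 3 + (Num.truncn (16 * (h + 1))).+1)%N.
have tr : (Num.truncn (16 * (h + 1)))%:R <= 16 * (h + 1) < (Num.truncn (16 * (h + 1))).+1%:R.
  apply: truncn_itv; lra.
case/andP: tr => tr1 tr2.
have A1 : 16 * (h + 1) <= A%:R by rewrite (le_trans (ltW tr2)) // ler_nat /A; lia.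
have A2 : A%:R <= L%:R + 4 + 16 * (h + 1).
  by rewrite /A !natrD -natr1; lra.
have A3 : (3 <= A)%N by rewrite /A -addnA addnCA leq_addr.
have AB : (A <= n./2)%N.
  rewrite -(ler_nat R); apply: le_trans A2 _.
  have B0 : (0 < n./2)%N.
    by rewrite lt0n; apply/eqP => B0; move: hK; rewrite /h B0 /harmonic big_ord0; lra.
  have E1 := harmonic_le_euler_prod R n./2; rewrite -/h in E1.
  have := euler_prod_ub R B0.
  have : h ^+ 2 <= euler_prod R n./2 ^+ 2 by apply: lerXn2r => //; rewrite nnegrE; lra.
  by rewrite !expr2 => H1 H2; nra.
have Sg : 1/4 <= prime_sum R A n./2.
  have tail := euler_prod_tail R AB.
  have E1 := harmonic_le_euler_prod R n./2; rewrite -/h in E1.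
  have E2 : euler_prod R A ^+ 2 <= 4 * A%:R by apply: euler_prod_ub; apply: leq_trans A3.
  have E3 := euler_prod_ge1 R A.
  rewrite leNgt; apply/negP => lt.
  have : h / 2 <= euler_prod R A.
    have s0 : 0 <= prime_sum R A n./2 by apply: sumr_ge0 => p _; rewrite invr_ge0 ler0n.
    by apply: le_trans tail; nra.
  move=> hE; have : (h / 2) ^+ 2 <= euler_prod R A ^+ 2 by apply: lerXn2r => //; rewrite nnegrE; lra.
  rewrite !expr2; rewrite expr2 in E2; nra.
have [B BB HB] := prime_sum_window A3 Sg.
exists A, B; split => //; first by rewrite /A -addnA leq_addr.
by apply: le_trans A1; have := harmonic_double R n; rewrite -/h; lra.
Qed.

(** * Cycles of prime length without companions *)

Section LonePrimeCycles.
Variables (R : realFieldType) (T : finType).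
Implicit Types (s : {perm T}) (p i k : nat).
Local Notation n := #|T|.

(** For a prime [p], this is what makes some power of [s] a single [p]-cycle. *)
Definition lone_cycle p s := [exists x, (#|porbit s x| == p) &&
  [forall y, (p %| #|porbit s y|) ==> (y \in porbit s x)]]%N.

Definition lone_prime_cycle A B s :=
  [exists p : 'I_B.+1, [&& prime p, A < p & lone_cycle p s]]%N.

Definition num_cycles i s := #|[set B in porbits s | #|B| == i]|.

Lemma points_in_cycles_num i s : points_in_cycles i setT s = (i * num_cycles i s)%N.
Proof.
rewrite /points_in_cycles /num_cycles -sum1_card.
rewrite (partition_big (porbit s) (fun B => B \in [set B in porbits s | #|B| == i])) /=; last first.
  by move=> x; rewrite !inE imset_f.
rewrite mulnC -sum_nat_const; apply: eq_bigr => B; rewrite inE => /andP[/imsetP[y _ ->] /eqP <-].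
rewrite -[RHS]sum1_card; apply: eq_bigl => x; rewrite !inE eq_porbit_mem.
case: (boolP (x \in _)) => xy; last by rewrite andbF.
by move: xy; rewrite -eq_porbit_mem => /eqP ->; rewrite ?eqxx.
Qed.

Local Notation c i s := ((num_cycles i s)%:R : R).

Lemma num_cyclesE i s : (0 < i)%N -> c i s = (points_in_cycles i setT s)%:R / i%:R.
Proof. by move=> i0; rewrite points_in_cycles_num natrM mulrC mulKf // pnatr_eq0 -lt0n. Qed.

Lemma avg_num_cycles2 i j : (0 < i)%N -> (0 < j)%N ->
  avg setT (fun s => c i s * c j s) <= ((i == j)%:R * i%:R + 1) / (i%:R * j%:R).
Proof.
move=> i0 j0.
rewrite (eq_avg (G := fun s => (i%:R * j%:R)^-1 * ((points_in_cycles i setT s)%:R * (points_in_cycles j setT s)%:R))).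
  rewrite avgM mulrC ler_wpM2r ?invr_ge0 ?mulr_ge0 // avg_points2.
  case: (_ < _ <= _)%N; rewrite ?mul0r ?mul1r ?addr_ge0 ?mulr_ge0 ?ler01 //.
  by rewrite lerD2l; case: (_ < _ <= _)%N; rewrite ?ler01.
by move=> s _; rewrite !num_cyclesE // invfM mulrACA mulrC.
Qed.

Lemma avg_num_cycles i : (0 < i <= n)%N -> avg setT (fun s => c i s) = i%:R^-1.
Proof.
move=> /andP[i0 iN].
rewrite (eq_avg (G := fun s => i%:R^-1 * (points_in_cycles i setT s)%:R)).
  by rewrite avgM avg_points cardsT i0 iN mulr1.
by move=> s _; rewrite num_cyclesE // mulrC.
Qed.

Lemma sum_even_num_cycles i : (0 < i)%N -> (i.+2 <= n)%N ->
  \sum_(s : {perm T} | ~~ odd_perm s) c i s = (n`!)%:R * (2^-1 * i%:R^-1).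
Proof.
move=> i0 iN; rewrite mulrA -(sum_even_points R i0 iN) mulr_suml; apply: eq_bigr => s _.
exact: num_cyclesE.
Qed.

(** The left side is positive only when there is exactly one [p]-cycle: with $c\ge2$ of them,
    $c(2-c)\le0$. When there is one, each orbit of length $pk$ with $k\ge2$ costs 1. *)
Lemma lone_cycle_lb p s : (0 < p)%N ->
  c p s - (c p s * c p s - c p s) - \sum_(2 <= k < n.+1) c p s * c (p * k) s
    <= (lone_cycle p s)%:R.
Proof.
move=> p0; have S0 : 0 <= \sum_(2 <= k < n.+1) c p s * c (p * k) s.
  by apply: sumr_ge0 => k _; rewrite mulr_ge0.
have [c0|c0] := eqVneq (num_cycles p s) 0%N.
  apply: (@le_trans _ _ 0); last exact: ler0n.
  by move: S0; set z := \sum_(_ <= _ < _) _; rewrite c0 mulr0n; lra.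
have [c1|c1] := eqVneq (num_cycles p s) 1%N; last first.
  have : 2 <= c p s by rewrite (ler_nat R 2); lia.
  move=> c2; apply: (@le_trans _ _ 0); last exact: ler0n.
  nra.
have [lc|nlc] := boolP (lone_cycle p s); first by move: S0; rewrite c1 !mulr1n; lra.
have : exists k, (2 <= k < n.+1)%N && (0 < num_cycles (p * k) s)%N.
  have /cards1P[B EB] := introT eqP c1.
  have : B \in [set B in porbits s | #|B| == p] by rewrite EB inE.
  rewrite inE => /andP[/imsetP[x _ Bx] /eqP Bp].
  move: nlc; rewrite negb_exists => /forallP /(_ x); rewrite -Bx Bp eqxx /=.
  rewrite negb_forall => /existsP[y]; rewrite negb_imply => /andP[/dvdnP[k Ek] yB].
  have k0 : (0 < k)%N by rewrite lt0n; apply: contraNneq (card_porbit_neq0 s y) => k0; rewrite Ek k0.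
  have yo : porbit s y \in porbits s by apply: imset_f.
  exists k; apply/andP; split; last first.
    by apply/card_gt0P; exists (porbit s y); rewrite inE yo Ek mulnC eqxx.
  rewrite ltnS (leq_trans _ (max_card (mem (porbit s y)))) ?Ek ?leq_pmulr // andbT.
  rewrite ltn_neqAle k0 andbT; apply: contraNneq yB => k1.
  have : porbit s y \in [set B in porbits s | #|B| == p] by rewrite inE yo Ek -k1 mul1n eqxx.
  by rewrite EB inE => /eqP <-; exact: porbit_id.
case=> k /andP[kn ck].
have : 1 <= \sum_(2 <= k < n.+1) c p s * c (p * k) s.
  rewrite (bigD1_seq k) ?iota_uniq ?mem_index_iota //= ler_wpDr ?sumr_ge0 // => [j _|].
    by rewrite mulr_ge0.
  by rewrite c1 mul1r ler1n.
rewrite c1 => H; apply: (@le_trans _ _ 0); last exact: ler0n.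
by rewrite mulr1n; lra.
Qed.

Variables A B : nat.
Local Notation Q := (fun p : 'I_B.+1 => prime p && (A < p)%N).

(** Bonferroni's inequality $1_{K>0}\ge K-K(K-1)/2$ for the number [K] of primes of the window with
    a lone cycle; pairs are bounded by products of cycle counts. *)
Lemma lone_prime_cycle_lb s :
  \sum_(p < B.+1 | Q p) (c p s - (c p s * c p s - c p s) - \sum_(2 <= k < n.+1) c p s * c (p * k) s)
  - 2^-1 * \sum_(p < B.+1 | Q p) \sum_(q < B.+1 | Q q && (q != p)) c p s * c q s
  <= (lone_prime_cycle A B s)%:R.
Proof.
pose g (p : nat) : R := (lone_cycle p s)%:R.
have g0 p : 0 <= g p by rewrite ler0n.
have gc p : g p <= c p s.
  rewrite /g; have [/existsP[x /andP[xp _]]|_] := boolP (lone_cycle p s); last by rewrite ler0n.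
  by rewrite ler1n; apply/card_gt0P; exists (porbit s x); rewrite inE imset_f.
have p0 (p : 'I_B.+1) : Q p -> (0 < p)%N by case/andP => /prime_gt0.
pose K := \sum_(p < B.+1 | Q p) g p.
have H1 : \sum_(p < B.+1 | Q p) (c p s - (c p s * c p s - c p s) -
    \sum_(2 <= k < n.+1) c p s * c (p * k) s) <= K.
  by apply: ler_sum => p /p0; exact: lone_cycle_lb.
have H2 : K * K - K <= \sum_(p < B.+1 | Q p) \sum_(q < B.+1 | Q q && (q != p)) c p s * c q s.
  rewrite {1}/K mulr_suml /K -sumrB; apply: ler_sum => p Qp.
  rewrite mulr_sumr (bigD1 p) //= addrAC -[X in _ <= X]add0r lerD //.
    by rewrite /g; case: lone_cycle; rewrite ?mulr1 ?mulr0 subrr.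
  by apply: ler_sum => q _; rewrite ler_pM.
have [|nl] := boolP (lone_prime_cycle A B s).
  move=> _; have [M KM] : exists M : nat, K = M%:R.
    by exists (\sum_(p < B.+1 | Q p) lone_cycle p s)%N; rewrite /K natr_sum.
  case: M KM => [|M] KM; first by rewrite KM mulr0n in H1 H2; rewrite mulr1n; lra.
  have M1 : 0 <= M%:R * (M%:R - 1) :> R.
    case: M {KM} => [|M]; first by rewrite mul0r.
    by rewrite mulr_ge0 // subr_ge0 ler1n.
  by rewrite KM -natr1 in H1 H2; rewrite mulr1n; nra.
have K0 : K = 0.
  apply: big1 => p /andP[pp Ap]; rewrite /g; case: (boolP (lone_cycle p s)) => // lc.
  by case/negP: nl; apply/existsP; exists p; rewrite pp Ap.
by rewrite K0 in H1 H2; rewrite mulr0n; lra.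
Qed.

(** In units of $n!$, a prime [p] contributes $1/(2p)$, minus at most $1/p^2$ for pairs of
    [p]-cycles and $(h-1)/p^2$ for the other multiples of [p]. As $h\le A/16\le p/16$, at least
    $7/(16p)$ is left. With [S] the sum of $1/p$, the total is at least $7S/16-S^2/2\ge3/64$ for
    $1/4\le S\le1/2$. *)
Lemma even_lone_prime_cycle_lb : (4 <= n)%N -> 16 * harmonic R n <= A%:R ->
  (B <= n./2)%N -> 1/4 <= prime_sum R A B <= 1/2 ->
  (n`!)%:R * (3/64) <=
    #|[set s : {perm T} | ~~ odd_perm s & lone_prime_cycle A B s]|%:R :> R.
Proof.
move=> n4 HA Bn /andP[S1 S2].
have p0 (p : 'I_B.+1) : Q p -> (0 < p)%N by case/andP => /prime_gt0.
have pn (p : 'I_B.+1) : (p.+2 <= n)%N by have := ltn_ord p; lia.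
set N := (n`!)%:R : R; have N0 : 0 <= N by rewrite ler0n.
set h := harmonic R n in HA *; set S := prime_sum R A B in S1 S2.
have -> : #|[set s : {perm T} | ~~ odd_perm s & lone_prime_cycle A B s]|%:R =
    \sum_(s : {perm T} | ~~ odd_perm s) (lone_prime_cycle A B s)%:R :> R.
  rewrite -sum1_card natr_sum [RHS](bigID (lone_prime_cycle A B)) /=.
  rewrite [X in _ + X]big1 ?addr0 => [|s /andP[_ /negbTE ->] //].
  by apply: eq_big => s; rewrite ?inE // => /andP[_ ->].
apply: le_trans (ler_sum _ (fun s _ => lone_prime_cycle_lb s)).
rewrite sumrB exchange_big /= -mulr_sumr.
have b1 (p : 'I_B.+1) : Q p -> N * (2^-1 * p%:R^-1 - h / (p%:R * p%:R)) <=
  \sum_(s : {perm T} | ~~ odd_perm s)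
    (c p s - (c p s * c p s - c p s) - \sum_(2 <= k < n.+1) c p s * c (p * k) s).
  move=> /p0 p1; have pR : p%:R != 0 :> R by rewrite pnatr_eq0 -lt0n.
  rewrite sumrB sumrB sum_even_num_cycles // mulrBr -/N.
  have U1 : \sum_(s : {perm T} | ~~ odd_perm s) (c p s * c p s - c p s) <= N * (1 / (p%:R * p%:R)).
    apply: le_trans (ler_sum_even _) _ => [s|].
      by rewrite subr_ge0 -natrM ler_nat; case: (num_cycles p s) => // m; rewrite leq_pmulr.
    rewrite ler_wpM2l // (eq_avg (G := fun s => c p s * c p s + (-1) * c p s)); last by move=> s _; rewrite mulN1r.
    rewrite avgD avgM avg_num_cycles ?p1 /=; last by apply: ltnW; apply: ltnW.
    apply: le_trans (lerD (avg_num_cycles2 p1 p1) (lexx _)) _.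
    by rewrite eqxx [true%:R]mulr1n mul1r [leLHS](_ : _ = 1 / (p%:R * p%:R)) //; field.
  have U2 : \sum_(s : {perm T} | ~~ odd_perm s) \sum_(2 <= k < n.+1) c p s * c (p * k) s
      <= N * ((h - 1) / (p%:R * p%:R)).
    apply: le_trans (ler_sum_even _) _ => [s|].
      by apply: sumr_ge0 => k _; rewrite mulr_ge0.
    rewrite ler_wpM2l //.
    rewrite avg_sum; have -> : h - 1 = \sum_(2 <= k < n.+1) k%:R^-1.
      rewrite /h /harmonic -(big_mkord xpredT (fun m => m.+1%:R^-1)) big_add1 /=.
      have n0 : (0 < n)%N by lia.
      by rewrite [\sum_(0 <= _ < _) _](big_ltn n0) invr1 [1 + _]addrC addrK.
    rewrite mulr_suml; apply: ler_sum_nat => k /andP[k2 _].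
    have k0 : (0 < p * k)%N by rewrite muln_gt0 p1 /=; lia.
    apply: le_trans (avg_num_cycles2 p1 k0) _.
    have -> : (p == p * k :> nat)%N = false.
      by apply/negbTE; rewrite -{1}[p : nat]muln1 eqn_pmul2l //; lia.
    have kR : k%:R != 0 :> R by rewrite pnatr_eq0 -lt0n; lia.
    rewrite [false%:R]mulr0n mul0r add0r natrM.
    by rewrite [leLHS](_ : _ = k%:R^-1 / (p%:R * p%:R)) //; field; rewrite pR kR.
  apply: (@le_trans _ _ (N * (2^-1 * p%:R^-1) - N * (1 / (p%:R * p%:R)) -
      N * ((h - 1) / (p%:R * p%:R)))); last by rewrite !lerB.
  by rewrite le_eqVlt; apply/orP; left; apply/eqP; ring.
have b2 : \sum_(s : {perm T} | ~~ odd_perm s)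
    \sum_(p < B.+1 | Q p) \sum_(q < B.+1 | Q q && (q != p)) c p s * c q s <= N * (S * S).
  rewrite exchange_big /= {1}/S /prime_sum mulr_suml mulr_sumr; apply: ler_sum => p Qp.
  rewrite exchange_big /= mulr_sumr mulr_sumr.
  rewrite [leRHS](bigID (fun q : 'I_B.+1 => q != p)) /= ler_wpDr //.
    by apply: sumr_ge0 => q _; rewrite !mulr_ge0 ?invr_ge0 ?ler0n.
  apply: ler_sum => q /andP[Qq qp]; have [p1 q1] := (p0 _ Qp, p0 _ Qq).
  apply: le_trans (ler_sum_even _) _ => [s|]; first by rewrite mulr_ge0.
  rewrite ler_wpM2l //; apply: le_trans (avg_num_cycles2 p1 q1) _.
  by rewrite eq_sym (negbTE (qp : q != p :> nat)) mul0r add0r mul1r invfM.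
apply: le_trans (lerB (ler_sum _ b1) (ler_wpM2l _ b2)); last by rewrite invr_ge0 ler0n.
have b3 : \sum_(p < B.+1 | Q p) (2^-1 * p%:R^-1 - h / (p%:R * p%:R)) >= 7/16 * S.
  rewrite /S /prime_sum mulr_sumr; apply: ler_sum => p Qp; have p1 := p0 p Qp.
  have pR : 0 < p%:R :> R by rewrite ltr0n.
  case/andP: Qp => _ Ap; have : 16 * h <= p%:R by rewrite (le_trans HA) // ler_nat ltnW.
  move=> hp; have : h / (p%:R * p%:R) <= 1/16 * p%:R^-1.
    rewrite invfM mulrA; apply: ler_wpM2r; first by rewrite invr_ge0 ltW.
    by rewrite ler_pdivrMr //; lra.
  by set u := _ / (_ * _); set v := p%:R^-1; lra.
rewrite -mulr_sumr; set X := \sum_(_ < _ | _) _ in b3 *.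
rewrite [leRHS](_ : _ = N * (X - 2^-1 * (S * S))); last by ring.
rewrite ler_wpM2l //; nra.
Qed.

End LonePrimeCycles.

(** * Jordan's theorem: all sets of size p are rotated *)

Section JordanPrimeCycle.
Local Open Scope group_scope.
Variables (T : finType) (G : {group {perm T}}).
Implicit Types (A D : {set T}) (a b g s : {perm T}).

Definition cyclic_on D b := perm_on D b && [forall u in D, D \subset porbit b u].

(* A set D is rotated by G when any two points of D are matched by an element
   of G acting as a full cycle on D and trivially elsewhere; the support of a
   cycle of prime length in G is such a set. *)
Definition rotated D := [forall x in D, forall y in D, (x != y) ==>
  [exists b in G, cyclic_on D b && (b x == y)]].

Lemma rotatedP D : reflect
  (forall x y, x \in D -> y \in D -> x != y -> exists2 b, b \in G & cyclic_on D b /\ b x = y)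
  (rotated D).
Proof.
apply: (iffP forall_inP) => [H x y xD yD xy|H x xD].
  have /forall_inP /(_ y yD) := H x xD; rewrite xy => /existsP[b /andP[bG /andP[cb /eqP bx]]].
  by exists b.
apply/forall_inP => y yD; apply/implyP => /(H x y xD yD)[b bG [cb bx]].
by apply/existsP; exists b; rewrite bG cb bx eqxx.
Qed.

Lemma porbit_closed D b x : b @: D = D -> x \in D -> porbit b x \subset D.
Proof.
move=> bD xD; apply/subsetP => _ /porbitP[i ->].
elim: i => [|i IHi]; first by rewrite expg0 perm1.
by rewrite expgSr permM -bD mem_imset //; exact: perm_inj.
Qed.

Lemma cyclic_on_closed D b A x : cyclic_on D b -> x \in D -> x \in A -> b @: A = A ->
  D \subset A.
Proof.
case/andP => _ /forall_inP H xD xA bA.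
exact: subset_trans (H x xD) (porbit_closed bA xA).
Qed.

(** A nontrivial power of a cycle of prime length generates the same cyclic group, hence has the
    same orbits. *)
Lemma prime_cycle_rotated a x : a \in G -> prime #|porbit a x| ->
  perm_on (porbit a x) a -> rotated (porbit a x).
Proof.
move=> aG pp aD; set D := porbit a x in pp aD *; set p := #|D| in pp.
have ap : a ^+ p = 1.
  apply/permP => u; rewrite perm1; have [uD|uD] := boolP (u \in D); last first.
    by rewrite (out_perm (perm_onX p aD)).
  have E : porbit a u = D by apply/eqP; rewrite eq_porbit_mem.
  by rewrite permX /p -E iter_porbit.
apply/rotatedP => y z yD zD yz.
have Dy : porbit a y = D by apply/eqP; rewrite eq_porbit_mem.
have /porbitP[i zE] : z \in porbit a y by rewrite Dy.
have oa : #[a] = p.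
  have : (#[a] %| p)%N by rewrite order_dvdn ap.
  case/primeP: pp => _ /(_ #[a]) H /H /orP[|/eqP //].
  rewrite order_eq1 => /eqP a1; case/eqP: yz; by rewrite zE a1 expg1n perm1.
have cop : coprime p i.
  rewrite prime_coprime //; apply: contra yz => /dvdnP[k ik].
  by rewrite zE ik mulnC expgM ap expg1n perm1.
exists (a ^+ i); first exact: groupX.
split; last by [].
rewrite /cyclic_on perm_onX //=; apply/forall_inP => u uD.
have Du : porbit a u = D by apply/eqP; rewrite eq_porbit_mem.
have := generator_coprime a i; rewrite /generator oa cop => E; have {}E := eqP E.
suff -> : porbit (a ^+ i) u = D by [].
by rewrite -[RHS]Du !porbit.unlock -E.
Qed.

Lemma mem_imsetT A g x : (g x \in g @: A) = (x \in A).
Proof. by rewrite mem_imset //; exact: perm_inj. Qed.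

Lemma card_imsetT A g : #|g @: A| = #|A|.
Proof. by rewrite card_imset //; exact: perm_inj. Qed.

Lemma porbitJ b g x : porbit (b ^ g) (g x) = g @: porbit b x.
Proof.
apply/setP => y; rewrite -(permKV g y) mem_imsetT.
apply/porbitP/porbitP => -[i E]; exists i.
  by apply: (@perm_inj _ g); rewrite E -conjXg permJ.
by rewrite E -conjXg permJ.
Qed.

Lemma cyclic_onJ D b g : cyclic_on D b -> cyclic_on (g @: D) (b ^ g).
Proof.
case/andP => bD /forall_inP cb; apply/andP; split.
  apply/subsetP => y; rewrite inE -(permKV g y) mem_imsetT permJ => H.
  by apply: (subsetP bD); rewrite inE; apply: contraNneq H => ->.
apply/forall_inP => _ /imsetP[u uD ->].
by rewrite porbitJ imsetS // cb.
Qed.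

Lemma rotatedJ D g : g \in G -> rotated D -> rotated (g @: D).
Proof.
move=> gG /rotatedP H; apply/rotatedP => _ _ /imsetP[x xD ->] /imsetP[y yD ->] xy.
have {}xy : x != y by apply: contraNneq xy => ->.
have [b bG [cb bx]] := H x y xD yD xy.
by exists (b ^ g); rewrite ?groupJ //; split; [exact: cyclic_onJ | rewrite permJ bx].
Qed.

Lemma imsetTK A g : g^-1 @: (g @: A) = A.
Proof.
apply/setP => x; apply/imsetP/idP => [[_ /imsetP[y yA ->] ->]|xA]; first by rewrite permK.
by exists (g x); rewrite ?permK ?imset_f.
Qed.

Lemma imsetTM A g b : (g * b) @: A = b @: (g @: A).
Proof.
by rewrite -imset_comp; apply: eq_imset => x; rewrite /= permM.
Qed.

Lemma subset_of_card A D k : A \subset D -> (#|A| <= k <= #|D|)%N ->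
  exists2 E : {set T}, A \subset E /\ E \subset D & #|E| = k.
Proof.
move=> AD /andP[Ak kD]; elim: k kD Ak => [|k IHk] kD.
  by rewrite leqn0 cards_eq0 => /eqP A0; exists A; rewrite A0 ?sub0set ?cards0.
rewrite leq_eqVlt => /predU1P[Ak|Ak]; first by exists A.
have [E [AE ED] Ek] := IHk (ltnW kD) Ak.
have /subsetPn[x xD xE] : ~~ (D \subset E).
  by apply: contraTN kD => /subset_leq_card; rewrite Ek -leqNgt.
exists (x |: E); last by rewrite cardsU1 xE Ek.
by rewrite (subset_trans AE (subsetUr _ _)) subUset sub1set xD.
Qed.

(** No set of intermediate size is a block; for a transitive group this is primitivity. *)
Definition no_blocks := forall A, (1 < #|A| < #|T|)%N ->
  exists2 g, g \in G & (g @: A != A) && ~~ [disjoint g @: A & A].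

(* Take A maximal with all its p-subsets rotated and a translate g A that meets
   A in as many points as possible: rotating p points of g A brings A closer to
   itself unless the two sets differ by a single point, and in that case
   A :|: g A is a larger such set. *)
Lemma all_rotated p D0 : (3 <= p)%N -> no_blocks -> #|D0| = p -> rotated D0 ->
  forall D, #|D| = p -> rotated D.
Proof.
move=> p3 nb D0p rD0.
pose P A := (p <= #|A|)%N && [forall D : {set T}, (D \subset A) && (#|D| == p) ==> rotated D].
have PD0 : P D0.
  rewrite /P D0p leqnn /=; apply/forallP => D; apply/implyP => /andP[sD /eqP Dp].
  by have /eqP -> : D == D0 by rewrite eqEcard sD D0p Dp leqnn.
have [A /maxsetP[/andP[Ap /forallP PA] Amax] _] := maxset_exists PD0.
have {}PA D : D \subset A -> #|D| = p -> rotated D.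
  by move=> DA Dp; have := PA D; rewrite DA Dp eqxx.
have [AT|AT] := leqP #|T| #|A|.
  move=> D; apply: PA; have /eqP -> : A == setT by rewrite eqEcard subsetT cardsT.
  exact: subsetT.
have [|g0 g0G /andP[g0A g0d]] := nb A; first by rewrite AT andbT (leq_trans _ Ap) // ltnW.
pose Q g := (g \in G) && (g @: A != A).
have Qg0 : Q g0 by rewrite /Q g0G.
case: (arg_maxnP (fun g => #|A :&: g @: A|) Qg0) => g /andP[gG gA] gmax.
set A' := g @: A in gA gmax; pose I := A :&: A'.
have A'c : #|A'| = #|A| by rewrite card_imsetT.
have PA' D : D \subset A' -> #|D| = p -> rotated D.
  move=> DA Dp; rewrite -(imsetTK D g^-1) invgK; apply: rotatedJ => //.
  apply: PA; last by rewrite card_imsetT.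
  by rewrite -(imsetTK A g) imsetS.
have I0 : (0 < #|I|)%N.
  apply: leq_trans (gmax _ Qg0); rewrite card_gt0; move: g0d.
  by rewrite -setI_eq0 setIC.
have cDA : (#|A :\: A'| = #|A' :\: A|)%N.
  by apply/eqP; rewrite -(eqn_add2l #|I|) cardsID -A'c /I setIC cardsID.
have e0 : (0 < #|A' :\: A|)%N.
  rewrite card_gt0; apply: contraNneq gA => /eqP; rewrite setD_eq0 => sA.
  by rewrite eqEcard sA A'c leqnn.
(* Two points [x], [y] of [A' :\: A] and a common point [z] of [A] and [A'] are placed in one
   [p]-subset [E] of [A'], rotated by [b] so that [x] goes to [y]. *)
exfalso; have [e2|e1] := ltnP 1 #|A' :\: A|.
  have [x [y [xD yD xy]]] := card_gt1P e2.
  have [z zI] := card_gt0P I0.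
  have [xA' xA] := setDP xD; have [yA' yA] := setDP yD; have [zA zA'] := setIP zI.
  have [||E [sE EA'] Ep] := @subset_of_card [set x; y; z] A' p.
  - by rewrite !subUset !sub1set xA' yA'.
  - rewrite A'c Ap andbT (leq_trans _ p3) // -setUA cardsU1 (leq_trans (leq_add (leq_b1 _) (leqnn _))) //.
    by rewrite cards2; case: (_ == _).
  have [xE yE zE] : [/\ x \in E, y \in E & z \in E].
    by split; apply: (subsetP sE); rewrite !inE eqxx ?orbT.
  have [b bG [cb bx]] := rotatedP _ (PA' E EA' Ep) x y xE yE xy.
  have bE : perm_on E b by case/andP: cb.
  have bA' : b @: A' = A' by apply: im_perm_on; apply: subset_trans bE EA'.
  (* If [b] preserved [A], then [I] would be invariant and meet [E] at [z], hence contain [E] and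
     [x]. *)
  have bA : b @: A != A.
    apply: contraNneq xA => bA; suff /subsetP/(_ x xE): E \subset I by case/setIP.
    apply: cyclic_on_closed cb zE zI _.
    by rewrite /I imsetI ?bA ?bA' //; exact: in2W (@perm_inj _ b).
  have := gmax b; rewrite /Q bG bA => /(_ isT); apply/negP; rewrite -ltnNge -/I.
  (* [b] fixes [A :\: A'] pointwise since [E] lies in [A'], and [y] is not in [b @: I] since it
     comes from [x]. The new intersection gains [#|A :\: A'|] points and loses at most
     [#|A' :\: A| - 1]. *)
  have sub : (A :\: A') :|: ((b @: I) :\: ((A' :\: A) :\ y)) \subset A :&: b @: A.
    apply/subsetP => u; rewrite in_setU => /orP[/setDP[uA uA']|].
      rewrite inE uA /=; apply/imsetP; exists u => //; rewrite (out_perm bE) //.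
      by apply: contra uA'; apply: (subsetP EA').
    case/setDP => /imsetP[v /setIP[vA vA'] ->].
    have bv : b v \in A' by rewrite -bA' mem_imsetT.
    rewrite !inE bv andbT negb_and !negbK mem_imsetT vA => /orP[/eqP bvy|->//].
    by case/negP: xA; rewrite -(perm_inj (etrans bvy (esym bx))).
  apply: leq_trans (subset_leq_card sub).
  rewrite cardsU disjoint_setI0 ?cards0 ?subn0; last first.
    rewrite disjoints_subset; apply/subsetP => u /setDP[_ uA']; rewrite !inE.
    apply: contra uA' => /andP[_ /imsetP[v /setIP[_ vA'] ->]].
    by rewrite -bA' mem_imsetT.
  have uv := subset_leq_card (subsetIr (b @: I) ((A' :\: A) :\ y)).
  rewrite (cardsD (b @: I)) card_imsetT cDA (cardsD1 y (A' :\: A)) yD add1n addSn ltnS.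
  apply: leq_trans (leq_add (leqnn _) (leq_sub (leqnn _) uv)); by rewrite -leq_subLR.
have /cards1P[y yE] : #|A' :\: A| == 1%N by rewrite eqn_leq e1 e0.
have /cards1P[x xE] : #|A :\: A'| == 1%N by rewrite cDA eqn_leq e1 e0.
have /setDP[yA' yA] : y \in A' :\: A by rewrite yE inE.
have /setDP[xA xA'] : x \in A :\: A' by rewrite xE inE.
have AE u : u \in A -> u != x -> u \in A'.
  move=> uA ux; apply: contraTT ux => uA'; rewrite negbK -in_set1 -xE inE uA'. by [].
suff /Amax /(_ (subsetUr _ _)) E : P (y |: A) by case/negP: yA; rewrite -E setU11.
rewrite /P cardsU1 yA (leq_trans Ap) ?leq_addl //=.
apply/forallP => D; apply/implyP => /andP[DyA /eqP Dp].
have DA u : u \in D -> u != y -> u \in A.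
  by move=> /(subsetP DyA); rewrite !inE => /orP[/eqP->|//]; rewrite eqxx.
have [yD|yD] := boolP (y \in D); last first.
  by apply: PA Dp; apply/subsetP => u uD; apply: DA => //; apply: contraNneq yD => <-.
have xy : x != y by apply: contraNneq xA' => ->.
have [xD|xD] := boolP (x \in D); last first.
  apply: PA' Dp; apply/subsetP => u uD; have [->//|uy] := eqVneq u y.
  by apply: AE; [apply: DA | apply: contraNneq xD => <-].
(* When [D] contains both [x] and [y], replace [y] by a point [z] of [A] outside [D]. The rotation
   taking [z] to [x] maps [D] into [A']: it fixes [y] and sends no point of [D] to [x]. *)
have /subsetPn[z zA zD] : ~~ (A \subset D).
  apply: contraTN yD => AD; suff -> : D = A by [].
  by apply/esym/eqP; rewrite eqEcard AD Dp.
pose D' := z |: (D :\ y).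
have D'A : D' \subset A.
  by rewrite subUset sub1set zA; apply/subsetP => u /setD1P[uy uD]; apply: DA.
have D'p : #|D'| = p.
  by rewrite cardsU1 !inE (negbTE zD) andbF /= -Dp (cardsD1 y D) yD.
have xD' : x \in D' by rewrite !inE xD xy orbT.
have zD' : z \in D' by rewrite setU11.
have zx : z != x by apply: contraNneq zD => ->.
have [b bG [/andP[bD' _] bz]] := rotatedP _ (PA D' D'A D'p) z x zD' xD' zx.
rewrite -(imsetTK D b); apply: rotatedJ; first exact: groupVr.
apply: PA'; last by rewrite card_imsetT.
apply/subsetP => _ /imsetP[u uD ->]; have [->|uy] := eqVneq u y.
  by rewrite (out_perm bD') //; apply: contra yA; apply: (subsetP D'A).
have uD' : u \in D' by rewrite !inE uD uy orbT.
apply: AE; first by apply: (subsetP D'A); rewrite perm_closed.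
by apply: contraNneq zD => bu; rewrite -(perm_inj (etrans bu (esym bz))).
Qed.

End JordanPrimeCycle.

(** * From rotated sets to the alternating group *)

Section AlternatingCriterion.
Local Open Scope group_scope.
Variables (T : finType) (G : {group {perm T}}).
Implicit Types (A D : {set T}) (a b g s : {perm T}).
Local Notation n := #|T|.

(** On three points, a full cycle sending [x] to [y] can only be $x\mapsto y\mapsto z\mapsto x$. *)
Lemma tperm_mul_rotated3 x y z : rotated G [set x; y; z] -> uniq [:: x; y; z] ->
  tperm y z * tperm x y \in G.
Proof.
move=> /rotatedP H; rewrite /= !inE negb_or andbT => /andP[/andP[xy xz] yz].
have [||//|b bG [cb bx]] := H x y; rewrite ?inE ?eqxx ?orbT //.
case/andP: cb => bD /forall_inP cb; set D := [set x; y; z] in bD cb.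
have [xD yD zD] : [/\ x \in D, y \in D & z \in D] by rewrite !inE !eqxx ?orbT.
have no2 (u v : T) : u \in D -> v \in D -> z \in D -> b u = v -> b v = u -> z \in [set u; v].
  move=> uD vD _ bu bv; have := subsetP (cb u uD) z zD.
  apply/subsetP/porbit_closed; last by rewrite !inE eqxx.
  by rewrite imsetU !imset_set1 bu bv setUC.
have byD : b y \in D by rewrite perm_closed.
have bynx : b y != x.
  apply: contraNneq xz => E; have := no2 x y xD yD zD bx E.
  by rewrite !inE [z == y]eq_sym (negbTE yz) orbF eq_sym.
have byny : b y != y by rewrite -{2}bx (inj_eq perm_inj) eq_sym.
have by_z : b y = z.
  by move: byD; rewrite !inE (negbTE bynx) (negbTE byny) => /eqP.
have bzD : b z \in D by rewrite perm_closed.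
have bz_x : b z = x.
  have e1 : b z != y by rewrite -bx (inj_eq perm_inj) eq_sym.
  have e2 : b z != z by rewrite -{2}by_z (inj_eq perm_inj) eq_sym.
  by move: bzD; rewrite !inE (negbTE e1) (negbTE e2) !orbF => /eqP.
suff -> : tperm y z * tperm x y = b by [].
apply/permP => u; rewrite permM.
have [->|ux] := eqVneq u x; first by rewrite (@tpermD _ y z x) 1?eq_sym // tpermL bx.
have [->|uy] := eqVneq u y; first by rewrite tpermL (@tpermD _ x y z) // by_z.
have [->|uz] := eqVneq u z; first by rewrite tpermR tpermR bz_x.
rewrite (@tpermD _ y z u) 1?eq_sym // (@tpermD _ x y u) 1?eq_sym // (out_perm bD) //.
by rewrite !inE (negbTE ux) (negbTE uy) (negbTE uz).
Qed.

(** An even permutation is a product of pairs of transpositions, and each pair is a product of at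
    most two 3-cycles, obtained by inserting a linking transposition twice. *)
Lemma Alt_sub_rotated3 : (forall D : {set T}, #|D| = 3%N -> rotated G D) -> 'Alt_T \subset G.
Proof.
move=> H.
have H1 x y z : x != y -> y != z -> tperm y z * tperm x y \in G.
  move=> xy yz; have [->|xz] := eqVneq x z.
    by rewrite [tperm z y]tpermC tperm2 group1.
  apply: tperm_mul_rotated3; last by rewrite /= !inE negb_or xy xz yz.
  by apply: H; rewrite -setUA cardsU1 cards2 !inE negb_or xy xz yz.
have H2 (a b c d : T) : a != b -> c != d -> tperm a b * tperm c d \in G.
  move=> ab cd; have [bc|bc] := eqVneq b c.
    by rewrite -{c}bc in cd *; rewrite tpermC [tperm b d]tpermC H1 // eq_sym.
  have -> : tperm a b * tperm c d = (tperm b a * tperm c b) * (tperm c b * tperm d c).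
    by rewrite -mulgA (mulgA (tperm c b)) tperm2 mul1g tpermC [tperm d c]tpermC.
  by rewrite groupM // H1 // eq_sym.
apply/subsetP => s; rewrite Alt_even; have [ts -> dts] := prod_tpermP s.
rewrite odd_perm_prod //; have [k] := ubnP (size ts); elim: k ts dts => // k IHk.
case=> [|[a b] [|[c d] ts]] /=; first by rewrite big_nil group1.
  by [].
case/and3P => ab cd dts; rewrite !ltnS negbK => /ltnW lt ev.
by rewrite !big_cons mulgA groupM ?H2 ?IHk.
Qed.

(* Two full cycles whose supports share a single point have a 3-cycle as
   commutator. *)
Lemma commutator_rotated3 (D1 D2 : {set T}) o : rotated G D1 -> rotated G D2 ->
  D1 :&: D2 = [set o] -> (1 < #|D1|)%N -> (1 < #|D2|)%N ->
  exists2 D : {set T}, #|D| = 3%N & rotated G D.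
Proof.
move=> r1 r2 E c1 c2.
have /setIP[o1 o2] : o \in D1 :&: D2 by rewrite E inE.
have ex (D : {set T}) : rotated G D -> o \in D -> (1 < #|D|)%N ->
    exists b, [/\ b \in G, perm_on D b & b o != o].
  move=> /rotatedP r oD /card_gt1P[x [y [xD yD xy]]].
  have [z zD oz] : exists2 z, z \in D & o != z.
    by have [ox|] := eqVneq o x; [exists y; rewrite ?ox | exists x].
  by have [b bG [/andP[bD _] bo]] := r o z oD zD oz; exists b; rewrite bo eq_sym.
have [a [aG aD ao]] := ex _ r1 o1 c1; have [b [bG bD bo]] := ex _ r2 o2 c2.
have d12 u : u \in D1 -> u != o -> u \notin D2.
  by move=> u1 uo; apply: contra uo => u2; rewrite -in_set1 -E inE u1.
have d21 u : u \in D2 -> u != o -> u \notin D1.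
  by move=> u1 uo; apply: contra uo => u2; rewrite -in_set1 -E inE u1 u2.
have aV := perm_onV aD; have bV := perm_onV bD.
have aoD : a o \in D1 by rewrite perm_closed.
have boD : b o \in D2 by rewrite perm_closed.
have ab : a o != b o by apply: contraNneq (d12 _ aoD ao) => ->.
pose c := a^-1 * b^-1 * a * b.
have cE u : c u = b (a (b^-1 (a^-1 u))) by rewrite /c !permM.
have c_ao : c (a o) = o.
  rewrite cE permK; have : b^-1 o \in D2 by rewrite perm_closed.
  have bVo : b^-1 o != o by rewrite (canF_eq (permKV b)) eq_sym.
  by move=> H; rewrite (out_perm aD) ?d21 // permKV.
have c_o : c o = b o.
  rewrite cE; have H : a^-1 o \in D1 by rewrite perm_closed.
  have aVo : a^-1 o != o by rewrite (canF_eq (permKV a)) eq_sym.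
  by rewrite (out_perm bV) ?d12 // permKV.
have c_bo : c (b o) = a o.
  by rewrite cE (out_perm aV) ?d21 // permK (out_perm bD) // d12.
have c_fix u : u != o -> u != a o -> u != b o -> c u = u.
  move=> uo ua ub; rewrite cE; have [u1|u1] := boolP (u \in D1).
    have H : a^-1 u \in D1 by rewrite perm_closed.
    have H2 : a^-1 u != o by rewrite (canF_eq (permKV a)).
    by rewrite (out_perm bV) ?d12 // permKV (out_perm bD) // d12.
  rewrite (out_perm aV) //; have [u2|u2] := boolP (u \in D2); last first.
    by rewrite (out_perm bV) // (out_perm aD) // (out_perm bD).
  have H : b^-1 u \in D2 by rewrite perm_closed.
  have H2 : b^-1 u != o by rewrite (canF_eq (permKV b)).
  by rewrite (out_perm aD) ?d21 // permKV.
have po : porbit c o = [set o; b o; a o].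
  apply/eqP; rewrite eqEsubset; apply/andP; split.
    apply: porbit_closed; last by rewrite !inE eqxx.
    by rewrite !imsetU !imset_set1 c_o c_bo c_ao setUC setUA.
  rewrite !subUset !sub1set porbit_id -{1}c_o -{1}(expg1 c) mem_porbit /=.
  by rewrite -c_bo -c_o -permM -{1}(expg1 c) -expgSr mem_porbit.
have p3 : #|porbit c o| = 3%N.
  by rewrite po -setUA cardsU1 cards2 !inE negb_or ![o == _]eq_sym ao bo eq_sym ab.
exists (porbit c o) => //; apply: prime_cycle_rotated; rewrite ?p3 //.
  by rewrite !groupM ?groupV.
apply/subsetP => u; rewrite inE; apply: contraR; rewrite po !inE !negb_or.
by case/andP => /andP[uo ub] ua; rewrite c_fix.
Qed.

(** As $2p\le n$, some [p]-set meets [D0] in exactly one point. The resulting 3-cycle lets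
    [all_rotated] be applied again with 3 in place of [p]. *)
Lemma Alt_sub_rotated p D0 : (3 <= p)%N -> (p.*2 <= n)%N -> no_blocks G ->
  #|D0| = p -> rotated G D0 -> 'Alt_T \subset G.
Proof.
move=> p3 pn nb D0p rD0; have all_p := all_rotated p3 nb D0p rD0.
have [|o oD] := card_gt0P (_ : (0 < #|D0|)%N); first by rewrite D0p; apply: leq_trans p3.
have [||E [oE ED] Ep] := @subset_of_card _ [set o] (o |: ~: D0) p.
- exact: subsetUl.
- rewrite cards1 (leq_trans _ p3) //= cardsU1 inE oD.
  by have := cardsC D0; rewrite D0p; lia.
have EI : D0 :&: E = [set o].
  apply/setP => u; rewrite !inE; apply/andP/eqP => [[uD /(subsetP ED)]|->].
    by rewrite !inE uD orbF => /eqP.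
  by rewrite oD (subsetP oE) // inE.
have [||D3 D33 r3] := commutator_rotated3 rD0 (all_p E Ep) EI; rewrite ?D0p ?Ep ?(leq_trans _ p3) //.
exact: Alt_sub_rotated3 (all_rotated (leqnn 3) nb D33 r3).
Qed.

(** Let [m] be the part of $n!$ prime to [p]. Every orbit length prime to [p] divides [m], so $s^m$
    fixes all points outside the [p]-orbit; it is still a full cycle on that orbit because [p] does
    not divide [m]. *)
Lemma lone_cycle_rotated p s : prime p -> s \in G -> lone_cycle p s ->
  exists2 D : {set T}, #|D| = p & rotated G D.
Proof.
move=> pp sG /existsP[x /andP[/eqP xp /forallP H]].
pose m := ((n`!)`_p^')%N; pose a := s ^+ m.
have cop : coprime p m.
  rewrite prime_coprime //; apply/negP => pm.
  have := part_pnat p^' (n`!)%N; rewrite -/m => /pnatP /(_ p pp pm).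
  by rewrite !inE eqxx => /(_ (part_gt0 _ _)).
have s_per y i : (s ^+ (#|porbit s y| * i)) y = y.
  have e : (s ^+ #|porbit s y|) y = y by rewrite permX iter_porbit.
  elim: i => [|i IHi]; first by rewrite muln0 expg0 perm1.
  by rewrite mulnS expgD permM e IHi.
have afix y : y \notin porbit s x -> a y = y.
  move=> yx; have npy : ~~ (p %| #|porbit s y|)%N.
    by apply: contra yx => py; have := H y; rewrite py.
  have : (#|porbit s y| %| m)%N.
    have k0 : (0 < #|porbit s y|)%N by rewrite lt0n card_porbit_neq0.
    have -> : #|porbit s y| = (#|porbit s y|`_p^')%N.
      by rewrite part_pnat_id // p'natE.
    by apply: partn_dvd; rewrite ?fact_gt0 // dvdn_fact // k0 max_card.
  by case/dvdnP => k mE; rewrite /a mE mulnC s_per.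
have po : porbit a x = porbit s x.
  apply/eqP; rewrite eqEsubset; apply/andP; split; apply/subsetP => y /porbitP[i ->].
    by rewrite -expgM mem_porbit.
  have m0 : (0 < m)%N by apply: part_gt0.
  case: (egcdnP p m0) => km kn E _; rewrite gcdnC (eqP cop) in E.
  apply/porbitP; exists (km * i)%N; rewrite /a -expgM mulnA [(m * km)%N]mulnC E.
  have -> : ((kn * p + 1) * i = #|porbit s x| * (kn * i) + i)%N.
    by rewrite xp mulnDl mul1n [(kn * p)%N]mulnC mulnA.
  by rewrite expgD permM s_per.
exists (porbit a x); first by rewrite po.
apply: prime_cycle_rotated; rewrite ?groupX ?po ?xp //.
by apply/subsetP => y; rewrite inE; apply: contraR => /afix ->.
Qed.

(** * Transitivity and primitivity from the absence of common fixed sets *)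

Section FixedSets.
Variables (L p : nat) (I : finType) (s r : {perm T}) (t : I -> {perm T}).
Hypotheses (sG : s \in G) (s_long : long_cycles L s).
Hypotheses (tG : forall i, t i \in G) (t_fix : forall i, has_fixed_point (t i)).
Hypothesis t_sets : forall l, (L <= l)%N -> (l.*2 <= n)%N ->
  exists i, ~~ has_fixed_set l (t i).

(** An invariant set contains an orbit of [s], so it has more than [L] points, and some [t i] has no
    fixed set of its size. *)
Lemma no_small_invariant A : (forall g, g \in G -> g @: A = A) ->
  A != set0 -> ((#|A|).*2 <= n)%N -> False.
Proof.
move=> GA /set0Pn[x xA] An; have LA : (L <= #|A|)%N.
  apply: ltnW; apply: leq_trans (forallP s_long x) _.
  by apply/subset_leq_card/porbit_closed; first exact: GA.
have [i /negP] := t_sets LA An; apply; apply/existsP; exists A.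
by rewrite eqxx GA ?eqxx.
Qed.

Lemma invariant_setT A : (forall g, g \in G -> g @: A = A) -> A != set0 -> A = setT.
Proof.
move=> GA A0; apply/eqP; apply: contraT => AT; exfalso.
have GC g : g \in G -> g @: (~: A) = ~: A.
  move=> gG; apply/setP => x; rewrite -(permKV g x) mem_imsetT !inE.
  by congr (~~ _); rewrite -[in RHS](GA g gG) mem_imsetT.
have [An|An] := leqP (#|A|).*2 n; first exact: no_small_invariant GA A0 An.
apply: no_small_invariant GC _ _; last by have := cardsC A; lia.
by apply: contraNneq AT => E; rewrite -[A]setCK E setC0.
Qed.

(** If [A] were a block, its translates would cover everything. The one through a point of [D]
    contains [D], so $|A|\ge L$; another is disjoint from [A], so $2|A|\le n$. Each [t i] preserves
    the translate through one of its fixed points, against [t_sets] for $l=|A|$. *)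
Lemma no_blocks_fixed_sets D : (L <= #|D|)%N -> (1 < #|D|)%N -> rotated G D -> no_blocks G.
Proof.
move=> LD D1 rD A /andP[A1 An].
have [/existsP[g /and3P[gG gA gd]]|] := boolP [exists g,
    [&& g \in G, g @: A != A & ~~ [disjoint g @: A & A]]].
  by exists g; rewrite ?gA.
rewrite negb_exists => /forallP nE; exfalso.
have block g h x : g \in G -> h \in G -> x \in g @: A -> x \in h @: (g @: A) ->
    h @: (g @: A) = g @: A.
  move=> gG hG x1 x2; have := nE (g * h * g^-1); rewrite !groupM ?groupV //= negb_and !negbK.
  rewrite !imsetTM => /orP[/eqP E|].
    by have := imsetTK (h @: (g @: A)) g^-1; rewrite invgK E => <-.
  rewrite -setI_eq0 => /eqP/setP/(_ (g^-1 x)); rewrite !inE mem_imsetT x2 /=.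
  by rewrite -(mem_imsetT A g) permKV x1.
have [x0 x0A] : exists x0, x0 \in A by apply/card_gt0P; apply: ltnW.
have cover x : exists2 g, g \in G & x \in g @: A.
  pose U := \bigcup_(g in G) g @: A.
  suff UT : U = setT by have : x \in U by [rewrite UT inE]; case/bigcupP => g; exists g.
  apply: invariant_setT.
    move=> h hG; apply/setP => y; rewrite -(permKV h y) mem_imsetT.
    apply/bigcupP/bigcupP => -[g gG yg].
      by exists (g * h); rewrite ?groupM // imsetTM mem_imsetT.
    by exists (g * h^-1); rewrite ?groupM ?groupV // imsetTM mem_imsetT; rewrite permKV in yg.
  by apply/set0Pn; exists x0; apply/bigcupP; exists 1; rewrite ?group1 //; apply/imsetP; exists x0; rewrite ?perm1.
have [x xD] : exists x, x \in D by apply/card_gt0P; apply: ltnW.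
have [g gG xg] := cover x.
have sD : D \subset g @: A.
  (* In both cases a rotation of [D] keeps a point of the translate inside it, and so preserves the
     translate: it moves [y] to [z] within it, or fixes a point [w] outside [D]. *)
  have [sA|/subsetPn[w wA wD]] := boolP (g @: A \subset D).
    have /card_gt1P[y [z [yA zA yz]]] : (1 < #|g @: A|)%N by rewrite card_imsetT.
    have [b bG [cb by_z]] := rotatedP _ _ rD y z (subsetP sA y yA) (subsetP sA z zA) yz.
    apply: (cyclic_on_closed cb (subsetP sA y yA) yA).
    by apply: (block _ _ z) => //; rewrite -by_z mem_imsetT.
  have /card_gt1P[y [z [yD zD yz]]] := D1.
  have [b bG [cb by_z]] := rotatedP _ _ rD y z yD zD yz.
  apply: (cyclic_on_closed cb xD xg); apply: (block _ _ w) => //.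
  by apply/imsetP; exists w; rewrite // (out_perm _ wD) //; case/andP: cb.
have AL : (L <= #|A|)%N.
  by apply: leq_trans LD _; rewrite -(card_imsetT A g) subset_leq_card.
have A2 : ((#|A|).*2 <= n)%N.
  have /subsetPn[y _ yA] : ~~ (setT \subset A).
    by apply: contraTN An => /subset_leq_card; rewrite cardsT -leqNgt.
  have [h hG yh] := cover y.
  have := nE h; rewrite hG /= negb_and !negbK => /orP[/eqP E|].
    by case/negP: yA; rewrite -E.
  rewrite -leq_card_setU => /eqP E.
  by rewrite -addnn -{1}(card_imsetT A h) -E max_card.
have [i /negP] := t_sets AL A2; apply.
have /existsP[y /eqP ty] := t_fix i; have [h hG yh] := cover y.
apply/existsP; exists (h @: A); rewrite card_imsetT eqxx /=; apply/eqP.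
by apply: (block _ _ y) => //; apply/imsetP; exists y.
Qed.

Hypotheses (rG : r \in G) (pp : prime p) (r_lone : lone_cycle p r).
Hypotheses (Lp : (L <= p)%N) (p3 : (3 <= p)%N) (pn : (p.*2 <= n)%N).

Lemma Alt_sub_fixed_sets : 'Alt_T \subset G.
Proof.
have [D Dp rD] := lone_cycle_rotated pp rG r_lone.
apply: (Alt_sub_rotated p3 pn _ Dp rD).
by apply: (no_blocks_fixed_sets _ _ rD); rewrite Dp // ltnW.
Qed.

End FixedSets.

End AlternatingCriterion.

(** * Tuples that generate invariably *)

Section InvariableGeneration.
Local Open Scope group_scope.
Variables (gT : finGroupType) (G : {group gT}).

Definition inv_generates (K : nat) (f : {ffun 'I_K -> gT}) :=
  [forall g : {ffun 'I_K -> gT}, [forall i, g i \in f i ^: G] ==>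
     (<<[set x in codom g]>> == G)].

Lemma card_family_prod (I : finType) (F : I -> {set gT}) :
  #|family F| = (\prod_i #|F i|)%N.
Proof. by rewrite card_family foldrE big_map big_enum. Qed.

(** The conjugates of [H], at most $|G:H|$ in number, contain at most $|G:H|(|H|-1)=|G|-|G:H|$
    nontrivial elements, fewer than $|G|-1$ when [H] is proper. *)
Lemma class_support_proper (H : {group gT}) : H \subset G ->
  G \subset class_support H G -> H = G :> {set gT}.
Proof.
move=> sHG cov; apply/eqP; rewrite eqEsubset sHG /=; apply: contraT => nGH.
have cG : (#|G^#| <= #|G : H| * #|H^#|)%N.
  have sub : G^# \subset \bigcup_(A in rcosets H G) (H^# :^ repr A).
    apply/subsetP => x /setD1P[x1 /(subsetP cov)].
    rewrite class_supportEr => /bigcupP[y yG xy].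
    apply/bigcupP; exists (H :* y); first by apply/rcosetsP; exists y.
    by case: repr_rcosetP => h hH; rewrite conjD1g inE in_set1 x1 /= conjsgM conjGid.
  apply: leq_trans (subset_leq_card sub) _.
  rewrite -sum_nat_const; elim/big_rec2: _ => [|A m U _ IH]; first by rewrite cards0.
  apply: leq_trans (leq_card_setU _ _) _.
  by rewrite cardJg leq_add.
have := cardsD1 1 G; have := cardsD1 1 H; rewrite !group1 !add1n.
have := Lagrange sHG; have i1 : (1 < #|G : H|)%N by rewrite indexg_gt1.
move=> la Hd Gd; move: la; rewrite Hd Gd mulSn mulnC => la.
by move: cG; rewrite -ltnS -la -addn1 addnC leq_add2l leqNgt i1.
Qed.

(** A tuple listing all elements of [G], padded with 1, meets every class, and so do its conjugates;
    [class_support_proper] applies to the subgroup that they generate. *)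
Lemma exists_inv_generates K : (#|G| <= K)%N ->
  exists2 f : {ffun 'I_K -> gT}, f \in ffun_on G & inv_generates f.
Proof.
move=> GK; pose f : {ffun 'I_K -> gT} := [ffun i : 'I_K => nth 1 (enum G) i].
have fG : f \in ffun_on G.
  apply/ffun_onP => i; rewrite ffunE.
  have [iG|iG] := ltnP i (size (enum G)); first by rewrite -mem_enum mem_nth.
  by rewrite nth_default.
exists f => //; apply/forallP => g; apply/implyP => /forallP gf.
have gG i : g i \in G.
  have /imsetP[y yG ->] := gf i; rewrite groupJ //; exact: (ffun_onP fG).
apply/eqP/class_support_proper.
  by rewrite gen_subG; apply/subsetP => x; rewrite inE => /codomP[i ->].
apply/subsetP => x xG.
have xi : (index x (enum G) < K)%N.
  by apply: leq_trans GK; rewrite cardE index_mem mem_enum.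
have := gf (Ordinal xi); rewrite ffunE /= nth_index ?mem_enum // => /imsetP[y yG gE].
rewrite class_supportEr; apply/bigcupP; exists y^-1; first by rewrite groupV.
rewrite mem_conjgV -gE; apply: mem_gen; rewrite inE; exact: codom_f.
Qed.

End InvariableGeneration.

(** * Roles of the 3 + k permutations of a block *)

Section LargeDegree.
Local Open Scope group_scope.
Variable T : finType.
Implicit Types (s g : {perm T}).

Lemma long_cyclesJ L s g : long_cycles L s -> long_cycles L (s ^ g).
Proof.
move=> /forallP H; apply/forallP => x.
by rewrite -(permKV g x) porbitJ card_imsetT.
Qed.

Lemma has_fixed_pointJ s g : has_fixed_point s -> has_fixed_point (s ^ g).
Proof.
by case/existsP => x /eqP sx; apply/existsP; exists (g x); rewrite permJ sx.
Qed.

Lemma has_fixed_setJ l s g : has_fixed_set l s -> has_fixed_set l (s ^ g).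
Proof.
case/existsP => U /andP[Ul /eqP sU]; apply/existsP; exists (g @: U).
by rewrite card_imsetT Ul -imsetTM -conjgC imsetTM sU eqxx.
Qed.

Lemma lone_cycleJ p s g : lone_cycle p s -> lone_cycle p (s ^ g).
Proof.
case/existsP => x /andP[xp /forallP H]; apply/existsP; exists (g x).
rewrite porbitJ card_imsetT xp; apply/forallP => y; rewrite -(permKV g y).
by rewrite porbitJ card_imsetT mem_imsetT.
Qed.

Variable G : {group {perm T}}.
Hypothesis AltG : 'Alt_T \subset G.
Variables (L A B k : nat).
Hypotheses (L3 : (3 <= L)%N) (LA : (L <= A)%N) (Bn : (B <= #|T|./2)%N).

(** For $n\ge2$ both cases have $n!/2$ elements, so the alternating and the symmetric group are
    treated together. *)
Definition parity_set : {set {perm T}} :=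
  if G \subset 'Alt_T then 'Alt_T else [set s in G | odd_perm s].

Definition role (i : 'I_(3 + k)) : {set {perm T}} :=
  match split i with
  | inl j => if j == 0 :> nat then [set s : {perm T} | ~~ odd_perm s & long_cycles L s]
             else if j == 1%N :> nat
             then [set s : {perm T} | ~~ odd_perm s & lone_prime_cycle A B s]
             else parity_set
  | inr _ => [set s : {perm T} | ~~ odd_perm s & has_fixed_point s]
  end.

(** The exceptional event for size [l] keeps the first three roles and records only a fixed [l]-set
    for the others, so that its cardinal shares three factors with that of [role]. *)
Definition role_fixing l (i : 'I_(3 + k)) : {set {perm T}} :=
  if split i is inr _ then [set s : {perm T} | has_fixed_set l s] else role i.

Lemma parity_set_sub : parity_set \subset G.
Proof.
by rewrite /parity_set; case: ifP => // _; apply/subsetP => s; rewrite inE => /andP[].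
Qed.

Lemma role_sub i : role i \subset G.
Proof.
have ev (P : pred {perm T}) : [set s : {perm T} | ~~ odd_perm s & P s] \subset G.
  by apply: subset_trans AltG; apply/subsetP => s; rewrite inE Alt_even => /andP[].
rewrite /role; case: (split i) => j //; do 2! [case: ifP => // _].
exact: parity_set_sub.
Qed.

Lemma inv_generates_roles (f : {ffun 'I_(3 + k) -> {perm T}}) : f \in family role ->
  (forall l, (L <= l)%N -> (l.*2 <= #|T|)%N -> f \notin family (role_fixing l)) ->
  inv_generates G f.
Proof.
move=> /familyP fr nf; apply/forallP => g; apply/implyP => /forallP gf.
pose H := <<[set x in codom g]>>%G.
have gH i : g i \in H by apply: mem_gen; rewrite inE codom_f.
have gG i : g i \in G.
  have /imsetP[y yG ->] := gf i; rewrite groupJ //; exact: (subsetP (role_sub i)).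
have sHG : H \subset G.
  by rewrite gen_subG; apply/subsetP => x; rewrite inE => /codomP[i ->].
pose i0 : 'I_(3 + k) := lshift k (@Ordinal 3 0 isT).
pose i1 : 'I_(3 + k) := lshift k (@Ordinal 3 1 isT).
pose i2 : 'I_(3 + k) := lshift k (@Ordinal 3 2 isT).
have sp (j : 'I_3) : split (lshift k j) = inl j by apply: (unsplitK (inl j)).
have spr (j : 'I_k) : split (rshift 3 j) = inr j by apply: (unsplitK (inr j)).
have AH : 'Alt_T \subset H.
  have := fr i0; rewrite /role sp /= inE => /andP[_ lc].
  have := fr i1; rewrite /role sp /= inE => /andP[_ /existsP[p /and3P[pp Ap lp]]].
  have /imsetP[y0 _ E0] := gf i0; have /imsetP[y1 _ E1] := gf i1.
  apply: (@Alt_sub_fixed_sets _ H L p _ (g i0) (g i1) (fun j : 'I_k => g (rshift 3 j))) => //.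
  - by rewrite E0 long_cyclesJ.
  - move=> j; have := fr (rshift 3 j); rewrite /role spr inE => /andP[_ fp].
    by have /imsetP[y _ ->] := gf (rshift 3 j); apply: has_fixed_pointJ.
  - move=> l Ll ln; have [/existsP[j nj]|] := boolP [exists j : 'I_k, ~~ has_fixed_set l (g (rshift 3 j))].
      by exists j.
    rewrite negb_exists => /forallP all_l; case/negP: (nf l Ll ln); apply/familyP => i.
    rewrite /role_fixing; case: splitP => j ij; first by apply: fr.
    rewrite inE; have := all_l j; rewrite negbK.
    have -> : rshift 3 j = i by apply: val_inj.
    by have /imsetP[y _ E] := gf i => /(has_fixed_setJ y^-1); rewrite E conjgK.
  - by rewrite E1 lone_cycleJ.
  - by apply: ltnW; apply: leq_ltn_trans LA Ap.
  - by apply: leq_trans L3 _; apply: ltnW; apply: leq_ltn_trans LA Ap.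
  - by have := ltn_ord p; lia.
rewrite eqEsubset sHG /=; have := fr i2; rewrite /role sp /= /parity_set.
case: ifP => [GA _|_]; first exact: subset_trans GA AH.
rewrite inE => /andP[_ odd2]; apply/subsetP => s sG.
have o2 : odd_perm (g i2) by have /imsetP[y _ ->] := gf i2; rewrite odd_permJ.
have [os|es] := boolP (odd_perm s); last by apply: (subsetP AH); rewrite Alt_even.
rewrite -(mulgKV (g i2) s) groupM //; apply: (subsetP AH).
by rewrite Alt_even odd_permM odd_permV os o2.
Qed.

Lemma card_parity_set : (1 < #|T|)%N -> (2 * #|parity_set| = #|T|`!)%N.
Proof.
move=> n1; have cA := card_Alt n1; rewrite /parity_set; case: ifP => // GA.
have GT : G = [set: {perm T}] :> {set {perm T}}.
  have /subsetPn[s0 s0G s0A] := negbT GA; rewrite Alt_even negbK in s0A.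
  apply/eqP; rewrite eqEsubset subsetT; apply/subsetP => s _.
  have [os|es] := boolP (odd_perm s); last by apply: (subsetP AltG); rewrite Alt_even.
  rewrite -(mulgKV s0 s) groupM //; apply: (subsetP AltG).
  by rewrite Alt_even odd_permM odd_permV os s0A.
have -> : [set s in G | odd_perm s] = ~: 'Alt_T.
  by apply/setP => s; rewrite GT in_setC Alt_even negbK !inE.
have cS : #|{perm T}| = #|T|`! by have : #|[set: {perm T}]| = #|T|`! := card_Sym T; rewrite cardsT.
by have := cardsC 'Alt_T; rewrite cS -cA mul2n -addnn => /addnI ->; rewrite addnn mul2n.
Qed.

Definition even_with (P : pred {perm T}) := [set s : {perm T} | ~~ odd_perm s & P s].

Lemma card_roles : #|family role| =
  (#|even_with (long_cycles L)| * #|even_with (lone_prime_cycle A B)| * #|parity_set| *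
   #|even_with (@has_fixed_point T)| ^ k)%N.
Proof.
have sp (j : 'I_3) : split (lshift k j) = inl j by apply: (unsplitK (inl j)).
have spr (j : 'I_k) : split (rshift 3 j) = inr j by apply: (unsplitK (inr j)).
rewrite card_family_prod big_split_ord /= !big_ord_recl big_ord0 /role !sp /= muln1 mulnA.
congr (_ * _)%N; rewrite (eq_bigr (fun=> #|even_with (@has_fixed_point T)|)).
  by rewrite prod_nat_const card_ord.
by move=> i _; rewrite spr.
Qed.

Lemma card_roles_fixing l : #|family (role_fixing l)| =
  (#|even_with (long_cycles L)| * #|even_with (lone_prime_cycle A B)| * #|parity_set| *
   #|[set s : {perm T} | has_fixed_set l s]| ^ k)%N.
Proof.
have sp (j : 'I_3) : split (lshift k j) = inl j by apply: (unsplitK (inl j)).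
have spr (j : 'I_k) : split (rshift 3 j) = inr j by apply: (unsplitK (inr j)).
rewrite card_family_prod big_split_ord /= !big_ord_recl big_ord0 /role_fixing /role !sp /= muln1 mulnA.
congr (_ * _)%N; rewrite (eq_bigr (fun=> #|[set s : {perm T} | has_fixed_set l s]|)).
  by rewrite prod_nat_const card_ord.
by move=> i _; rewrite spr.
Qed.

Lemma card_inv_generates_lb :
  (#|family role| <= #|[set f in ffun_on G | @inv_generates _ G (3 + k) f]| +
    \sum_(L <= l < #|T|./2.+1) #|family (role_fixing l)|)%N.
Proof.
pose U := \bigcup_(l < #|T|./2.+1 | (L <= l)%N) [set f in family (role_fixing l)].
have sub : [set f in family role] \subset
    [set f in ffun_on G | @inv_generates _ G (3 + k) f] :|: U.
  apply/subsetP => f; rewrite inE => fr; rewrite in_setU.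
  have [//|fU] := boolP (f \in U); first by rewrite orbT.
  rewrite orbF inE; apply/andP; split.
    by apply/ffun_onP => i; apply: (subsetP (role_sub i)); move/familyP: fr.
  apply: inv_generates_roles => // l Ll ln; apply: contra fU => fl.
  have lT : (l < #|T|./2.+1)%N by rewrite ltnS; lia.
  by apply/bigcupP; exists (Ordinal lT); rewrite ?inE.
have := subset_leq_card sub; rewrite cardsE => /leq_trans; apply.
apply: leq_trans (leq_card_setU _ _) _; rewrite leq_add2l.
rewrite /U [X in (_ <= X)%N](big_nat_widenl _ 0) // big_mkord.
elim/big_rec2: _ => [|l m V _ IH]; first by rewrite cards0.
by apply: leq_trans (leq_card_setU _ _) _; rewrite cardsE leq_add.
Qed.

End LargeDegree.

(** * A positive proportion of good tuples *)

Section LargeDegreeBounds.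
Variable R : archiRealFieldType.

Lemma sum_inv_sqr_le L M : (0 < L)%N ->
  \sum_(L <= l < M) (l.+1%:R ^+ 2)^-1 <= L%:R^-1 :> R.
Proof.
move=> L0; have [ML|LM] := leqP M L; first by rewrite big_geq // invr_ge0 ler0n.
suff : \sum_(L <= l < M) (l.+1%:R ^+ 2)^-1 <= L%:R^-1 - M%:R^-1 :> R.
  by move/le_trans; apply; rewrite gerBl invr_ge0 ler0n.
elim: M LM => // M IHM; rewrite ltnS leq_eqVlt => /predU1P[LM|LM].
  rewrite -LM big_nat1.
  have l0 : 0 < L%:R :> R by rewrite ltr0n.
  have -> : L%:R^-1 - L.+1%:R^-1 = (L%:R * L.+1%:R)^-1 :> R.
    by rewrite -natr1; field; rewrite !gt_eqF //; lra.
  rewrite lef_pV2 ?posrE ?mulr_gt0 ?exprn_gt0 ?ltr0n // expr2 ler_wpM2r ?ler0n //.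
  by rewrite ler_nat.
rewrite big_nat_recr /=; last exact: ltnW.
apply: le_trans (lerD (IHM LM) (lexx _)) _.
have Mn : (0 < M)%N by apply: leq_ltn_trans LM.
have M0 : 0 < M%:R :> R by rewrite ltr0n.
have : (M.+1%:R ^+ 2)^-1 <= M%:R^-1 - M.+1%:R^-1 :> R.
  have -> : M%:R^-1 - M.+1%:R^-1 = (M%:R * M.+1%:R)^-1 :> R.
    by rewrite -natr1; field; rewrite !gt_eqF //; lra.
  rewrite lef_pV2 ?posrE ?mulr_gt0 ?exprn_gt0 ?ltr0n // expr2 ler_wpM2r ?ler0n //.
  by rewrite ler_nat.
by move: (M.+1%:R ^- 2) (M.+1%:R^-1) (M%:R^-1) (L%:R^-1) => u v w z; lra.
Qed.

(** [fixed_set_ub] bounds a square, so 24 copies give a 12th power. The exponent is chosen for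
    $(8/9)^{12}\le1/4$: as $2^{t+1}>l+1$, the bound becomes of order $l^{-2}$. *)
Lemma fixed_set_ub24 : exists2 C : R, 0 < C &
  forall (T : finType) l, (l.*2 <= #|T|)%N ->
  #|[set s : {perm T} | has_fixed_set l s]|%:R ^+ 24 <=
    C * (#|T|`!)%:R ^+ 24 * (l.+1%:R ^+ 2)^-1.
Proof.
exists (36 ^+ 12 * 4); first by rewrite mulr_gt0 ?exprn_gt0.
move=> T l ln; rewrite mulrAC -ler_pdivrMr ?exprn_gt0 ?ltr0n ?fact_gt0 // -expr_div_n.
set t := trunc_log 2 l.+1.
have H := fixed_set_ub R ln; rewrite -/t in H.
rewrite (exprM _ 2 12).
have p2 : 0 <= (#|[set s : {perm T} | has_fixed_set l s]|%:R / (#|T|`!)%:R) ^+ 2 :> R by apply: sqr_ge0.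
have : (36 * (8/9) ^+ t) ^+ 12 <= 36 ^+ 12 * 4 * (l.+1%:R ^+ 2)^-1 :> R.
  rewrite exprMn -mulrA ler_wpM2l ?exprn_ge0 // -exprM mulnC exprM.
  have e : (8/9) ^+ 12 <= 1/4 :> R.
    have e1 : (8/9) ^+ 3 <= 703/1000 :> R by rewrite !exprS expr0; lra.
    have e0 : 0 <= (8/9) ^+ 3 :> R by rewrite exprn_ge0 //; lra.
    rewrite (exprM _ 3 4); apply: le_trans (lerXn2r 4 _ _ e1) _; rewrite ?nnegrE //; first lra.
    rewrite !exprS expr0; lra.
  have e0 : 0 <= (8/9) ^+ 12 :> R by rewrite exprn_ge0 //; lra.
  apply: (@le_trans _ _ ((1/4) ^+ t)); first by apply: lerXn2r; rewrite ?nnegrE //; lra.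
  rewrite expr_div_n expr1n ler_pdivlMr ?exprn_gt0 ?ltr0n // mulrC.
  rewrite mulrA mulr1 ler_pdivrMr ?exprn_gt0 //.
  have /andP[_ t2] := trunc_log_bounds (isT : (1 < 2)%N) (ltn0Sn l); rewrite -/t in t2.
  have -> : 4 * 4 ^+ t = (2 ^+ t.+1) ^+ 2 :> R.
    by rewrite -exprM mulnC exprM -exprS; congr (_ ^+ _); rewrite expr2; lra.
  apply: lerXn2r; rewrite ?nnegrE ?exprn_ge0 ?ler0n //.
  by rewrite -natrX ler_nat ltnW.
by apply: le_trans; apply: lerXn2r => //; rewrite nnegrE (le_trans p2).
Qed.

(** The order of the choices matters: [e] is the proportion guaranteed for 24 even permutations with
    fixed points, [L] makes the union bound at most $e/2$, and only then is the degree bounded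
    below. In the witness, [c] stands for the long cycles, 3/64 for the lone prime cycle and 1/2 for
    the parity. *)
Lemma large_degree_inv_generates : exists2 d : R, 0 < d &
  exists N0, forall T : finType, (N0 <= #|T|)%N ->
  forall G : {group {perm T}}, ('Alt_T \subset G)%g ->
    d * #|G|%:R ^+ 27 <= #|[set f in ffun_on G | @inv_generates _ G 27 f]|%:R.
Proof.
have [e [e0 eE]] : exists e : R, 0 < e /\ e = (1/8) ^+ 24.
  by exists ((1/8) ^+ 24); split => //; rewrite exprn_gt0 //; lra.
have [C C0 fix_ub] := fixed_set_ub24.
have [L L3 CL] : exists2 L, (3 <= L)%N & C * L%:R^-1 <= e / 2.
  exists (Num.bound (2 * C / e) + 3)%N; first by rewrite leq_addl.
  set b := Num.bound _; have b1 : 2 * C / e < b%:R.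
    by apply: archi_boundP; rewrite divr_ge0 ?mulr_ge0 // ltW.
  rewrite ler_pdivrMr; last by rewrite ltr0n addn3.
  rewrite ltr_pdivrMr // in b1; rewrite natrD; nra.
pose c : R := ((L.+1 * (3 * L).+2)%N)%:R^-1.
have c0 : 0 < c by rewrite invr_gt0 ltr0n.
have [N1 HN1] := prime_window R L.
exists (c * (3/64) * 2^-1 * (e / 2)); first by rewrite !mulr_gt0 ?invr_gt0 //; lra.
exists (N1 + (L.+1.*2 + 4))%N => T TN G AG.
have [|A [B [LA HA Bn HAB]]] := HN1 #|T|; first by lia.
have n4 : (4 <= #|T|)%N by lia.
have nL : (L.+1.*2 <= #|T|)%N by lia.
have half2 l : (l < #|T|./2.+1)%N -> (l.*2 <= #|T|)%N by clear; lia.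
have := @card_inv_generates_lb T G AG L A B 24 L3 LA Bn.
rewrite card_roles -(ler_nat R) natrD natr_sum.
set good := #|[set f in _ | _]|%:R.
under eq_bigr do rewrite card_roles_fixing natrM.
rewrite -mulr_sumr natrM natrX.
set a := (_ * _ * _)%N%:R; set b := #|even_with _|%:R.
under eq_bigr do rewrite natrX.
set N := (#|T|`!)%:R : R; have N0 : 0 < N by rewrite ltr0n fact_gt0.
set S := \sum_(_ <= _ < _) _ => H.
have b1 : N / 8 <= b by apply: even_fixed_point_lb (ltnW n4).
have b2 : e * N ^+ 24 <= b ^+ 24.
  rewrite eE -exprMn; apply: lerXn2r; rewrite ?nnegrE ?ler0n //; lra.
have S1 : S <= e / 2 * N ^+ 24.
  apply: (@le_trans _ _ (\sum_(L <= l < #|T|./2.+1) (C * N ^+ 24) * (l.+1%:R ^+ 2)^-1)).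
    apply: ler_sum_nat => l /andP[_ l2].
    exact: fix_ub (half2 l l2).
  rewrite -mulr_sumr mulrAC; apply: (@le_trans _ _ (C * L%:R^-1 * N ^+ 24)).
    apply: ler_wpM2r; first exact: exprn_ge0 (ltW N0).
    apply: ler_wpM2l; first exact: ltW.
    by apply: sum_inv_sqr_le; apply: leq_trans L3.
  by apply: ler_wpM2r CL; exact: exprn_ge0 (ltW N0).
have a1 : c * (3/64) * 2^-1 * N ^+ 3 <= a.
  rewrite /a !natrM.
  have q1 : c * N <= #|even_with (@long_cycles T L)|%:R.
    rewrite /even_with even_long_cyclesE mulrC; apply: ler_wpM2l; first exact: ltW.
    exact: parity_avg_lb.
  have q2 : (3/64) * N <= #|even_with (@lone_prime_cycle T A B)|%:R.
    by rewrite mulrC; apply: even_lone_prime_cycle_lb.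
  have q3 : 2^-1 * N <= #|parity_set G|%:R.
    have := card_parity_set AG; move=> P; rewrite /N -P; last exact: ltnW (ltnW n4).
    by rewrite natrM mulKf ?pnatr_eq0.
  rewrite [leLHS](_ : _ = (c * N) * ((3/64) * N) * (2^-1 * N)); last by ring.
  have n0 := ltW N0; have c0' := ltW c0.
  have w1 : 0 <= c * N by apply: mulr_ge0.
  have w2 : 0 <= 3/64 * N by apply: mulr_ge0 => //; lra.
  have w3 : 0 <= 2^-1 * N by apply: mulr_ge0 => //; lra.
  exact: ler_pM (mulr_ge0 w1 w2) w3 (ler_pM w1 w2 q1 q2) q3.
have a0 : 0 <= a by rewrite ler0n.
have gE : a * (b ^+ 24 - S) <= good by rewrite mulrBr; lra.
apply: le_trans gE; have eN : e / 2 * N ^+ 24 <= b ^+ 24 - S by lra.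
have GN : #|G|%:R ^+ 27 <= N ^+ 27.
  apply: lerXn2r; rewrite ?nnegrE ?ler0n // ler_nat -card_Sym.
  by apply: subset_leq_card; apply: subsetT.
apply: le_trans (ler_wpM2l _ GN) _; first by apply: ltW; rewrite !mulr_gt0 ?invr_gt0 //; lra.
rewrite [leLHS](_ : _ = (c * (3/64) * 2^-1 * N ^+ 3) * (e / 2 * N ^+ 24)); last first.
  by rewrite (exprD _ 3 24); ring.
apply: ler_pM a1 eN; apply: ltW; rewrite !mulr_gt0 ?invr_gt0 ?exprn_gt0 //; lra.
Qed.

(** [K] is at least the order of every group of degree at most [N0], so there is one good tuple
    among at most $K^K$. *)
Lemma small_degree_inv_generates N0 : exists2 K, (0 < K)%N & exists2 d : R, 0 < d &
  forall T : finType, (#|T| <= N0)%N -> forall G : {group {perm T}},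
    d * #|G|%:R ^+ K <= #|[set f in ffun_on G | @inv_generates _ G K f]|%:R.
Proof.
have [K KE] : exists K, K = N0`! by exists N0`!.
have K0 : (0 < K)%N by rewrite KE fact_gt0.
exists K => //; exists (K%:R ^+ K)^-1; first by rewrite invr_gt0 exprn_gt0 ?ltr0n.
move=> T TN G; have GK : (#|G| <= K)%N.
  rewrite KE; apply: leq_trans (leq_fact TN).
  by rewrite -card_Sym; apply: subset_leq_card; apply: subsetT.
have [f fG fI] := exists_inv_generates GK.
apply: (@le_trans _ _ 1).
  rewrite ler_pdivrMl ?exprn_gt0 ?ltr0n // mulr1; apply: lerXn2r; rewrite ?nnegrE ?ler0n //.
  by rewrite ler_nat.
by rewrite ler1n card_gt0; apply/set0Pn; exists f; rewrite inE fG.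
Qed.

End LargeDegreeBounds.

Require Import Defs.
From mathcomp Require Import all_classical all_reals all_analysis measurable_realfun.

Import Order.TTheory GRing.Theory Num.Theory.

Local Open Scope classical_set_scope.
Local Open Scope ring_scope.

(** * Comparison of integrals *)

Section IntegralMonotone.
Local Open Scope ereal_scope.
Context d (T : measurableType d) (R : realType) (mu : {measure set T -> \bar R}).

(* Unlike ge0_le_integral, no measurability is required: the integral of a
   nonnegative function is a supremum over the simple functions below it. *)
Lemma ge0_le_integralT (f g : T -> \bar R) : (forall x, 0 <= f x) ->
  (forall x, f x <= g x) -> \int[mu]_x f x <= \int[mu]_x g x.
Proof.
move=> f0 fg; have g0 x : 0 <= g x by exact: le_trans (f0 x) (fg x).
rewrite !ge0_integralTE //; apply: le_ereal_sup => _ [h hf <-].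
by exists h => // x; exact: le_trans (hf x) (fg x).
Qed.

End IntegralMonotone.

(** * Blocks of independent samples and the waiting time *)

Section UniformSequence.
Context (R : realType) (gT : finGroupType) (G : {group gT}).
Variable S : uniform_sequence R G.
Local Notation P := (law S).
Local Notation X := (sample S).

Section Coordinates.
Variables (I : finType) (idx : I -> nat).
Hypothesis idx_inj : injective idx.

Let coords (w : space S) : {ffun I -> gT} := [ffun i => X (idx i) w].

Lemma measurable_coords f : measurable [set w | coords w = f].
Proof.
have -> : [set w | coords w = f] = \bigcap_(i in [set` enum I]) (X (idx i) @^-1` [set f i]).
  apply/seteqP; split => [w /= <- i _ /=|w H /=]; first by rewrite ffunE.
  by apply/ffunP => i; rewrite ffunE; apply: (H i); rewrite /= mem_enum.
apply: fin_bigcap_measurable; first exact: finite_seq.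
by move=> i _; apply: sample_measurable.
Qed.

Lemma law_coords f : f \in ffun_on G ->
  P [set w | coords w = f] = (((#|G|%:R : R)^-1) ^+ #|I|)%:E.
Proof.
move=> /ffun_onP fG.
(* The condition is extended to all indices: a singleton at [idx i], by injectivity, and the full
   set outside the range of [idx]. *)
pose A (n : nat) := [set x : gT | forall i, idx i = n -> x = f i].
have Ai i : A (idx i) = [set f i].
  by apply/seteqP; split => [x /= /(_ i erefl)//|x /= -> j /idx_inj ->].
have -> : [set w | coords w = f] =
    \bigcap_(n in [set` map idx (enum I)]) (X n @^-1` A n).
  apply/seteqP; split => [w /= E n /= /mapP[i _ ->]|w H /=].
    by move=> j /idx_inj ->; rewrite -E ffunE.
  apply/ffunP => i; rewrite ffunE.
  have := H (idx i); rewrite /= Ai; apply; apply: map_f; by rewrite mem_enum.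
rewrite sample_independent; last by rewrite map_inj_uniq ?enum_uniq.
rewrite big_map (eq_bigr (fun=> ((#|G|%:R : R)^-1)%:E)); last first.
  by move=> i _; rewrite Ai sample_uniform.
rewrite big_const_seq count_predT -cardE.
by elim: #|I| => //= n ->; rewrite exprS EFinM.
Qed.

Lemma law_coords_le (D : {set {ffun I -> gT}}) : (D \subset ffun_on G)%SET ->
  measurable [set w | coords w \in D] /\
  (P [set w | coords w \in D] <= (#|D|%:R * ((#|G|%:R : R)^-1) ^+ #|I|)%:E)%E.
Proof.
move=> DG; have {DG} : {subset enum D <= ffun_on G}.
  by move=> f; rewrite mem_enum; exact: (fintype.subsetP DG).
have -> : [set w | coords w \in D] = [set w | coords w \in enum D].
  by apply/seteqP; split => w /=; rewrite mem_enum.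
rewrite cardE; elim: (enum D) => [|f s IHs] H.
  have -> : [set w | coords w \in [::]] = set0 by apply/seteqP; split => w.
  by rewrite measure0 mul0r.
have [|ms Ps] := IHs; first by move=> g gs; apply: H; rewrite inE gs orbT.
have -> : [set w | coords w \in f :: s] = [set w | coords w = f] `|` [set w | coords w \in s].
  apply/seteqP; split => w /=; first by rewrite inE => /orP[/eqP|]; [left|right].
  by case=> [->|ws]; rewrite inE ?eqxx ?ws ?orbT.
have mf := measurable_coords f; split; first exact: measurableU.
apply: le_trans (measureU2 _ mf ms) _.
have fG : f \in ffun_on G by apply: H; rewrite inE eqxx.
rewrite /= -natr1 mulrDl mul1r addrC EFinD; apply: leeD => //.
by have := law_coords fG => /= ->.
Qed.

End Coordinates.

Section Blocks.
Variables (K : nat) (d : R).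
Hypotheses (K0 : (0 < K)%N) (d0 : 0 < d) (d1 : d <= 1).
Hypothesis many : d * #|G|%:R ^+ K <=
  #|[set f in ffun_on G | @inv_generates _ G K f]%SET|%:R.

Definition block (w : space S) (i : nat) : {ffun 'I_K -> gT} :=
  [ffun r : 'I_K => X (i * K + r)%N w].

Definition bad_blocks (j : nat) : set (space S) :=
  [set w | forall i, (i < j)%N -> ~~ inv_generates G (block w i)].

(** The $jK$ samples form one family indexed by pairs, so the independence of blocks becomes a
    count: at most $|bad|^j$ arrays have all their rows bad. *)
Lemma bad_blocks_law j : measurable (bad_blocks j) /\ (P (bad_blocks j) <= ((1 - d) ^+ j)%:E)%E.
Proof.
pose I : finType := ('I_j * 'I_K)%type.
pose idx (p : I) := (p.1 * K + p.2)%N.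
have idx_inj : injective idx.
  move=> [[i hi] [r hr]] [[i' hi'] [r' hr']]; rewrite /idx /= => E.
  have E1 : i = i' by have := congr1 (divn^~ K) E; rewrite !divnMDl // !divn_small // !addn0.
  have E2 : r = r' by have := congr1 (modn^~ K) E; rewrite !modnMDl !modn_small.
  by congr (_, _); apply: val_inj.
pose bad := [set f in ffun_on G | ~~ @inv_generates _ G K f]%SET.
pose D := [set F : {ffun I -> gT} | [forall i, [ffun r => F (i, r)] \in bad]]%SET.
have DG : (D \subset ffun_on G)%SET.
  apply/fintype.subsetP => F; rewrite inE => /forallP H; apply/ffun_onP => -[i r].
  have := H i; rewrite inE => /andP[/ffun_onP /(_ r)]; by rewrite ffunE.
have BE : bad_blocks j = [set w | [ffun p : I => X (idx p) w] \in D].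
  apply/seteqP; split => [w /= H|w /=].
    rewrite inE; apply/forallP => i; rewrite inE; apply/andP; split.
      by apply/ffun_onP => r; rewrite !ffunE; exact: sample_in.
    by have := H i (ltn_ord i); congr (~~ inv_generates _ _); apply/ffunP => r; rewrite !ffunE.
  rewrite inE => /forallP H i ij; have := H (Ordinal ij); rewrite inE => /andP[_].
  by congr (~~ inv_generates _ _); apply/ffunP => r; rewrite !ffunE.
have [mD PD] := law_coords_le idx_inj DG.
rewrite BE; split => //; apply: le_trans PD _; rewrite lee_fin.
have G0 : 0 < #|G|%:R :> R by rewrite ltr0n cardG_gt0.
rewrite card_prod !card_ord mulnC exprM exprVn.
have cD : (#|D| <= #|bad| ^ j)%N.
  have := card_ffun_on 'I_j bad; rewrite card_ord => <-.
  pose curry (F : {ffun I -> gT}) := [ffun i : 'I_j => [ffun r : 'I_K => F (i, r)]].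
  have ci : injective curry.
    move=> F F' E; apply/ffunP => -[i r].
    by have := congr1 (fun H : {ffun 'I_j -> {ffun 'I_K -> gT}} => H i r) E; rewrite !ffunE.
  rewrite -(card_imset _ ci) -[X in (_ <= X)%N]cardsE; apply: subset_leq_card.
  apply/fintype.subsetP => _ /imsetP[F FD ->]; rewrite inE; apply/ffun_onP => i.
  by rewrite ffunE; move: FD; rewrite inE => /forallP.
have cb : #|bad|%:R <= (1 - d) * #|G|%:R ^+ K.
  have E : (#|[set f in ffun_on G | @inv_generates _ G K f]%SET| + #|bad| = #|G| ^ K)%N.
    have := card_ffun_on 'I_K G; rewrite card_ord => <-.
    rewrite -(cardID (inv_generates G (K := K)) (ffun_on G)); congr (_ + _)%N.
      by apply: eq_card => f; rewrite !inE.
    by apply: eq_card => f; rewrite !inE andbC.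
  have := congr1 (fun x : nat => x%:R : R) E; rewrite /= natrD natrX => E2.
  by move: many; rewrite mulrBl mul1r -E2 addrC -addrA lerDl subr_ge0.
have u0 : 0 <= (#|G|%:R ^+ K)^-1 :> R by rewrite invr_ge0 exprn_ge0 // ltW.
apply: (@le_trans _ _ ((#|bad|%:R ^+ j) * ((#|G|%:R ^+ K)^-1) ^+ j)).
  by rewrite ler_wpM2r ?exprn_ge0 // -natrX ler_nat.
rewrite -exprMn; apply: lerXn2r; rewrite ?nnegrE ?mulr_ge0 ?ler0n ?subr_ge0 //.
by rewrite ler_pdivrMr ?exprn_gt0.
Qed.

Section Pointwise.
Variable w : space S.
Local Notation tau := (@waiting_time R gT G S w).

Lemma block_classes_generate i : inv_generates G (block w i) ->
  classes_generate G (fun k : 'I_(i.+1 * K) => (X k w ^: G)%g).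
Proof.
move=> /forallP H g gC; apply/eqP; rewrite finset.eqEsubset; apply/andP; split.
  rewrite gen_subG; apply/fintype.subsetP => x; rewrite inE => /codomP[k ->].
  have /imsetP[y yG ->] := gC k; rewrite groupJ //; exact: sample_in.
have lt (r : 'I_K) : (i * K + r < i.+1 * K)%N by rewrite mulSn addnC ltn_add2r.
pose h := [ffun r : 'I_K => g (Ordinal (lt r))].
have := H h; have -> : [forall r, h r \in (block w i r ^: G)%g].
  by apply/forallP => r; rewrite !ffunE; exact: gC.
move=> /= /eqP <-; apply: genS; apply/fintype.subsetP => x; rewrite !inE.
by case/codomP => r ->; rewrite ffunE codom_f.
Qed.

Lemma waiting_time_le n : (0 < n)%N ->
  classes_generate G (fun i : 'I_n => (X i w ^: G)%g) -> (tau <= n%:R%:E)%E.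
Proof. by move=> n0 cg; apply: ereal_inf_lbound; exists n. Qed.

Lemma waiting_time_ge1 : (1 <= tau)%E.
Proof.
apply: le_ereal_inf_tmp => _ [n [n0 _] <-]; by rewrite lee_fin ler1n.
Qed.

Lemma waiting_time_nat : tau = +oo%E \/ exists n : nat, tau = (n%:R)%:E.
Proof.
pose Q n := (0 < n)%N /\ classes_generate G (fun i : 'I_n => (X i w ^: G)%g).
have [[n Qn]|nQ] := pselect (exists n, Q n); last first.
  by left; rewrite /waiting_time (_ : [set _ | _ in _] = set0) ?ereal_inf0 //; apply/seteqP; split => // x [n Qn _]; apply: nQ; exists n.
right; have exq : exists n, `[< Q n >] by exists n; apply/asboolP.
case: (ex_minnP exq) => m /asboolP Qm mmin; exists m; apply/eqP; rewrite eq_le.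
rewrite waiting_time_le; [|exact: Qm.1|exact: Qm.2].
apply: le_ereal_inf_tmp => _ [k Qk <-]; rewrite lee_fin ler_nat.
by apply: mmin; apply/asboolP.
Qed.

Variables (D c : R).
Hypotheses (D0 : 0 < D) (c1 : 1 <= c).

Let term n (v : space S) : \bar R := (D * c ^+ (n.+1 * K))%:E * (\1_(bad_blocks n) v)%:E.

Let coef_ge0 n : 0 <= D * c ^+ (n.+1 * K).
Proof. by rewrite mulr_ge0 ?exprn_ge0 ?ltW // (lt_le_trans _ c1). Qed.

Let term_ge0 n v : (0 <= term n v)%E.
Proof. by rewrite /term -EFinM lee_fin mulr_ge0 // indicE ler0n. Qed.

(** If block [i] is the first good one, then $\tau\le(i+1)K$ and the [i]-th term alone suffices. If
    there is none, every term is at least [D] and the series diverges, which covers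
    $\tau=+\infty$. *)
Lemma exp_waiting_time_le :
  (D%:E * expe_base c tau <= \sum_(n <oo) term n w)%E.
Proof.
have D0' := ltW D0; have c0 : 0 <= c := le_trans ler01 c1.
have [[i gi]|ng] := pselect (exists i, inv_generates G (block w i)).
  have exq : exists n, inv_generates G (block w n) by exists i.
  case: (ex_minnP exq) => {i gi} i gi imin.
  have wi : bad_blocks i w.
    by move=> j ji; apply/negP => /imin; rewrite leqNgt ji.
  have tle : (tau <= (i.+1 * K)%N%:R%:E)%E.
    by apply: waiting_time_le; rewrite ?muln_gt0 // ; exact: block_classes_generate.
  have [tE|[m tE]] := waiting_time_nat; first by rewrite tE in tle.
  have -> : expe_base c tau = (c ^+ m)%:E by rewrite tE /= powR_mulrn.
  rewrite tE lee_fin ler_nat in tle.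
  apply: (@le_trans _ _ (term i w)).
    rewrite /term indicE mem_set // mule1 -EFinM lee_fin ler_wpM2l //.
    exact: ler_weXn2l.
  apply: le_trans (nneseries_lim_ge i.+1 (P := xpredT) (m := 0) _) => //.
  by rewrite big_nat_recr //= leeDr // sume_ge0.
have big N : ((D * N%:R)%:E <= \sum_(n <oo) term n w)%E.
  apply: le_trans (nneseries_lim_ge N (P := xpredT) (m := 0) _) => //.
  elim: N => [|N IHN]; first by rewrite big_geq // mulr0.
  rewrite big_nat_recr //= -natr1 mulrDr mulr1 EFinD; apply: leeD => //.
  rewrite /term indicE mem_set; last by move=> j _; apply/negP => gj; apply: ng; exists j.
  by rewrite mule1 lee_fin ler_peMr // exprn_ege1.
suff -> : (\sum_(n <oo) term n w = +oo)%E by rewrite leey.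
have s0 : (0 <= \sum_(n <oo) term n w)%E by apply: nneseries_ge0.
move: big s0; case: (\sum_(n <oo) term n w)%E => [r| |] // big r0.
exfalso; have := big (Num.bound (r / D)); rewrite lee_fin leNgt => /negP; apply.
rewrite mulrC -ltr_pdivrMr //; apply: archi_boundP.
by rewrite divr_ge0 // -lee_fin.
Qed.

End Pointwise.

(** [f] is compared pointwise with a series of measurable terms; integrated term by term, it is
    bounded by a geometric series of ratio $c^K(1-d)\le1-d/2$. *)
Lemma integral_exp_waiting_time (D c : R) (f : space S -> \bar R) :
  0 < D -> 1 <= c -> c ^+ K * (1 - d) <= 1 - d / 2 ->
  (forall w, 0 <= f w <= D%:E * expe_base c (@waiting_time R gT G S w))%E ->
  (\int[P]_w f w <= (D * c ^+ K / (d / 2))%:E)%E.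
Proof.
move=> D0 c1 cK fb; have c0 : 0 <= c := le_trans ler01 c1.
pose a n : R := D * c ^+ (n.+1 * K).
have a0 n : 0 <= a n by rewrite mulr_ge0 ?exprn_ge0 ?ltW // (lt_le_trans _ c1).
pose term n (v : space S) : \bar R := ((a n)%:E * (\1_(bad_blocks n) v)%:E)%E.
have t0 n v : (0 <= term n v)%E by rewrite /term -EFinM lee_fin mulr_ge0 // indicE ler0n.
have mB n : measurable (bad_blocks n) := (bad_blocks_law n).1.
have mt n : measurable_fun setT (term n).
  apply: measurable_funeM; apply/measurable_EFinP; exact: measurable_indic.
apply: le_trans (ge0_le_integralT _ (g := fun w => \sum_(n <oo) term n w)%E _ _) _.
- by move=> w; have /andP[] := fb w.
- move=> w; have /andP[_ H] := fb w; apply: le_trans H _.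
  exact: exp_waiting_time_le.
rewrite integral_nneseries //.
apply: lime_le; first by apply: is_cvg_nneseries => n _ _; apply: integral_ge0.
apply: nearW => N.
have I n : (\int[P]_w term n w <= (a n * (1 - d) ^+ n)%:E)%E.
  rewrite /term ge0_integralZl_EFin //;
    [|by apply/measurable_EFinP; exact: measurable_indic].
  have an : (0 <= (a n)%:E)%E by rewrite lee_fin.
  have := lee_wpmul2l an (bad_blocks_law n).2.
  by rewrite integral_indic // setIT EFinM.
apply: (@le_trans _ _ (\sum_(0 <= n < N) (a n * (1 - d) ^+ n)%:E)%E); first exact: lee_sum.
rewrite sumEFin lee_fin.
have d2 : 0 < d / 2 by rewrite divr_gt0.
rewrite ler_pdivlMr //.
pose r := c ^+ K * (1 - d).
have r0 : 0 <= r by rewrite mulr_ge0 ?exprn_ge0 // subr_ge0.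
suff H : (\sum_(0 <= n < N) a n * (1 - d) ^+ n) * (1 - r) <= D * c ^+ K * (1 - r ^+ N).
  have s0 : 0 <= \sum_(0 <= n < N) a n * (1 - d) ^+ n.
    by apply: sumr_ge0 => n _; rewrite mulr_ge0 ?exprn_ge0 // subr_ge0.
  have k0 : 0 <= D * c ^+ K by rewrite mulr_ge0 ?exprn_ge0 // ltW.
  have rN : 0 <= r ^+ N by rewrite exprn_ge0.
  rewrite -/r in cK.
  apply: (@le_trans _ _ (D * c ^+ K * (1 - r ^+ N))); last by rewrite ler_piMr // gerBl.
  by apply: le_trans H; rewrite ler_wpM2l //; lra.
elim: N => [|N IHN]; first by rewrite big_geq // mul0r expr0 subrr mulr0.
rewrite big_nat_recr //= mulrDl.
have -> : a N * (1 - d) ^+ N = D * c ^+ K * r ^+ N.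
  by rewrite /a /r mulSn exprD mulnC exprM exprMn; ring.
by rewrite exprS; move: IHN; set s := \sum_(_ <= _ < _) _; set k := D * _; set q := r ^+ N => IHN; lra.
Qed.

End Blocks.

End UniformSequence.

(** * Moments bounded uniformly in the degree *)

Section UniformBounds.
Variable R : realType.

Lemma expr1D_bernoulli (x : R) K : 0 <= x -> (1 + x) ^+ K * (1 - K%:R * x) <= 1.
Proof.
move=> x0; elim: K => [|K IHK]; first by rewrite expr0 mul0r subr0 mulr1.
apply: le_trans IHK; rewrite exprSr -mulrA ler_wpM2l ?exprn_ge0 ?addr_ge0 //.
rewrite -natr1; have K0 : 0 <= K%:R :> R by rewrite ler0n.
nra.
Qed.

Lemma expr1D_ge (x : R) m : 0 <= x -> m%:R * x <= (1 + x) ^+ m.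
Proof.
move=> x0; elim: m => [|m IHm]; first by rewrite mul0r.
have p1 : 1 <= (1 + x) ^+ m by apply: exprn_ege1; lra.
by rewrite exprSr -natr1; nra.
Qed.

(** The choice of [e] gives $Kx\le d/2$, hence $(1+x)^K(1-d/2)\le1$; multiply by $1-d/2$ and use
    $(1-d/2)^2\ge1-d$. *)
Lemma small_base (K : nat) (d : R) : 0 < d -> d <= 1 -> exists2 e : R, 0 < e &
  forall x, 0 <= x -> x <= e -> (1 + x) ^+ K * (1 - d) <= 1 - d / 2.
Proof.
move=> d0 d1; exists (d / (2 * K.+1%:R)); first by rewrite divr_gt0 ?mulr_gt0 ?ltr0n.
move=> x x0; rewrite ler_pdivlMr ?mulr_gt0 ?ltr0n // -[K.+1%:R]natr1 => xe.
have A0 : 0 <= (1 + x) ^+ K by rewrite exprn_ge0 // addr_ge0.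
have := expr1D_bernoulli K x0; set A := (1 + x) ^+ K in A0 *.
have K0 : 0 <= K%:R :> R by rewrite ler0n.
have Kx : K%:R * x <= d / 2 by nra.
move=> H; have H2 : A * (1 - d / 2) <= 1 by apply: le_trans H; rewrite ler_wpM2l //; lra.
have : A * (1 - d / 2) * (1 - d / 2) <= 1 * (1 - d / 2) by rewrite ler_wpM2r //; lra.
by have := mulr_ge0 A0 (sqr_ge0 d); rewrite expr2; lra.
Qed.

Lemma uniform_inv_generates : exists (K1 K2 : nat) (d1 d2 : R), [/\ (0 < K1)%N, (0 < K2)%N,
  0 < d1 <= 1, 0 < d2 <= 1 &
  forall (T : finType) (G : {group {perm T}}), ('Alt_T \subset G)%g ->
    d1 * #|G|%:R ^+ K1 <= #|[set f in ffun_on G | @inv_generates _ G K1 f]%SET|%:R \/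
    d2 * #|G|%:R ^+ K2 <= #|[set f in ffun_on G | @inv_generates _ G K2 f]%SET|%:R].
Proof.
have [d1 d10 [N0 large]] := large_degree_inv_generates R.
have [K2 K20 [d2 d20 small]] := small_degree_inv_generates R N0.
exists 27%N, K2, (Num.min d1 1), (Num.min d2 1); split => //.
- by rewrite lt_min d10 ltr01 ge_min lexx orbT.
- by rewrite lt_min d20 ltr01 ge_min lexx orbT.
move=> T G AG; have [TN|TN] := leqP N0 #|T|; [left|right].
  by apply: le_trans (large T TN G AG); rewrite ler_wpM2r ?exprn_ge0 // ge_min lexx.
by apply: le_trans (small T (ltnW TN) G); rewrite ler_wpM2r ?exprn_ge0 // ge_min lexx.
Qed.

(** The base is a square in view of the bound on $\tau^2$, and [f] is arbitrary so that one
    statement serves all three moments. *)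
Lemma uniform_exp_moment : exists y M : R, [/\ 0 < y, 0 < M &
  forall (T : finType) (G : {group {perm T}}), ('Alt_T \subset G)%g ->
  forall (S : uniform_sequence R G) (D : R) (f : space S -> \bar R), 0 < D ->
    (forall w, 0 <= f w <= D%:E * expe_base ((1 + y) ^+ 2) (@waiting_time R _ G S w))%E ->
    (\int[law S]_w f w <= (D * M)%:E)%E].
Proof.
have [K1 [K2 [d1 [d2 [K10 K20 /andP[d10 d11] /andP[d20 d21] H]]]]] := uniform_inv_generates.
have [e1 e10 H1] := small_base K1 d10 d11.
have [e2 e20 H2] := small_base K2 d20 d21.
(* For $y\le1$, $(1+y)^2\le1+3y$; hence the division by 3. *)
pose y := Num.min 1 (Num.min e1 e2) / 3.
have y0 : 0 < y by rewrite divr_gt0 // !lt_min ltr01 e10.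
have y1 : 3 * y <= 1 by rewrite mulrC divfK // ge_min lexx.
have ye1 : 3 * y <= e1 by rewrite mulrC divfK // !ge_min lexx orbT.
have ye2 : 3 * y <= e2 by rewrite mulrC divfK // !ge_min lexx !orbT.
pose c := (1 + y) ^+ 2; have cE : c = 1 + (2 * y + y ^+ 2) by rewrite /c; ring.
have yy : y ^+ 2 <= y by rewrite expr2; nra.
have x0 : 0 <= 2 * y + y ^+ 2 by have := sqr_ge0 y; lra.
have c1 : 1 <= c by rewrite cE; lra.
have cp : 0 < c by apply: lt_le_trans c1.
have h1 : 0 < d1 / 2 by lra.
have M1 : 0 < c ^+ K1 / (d1 / 2) := divr_gt0 (exprn_gt0 _ cp) h1.
have h2 : 0 < d2 / 2 by lra.
have M2 : 0 < c ^+ K2 / (d2 / 2) := divr_gt0 (exprn_gt0 _ cp) h2.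
exists y, (c ^+ K1 / (d1 / 2) + c ^+ K2 / (d2 / 2)); split => //; first exact: addr_gt0.
move=> T G AG S D f D0 fb; case: (H T G AG) => HG.
  have ck : c ^+ K1 * (1 - d1) <= 1 - d1 / 2 by rewrite cE; apply: H1 => //; lra.
  apply: le_trans (integral_exp_waiting_time K10 d10 d11 HG D0 c1 ck fb) _.
  by rewrite lee_fin -mulrA ler_wpM2l ?ltW // ltrDl.
have ck : c ^+ K2 * (1 - d2) <= 1 - d2 / 2 by rewrite cE; apply: H2 => //; lra.
apply: le_trans (integral_exp_waiting_time K20 d20 d21 HG D0 c1 ck fb) _.
by rewrite lee_fin -mulrA ler_wpM2l ?ltW // ltrDr.
Qed.

Lemma expe_base_ge0 (c : R) t : 0 <= c -> (0 <= expe_base c t)%E.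
Proof. by move=> c0; case: t => [r| |] //=; rewrite lee_fin powR_ge0. Qed.

(** For a finite value [m] this is the square of $my\le(1+y)^m$. *)
Lemma waiting_time_sqr_le (gT : finGroupType) (G : {group gT})
    (S : uniform_sequence R G) (y : R) w : 0 < y ->
  (waiting_time w * waiting_time w <=
    (y ^- 2)%:E * expe_base ((1 + y) ^+ 2) (@waiting_time R _ G S w))%E.
Proof.
move=> y0; have y2 : 0 < y ^- 2 by rewrite invr_gt0 exprn_gt0.
case: (waiting_time_nat w) => [->|[m ->]] /=.
  by rewrite [X in (_ <= X)%E]gt0_muley ?leey ?lte_fin.
rewrite powR_mulrn; last exact: sqr_ge0.
rewrite -!EFinM lee_fin -exprM mulnC exprM.
rewrite [leRHS]mulrC ler_pdivlMr ?exprn_gt0 // -expr2 -exprMn.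
have y0' := ltW y0.
by apply: lerXn2r; rewrite ?expr1D_ge // nnegrE ?mulr_ge0 ?exprn_ge0 ?addr_ge0.
Qed.

Lemma chebotarev_ge1 (gT : finGroupType) (G : {group gT}) (S : uniform_sequence R G) :
  (1 <= chebotarev S)%E /\ (1 <= chebotarev2 S)%E.
Proof.
have int1 : (\int[law S]_w (cst 1 w) = 1)%E 
  by rewrite integral_cst // mul1e; exact: probability_setT.
have t1 w := @waiting_time_ge1 R gT G S w.
split; rewrite -int1; apply: ge0_le_integralT => w //=.
by rewrite -[leLHS]mule1; apply: lee_pmul.
Qed.

(** The first moment is bounded through $\tau\le\tau^2$, since $\tau\ge1$; [b] adds up the constants
    of the three bounds. *)
Lemma uniform_chebotarev : exists c b : R, [/\ 1 < c, 1 <= b &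
  forall (T : finType) (G : {group {perm T}}), ('Alt_T \subset G)%g ->
  forall S : uniform_sequence R G,
  [/\ (1 <= chebotarev S <= b%:E)%E, (1 <= chebotarev2 S <= b%:E)%E &
      (chebotarev_exp S c <= b%:E)%E]].
Proof.
have [y [M [y0 M0 H]]] := uniform_exp_moment.
have y2 : 0 < y ^- 2 by rewrite invr_gt0 exprn_gt0.
have c0 : 0 <= (1 + y) ^+ 2 by apply: sqr_ge0.
exists ((1 + y) ^+ 2), (1 + M + y ^- 2 * M); split.
- by rewrite exprn_egt1 //; lra.
- by rewrite -addrA lerDl addr_ge0 ?mulr_ge0 ?ltW.
move=> T G AG S; have [l1 l2] := chebotarev_ge1 S.
have My : 0 < y ^- 2 * M by rewrite mulr_gt0.
have t1 w := @waiting_time_ge1 R _ G S w.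
have t0 w : (0 <= @waiting_time R _ G S w)%E by apply: le_trans (t1 w); rewrite lee01.
have tt w : (waiting_time w <= waiting_time w * @waiting_time R _ G S w)%E.
  by rewrite -[leLHS]mule1; apply: lee_pmul.
split.
- rewrite l1 /=; apply: le_trans (H T G AG S (y ^- 2) _ y2 _) _.
    by move=> w; rewrite t0 /=; apply: le_trans (tt w) (waiting_time_sqr_le _ y0).
  by rewrite lee_fin; lra.
- rewrite l2 /=; apply: le_trans (H T G AG S (y ^- 2) _ y2 _) _.
    by move=> w; rewrite mule_ge0 //=; exact: waiting_time_sqr_le.
  by rewrite lee_fin; lra.
apply: le_trans (H T G AG S 1 _ ltr01 _) _.
  by move=> w; rewrite mul1e lexx andbT expe_base_ge0.
by rewrite lee_fin mul1r; lra.
Qed.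

End UniformBounds.

Theorem theorem6p1 (R : realType) :
  [/\ exists a b : R, [/\ 0 < a, 0 < b & forall n : nat, (1 <= n)%N ->
        forall S : uniform_sequence R 'Sym_('I_n)%G,
          (a%:E <= chebotarev S <= b%:E)%E],
      exists a b : R, [/\ 0 < a, 0 < b & forall n : nat, (1 <= n)%N ->
        forall S : uniform_sequence R 'Alt_('I_n)%G,
          (a%:E <= chebotarev S <= b%:E)%E],
      exists a b : R, [/\ 0 < a, 0 < b & forall n : nat, (1 <= n)%N ->
        forall S : uniform_sequence R 'Sym_('I_n)%G,
          (a%:E <= chebotarev2 S <= b%:E)%E],
      exists a b : R, [/\ 0 < a, 0 < b & forall n : nat, (1 <= n)%N ->
        forall S : uniform_sequence R 'Alt_('I_n)%G,
          (a%:E <= chebotarev2 S <= b%:E)%E]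
    & exists c : R, [/\ 1 < c,
        exists b : R, 0 < b /\ forall n : nat, (1 <= n)%N ->
          forall S : uniform_sequence R 'Sym_('I_n)%G,
            (chebotarev_exp S c <= b%:E)%E
      & exists b : R, 0 < b /\ forall n : nat, (1 <= n)%N ->
          forall S : uniform_sequence R 'Alt_('I_n)%G,
            (chebotarev_exp S c <= b%:E)%E]].
Proof.
have [c [b [c1 b1 H]]] := uniform_chebotarev R.
have b0 : 0 < b := lt_le_trans ltr01 b1.
have HS n S := H _ _ (Alt_subset 'I_n) S.
have HA n S := H _ ('Alt_('I_n))%G (subxx _) S.
split.
- by exists 1, b; split => // n _ S; case: (HS n S).
- by exists 1, b; split => // n _ S; case: (HA n S).
- by exists 1, b; split => // n _ S; case: (HS n S).
- by exists 1, b; split => // n _ S; case: (HA n S).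
exists c; split => //; exists b; split => // n _ S.
  by case: (HS n S).
by case: (HA n S).
Qed.
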